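(* Let $r\in\mathbb{N}$ and let $a\in(l_0(\mathbb{Z}))^{r\times r}$ be such that $m<\operatorname{sm}_\infty(a)\le m+1$ for some $m\in\mathbb{N}_0$. Then $1$ must be a simple eigenvalue of $\widehat{a}(0)$ and all the other eigenvalues of $\widehat{a}(0)$ must be less than $2^{-m}$ in modulus. Let $\upsilon_a\in(l_0(\mathbb{Z}))^{1\times r}$ be an order $m+1$ matching filter of $a$, i.e. (up to a multiplicative constant) its values at $0$ are given by $\widehat{\upsilon_a}(0)\ne 0$, $\widehat{\upsilon_a}(0)\widehat{a}(0)=\widehat{\upsilon_a}(0)$ and $$\widehat{\upsilon_a}^{(j)}(0)=\sum_{k=0}^{j-1}\frac{2^kj!}{k!(j-k)!}\widehat{\upsilon_a}^{(k)}(0)\,\widehat{a}^{(j-k)}(0)\,[I_r-2^j\widehat{a}(0)]^{-1},\qquad 1\le j\le m.$$ Let $\phi$ be the unique compactly supported refinable vector function satisfying $\widehat{\phi}(2\xi)=\widehat{a}(\xi)\widehat{\phi}(\xi)$ and $\widehat{\upsilon_a}(0)\widehat{\phi}(0)=1$ (note that $\operatorname{sm}_\infty(a)>m$ implies $\phi\in(C^m(\mathbb{R}))^r$). For $u\in(l_0(\mathbb{Z}))^r$, define $j:=\operatorname{ld}_m(\widehat{\upsilon_a}\widehat{u})$ and $\beta_j:=\frac{[\widehat{\upsilon_a}\widehat{u}]^{(j)}(0)}{i^jj!}$. If $$\widehat{\upsilon_a}(\xi)\widehat{u}(\xi)=\beta_j(i\xi)^j+O(|\xi|^{j+s}),\quad\xi\to0,\quad\text{with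 } s\in\mathbb{N}\text{ satisfying }1\le s\le m+1-j,$$ then for any $0<\varepsilon<\nu$ with $\nu:=\min(s,\operatorname{sm}_\infty(a)-j)>0$, there is a constant $C>0$ such that $$\big\|[(\mathcal{S}_a^n(\boldsymbol{\delta}I_r))*u](\cdot)2^{jn}-\beta_j\phi^{(j)}(2^{-n}\cdot)\big\|_{(l_\infty(\mathbb{Z}))^r}\le C2^{-(\nu-\varepsilon)n},\qquad\forall\,n\in\mathbb{N},$$ and for every $w_0\in(l(\mathbb{Z}))^{1\times r}$ and constant $K>0$, $$\max_{k\in\mathbb{Z}\cap[-2^nK,2^nK]}\big\|[(\mathcal{S}_a^nw_0)*u](k)2^{jn}-\beta_j\eta^{(j)}(2^{-n}k)\big\|\le C\,C_{K,N,w_0}2^{-(\nu-\varepsilon)n},\qquad\forall\,n\in\mathbb{N},$$ where $\eta:=\sum_{k\in\mathbb{Z}}w_0(k)\phi(\cdot-k)$, $C_{K,N,w_0}:=\sum_{k=-K-N}^{K+N}\|w_0(k)\|<\infty$ (sum over integers $k$ with $|k|\le K+N$), and $N\in\mathbb{N}$ is a fixed integer such that both the matrix mask $a$ and the sequence $u$ are supported inside $[-N,N]$.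
   Context: Notation. $\mathbb{N}_0=\mathbb{N}\cup\{0\}$. $(l(\mathbb{Z}))^{s\times r}$ is the space of all sequences $\mathbb{Z}\to\mathbb{C}^{s\times r}$, and $(l_0(\mathbb{Z}))^{s\times r}$ its subspace of finitely supported sequences; $(l_0(\mathbb{Z}))^r:=(l_0(\mathbb{Z}))^{r\times1}$. $\|\cdot\|_{(l_\infty(\mathbb{Z}))^r}$ is the sup norm of $\mathbb{C}^r$-valued sequences on $\mathbb{Z}$; $f(2^{-n}\cdot)$ inside it means the sequence $k\mapsto f(2^{-n}k)$, $k\in\mathbb{Z}$. $\boldsymbol{\delta}$ is the Dirac sequence ($\boldsymbol{\delta}(0)=1$, $\boldsymbol{\delta}(k)=0$ for $k\neq0$); $I_r$ is the $r\times r$ identity matrix. Convolution: $[u*v](j)=\sum_{k}u(j-k)v(k)$. Symbol: $\widehat{u}(\xi):=\sum_{k\in\mathbb{Z}}u(k)e^{-ik\xi}$. Fourier transform: $\widehat{f}(\xi)=\int_{\mathbb{R}}f(x)e^{-ix\xi}dx$, extended to tempered distributions. $C^m(\mathbb{R})$: $m$ times continuously differentiable functions. $\widehat f(\xi)=\widehat g(\xi)+O(|\xi|^{k})$, $\xi\to0$, means $\widehat f^{(j)}(0)=\widehat g^{(j)}(0)$ for $j=0,\dots,k-1$. Subdivision operator: $(\mathcal{S}_av)(j):=2\sum_{k\in\mathbb{Z}}v(k)a(j-2k)$ for $v\in(l(\mathbb{Z}))^{s\times r}$, $j\in\mathbb{Z}$. Matching filter: $\upsilon_a\in(l_0(\mathbb{Z}))^{1\times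 r}$ is an order $m+1$ matching filter of $a$ if $\widehat{\upsilon_a}(0)\neq0$ and $\widehat{\upsilon_a}(2\xi)\widehat{a}(\xi)=\widehat{\upsilon_a}(\xi)+O(|\xi|^{m+1})$ as $\xi\to0$. For a scalar trigonometric polynomial $\widehat{w}$: $\operatorname{ld}_m(\widehat{w}):=j$ if $j\in\{0,\ldots,m\}$, $\widehat{w}^{(j)}(0)\ne0$ and $\widehat{w}^{(\ell)}(0)=0$ for $\ell=0,\ldots,j-1$; $\operatorname{ld}_m(\widehat{w}):=m$ if $\widehat{w}^{(\ell)}(0)=0$ for all $\ell=0,\ldots,m$. Quantity $\operatorname{sm}_\infty(a)$: $a$ has order $k$ sum rules with a matching filter $v\in(l_0(\mathbb{Z}))^{1\times r}$ if $\widehat{v}(0)\neq0$, $\widehat{v}(2\xi)\widehat{a}(\xi)=\widehat{v}(\xi)+O(|\xi|^{k})$ and $\widehat{v}(2\xi)\widehat{a}(\xi+\pi)=O(|\xi|^{k})$ as $\xi\to0$. Let $\operatorname{sr}(a)$ be the largest $k\in\mathbb{N}_0$ such that $a$ has order $k$ sum rules with some matching filter, and let $v$ be such a filter for $k=\operatorname{sr}(a)$. With $\mathscr{V}_{j-1,v}:=\{u\in(l_0(\mathbb{Z}))^r:\widehat{v}(\xi)\widehat{u}(\xi)=O(|\xi|^{j}),\ \xi\to0\}$ (so $\mathscr{V}_{-1,v}=(l_0(\mathbb{Z}))^r$), put $\rho_j(a,v)_\infty:=\sup\{\limsup_{n\to\infty}\|(\mathcal{S}_a^n(\boldsymbol{\delta}I_r))*u\|_{(l_\infty(\mathbb{Z}))^r}^{1/n}:u\in\mathscr{V}_{j-1,v}\}$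 and $\operatorname{sm}_\infty(a):=-\log_2\rho_{\operatorname{sr}(a)}(a,v)_\infty$ (the value does not depend on the choice of $v$).
   Formalization: The added hypothesis sr(a) ≥ 1 (a satisfies sum rules of some positive order) is needed: for r = 1, a = δ/4 one has sr(a) = 0 and sm_∞(a) = 1, yet 1 is not an eigenvalue of â(0); whenever sr(a) = 0 and sm_∞(a) > 0 the claim fails. *)

(* Defs.v *)
From HB Require Import structures.
From mathcomp Require Import all_boot all_order all_algebra.
From mathcomp Require Import all_classical all_reals all_analysis.
From mathcomp.real_closed Require Import complex.

Set Implicit Arguments.
Unset Strict Implicit.
Unset Printing Implicit Defensive.

Import Order.TTheory GRing.Theory Num.Theory.
Import numFieldNormedType.Exports.

Local Open Scope classical_set_scope.
Local Open Scope complex_scope.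
Local Open Scope ring_scope.

(* R[i] carries no normed R-module structure, so the derivatives, smoothness  *)
(* and integrals of functions R -> R[i] are taken on real and imaginary parts *)
Section complex_valued_functions.
Context {R : realType}.

Definition cderiven (n : nat) (f : R -> R[i]) (x : R) : R[i] :=
  (derive1n n (fun t => complex.Re (f t)) x) +i*
  (derive1n n (fun t => complex.Im (f t)) x).

Definition real_class_C (m : nat) (g : R -> R) : Prop :=
  (forall n x, (n < m)%N -> derivable (derive1n n g) x 1) /\
  (forall n, (n <= m)%N -> continuous (derive1n n g)).

Definition class_C (m : nat) (f : R -> R[i]) : Prop :=
  real_class_C m (fun t => complex.Re (f t)) /\
  real_class_C m (fun t => complex.Im (f t)).

Definition smooth (f : R -> R[i]) : Prop := forall m, class_C m f.

Definition cintegral (f : R -> R[i]) : R[i] :=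
  (Rintegral lebesgue_measure setT (fun t => complex.Re (f t))) +i*
  (Rintegral lebesgue_measure setT (fun t => complex.Im (f t))).

(* x |-> e^{ix} *)
Definition cis (x : R) : R[i] := cos x +i* sin x.

(* f(xi) = g(xi) + O(|xi|^k) as xi -> 0, in the sense that the derivatives of *)
(* order < k agree at 0                                                       *)
Definition eqO (k : nat) (f g : R -> R[i]) : Prop :=
  forall l, (l < k)%N -> cderiven l f 0 = cderiven l g 0.

Definition ld (m : nat) (w : R -> R[i]) : nat :=
  head m [seq l <- iota 0 m.+1 | cderiven l w 0 != 0].

End complex_valued_functions.

Section matrix_valued_functions.
Context {R : realType} {p q : nat}.

Definition mxderiven (n : nat) (F : R -> 'M[R[i]]_(p, q)) (x : R) :
    'M[R[i]]_(p, q) :=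
  \matrix_(i, j) cderiven n (fun t => F t i j) x.

Definition mxeqO (k : nat) (F G : R -> 'M[R[i]]_(p, q)) : Prop :=
  forall i j, eqO k (fun t => F t i j) (fun t => G t i j).

(* the largest modulus of an entry; the choice of the norm is immaterial      *)
Definition entry_norm (A : 'M[R[i]]_(p, q)) : R :=
  \big[Num.max/0]_i \big[Num.max/0]_j ComplexField.Normc.normc (A i j).

Definition linf_norm (v : int -> 'M[R[i]]_(p, q)) : \bar R :=
  ereal_sup (range (fun k => (entry_norm (v k))%:E)).

Definition supported_in (N : nat) (u : int -> 'M[R[i]]_(p, q)) : Prop :=
  forall k, (N < `|k|)%N -> u k = 0.

Definition fin_supp (u : int -> 'M[R[i]]_(p, q)) : Prop :=
  exists N, supported_in N u.

(* Here and below \sum_(k \in A) is the finitely supported sum; it equals 0   *)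
(* by convention when infinitely many terms are nonzero.                      *)
Definition symbol (u : int -> 'M[R[i]]_(p, q)) (xi : R) : 'M[R[i]]_(p, q) :=
  \sum_(k \in [set: int]) cis (- (k%:~R * xi)) *: u k.

End matrix_valued_functions.

Section subdivision.
Context {R : realType}.
Notation C := R[i].

Definition dirac_id (r : nat) : int -> 'M[C]_r :=
  fun k => if k == 0 then 1%:M else 0.

Definition convolution (p q s : nat)
    (u : int -> 'M[C]_(p, q)) (v : int -> 'M[C]_(q, s)) : int -> 'M[C]_(p, s) :=
  fun j => \sum_(k \in [set: int]) (u (j - k) *m v k).

Definition subdivision (s r : nat) (a : int -> 'M[C]_r)
    (v : int -> 'M[C]_(s, r)) : int -> 'M[C]_(s, r) :=
  fun j => 2%:R *: \sum_(k \in [set: int]) (v k *m a (j - 2%:Z * k)).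

Definition matching_filter (r : nat) (a : int -> 'M[C]_r) (k : nat)
    (v : int -> 'rV[C]_r) : Prop :=
  [/\ fin_supp v,
      symbol v 0 != 0 &
      mxeqO k (fun xi => symbol v (2%:R * xi) *m symbol a xi) (symbol v)].

Definition sum_rules (r : nat) (a : int -> 'M[C]_r) (k : nat)
    (v : int -> 'rV[C]_r) : Prop :=
  matching_filter a k v /\
  mxeqO k (fun xi => symbol v (2%:R * xi) *m symbol a (xi + pi)) (fun=> 0).

(* Order 0 sum rules hold for every filter nonvanishing at 0. The value is 0  *)
(* by convention if there is no largest order.                                *)
Definition sr (r : nat) (a : int -> 'M[C]_r) : nat :=
  xget 0%N [set k | (exists v, sum_rules a k v) /\
                    forall k' v, sum_rules a k' v -> (k' <= k)%N].

Definition sr_filter (r : nat) (a : int -> 'M[C]_r) : int -> 'rV[C]_r :=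
  xget (fun=> 0) [set v | sum_rules a (sr a) v].

(* the space written V_{j-1,v} in the literature                              *)
Definition vanishing_space (r : nat) (j : nat) (v : int -> 'rV[C]_r) :
    set (int -> 'cV[C]_r) :=
  [set u | fin_supp u /\ mxeqO j (fun xi => symbol v xi *m symbol u xi) (fun=> 0)].

Definition rho_infty (r : nat) (a : int -> 'M[C]_r) (j : nat)
    (v : int -> 'rV[C]_r) : \bar R :=
  ereal_sup [set limn_esup (fun n : nat =>
      (linf_norm (convolution (iter n (subdivision a) (dirac_id r)) u)
        `^ (n%:R^-1))%E)
    | u in vanishing_space j v].

Definition sm_infty (r : nat) (a : int -> 'M[C]_r) : \bar R :=
  (- (lne (rho_infty a (sr a) (sr_filter a)) * ((ln 2%:R)^-1)%:E))%E.

End subdivision.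

(* A compactly supported distribution is a functional on C^oo(R), continuous  *)
(* for uniform convergence of all derivatives on compact sets; as functionals *)
(* take every function as argument, two distributions are the same when they  *)
(* agree on smooth functions.                                                 *)
Section distributions.
Context {R : realType}.
Notation C := R[i].

Definition compact_distribution (T : (R -> C) -> C) : Prop :=
  (forall (c : C) (f g : R -> C), smooth f -> smooth g ->
     T (fun x => c * f x + g x) = c * T f + T g) /\
  exists (K B : R) (M : nat), forall f : R -> C, smooth f -> forall c : R,
    (forall k x, (k <= M)%N -> `|x| <= K ->
       ComplexField.Normc.normc (cderiven k f x) <= c) ->
    ComplexField.Normc.normc (T f) <= B * c.

Definition fourier (T : (R -> C) -> C) (xi : R) : C :=
  T (fun x => cis (- (x * xi))).

Definition vec_fourier (r : nat) (Phi : 'I_r -> (R -> C) -> C) (xi : R) :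
    'cV[C]_r :=
  \col_i fourier (Phi i) xi.

Definition distribution_of (r : nat) (phi : R -> 'cV[C]_r) :
    'I_r -> (R -> C) -> C :=
  fun i f => cintegral (fun x => phi x i 0 * f x).

Definition normalized_refinable (r : nat) (a : int -> 'M[C]_r)
    (v : int -> 'rV[C]_r) (Phi : 'I_r -> (R -> C) -> C) : Prop :=
  [/\ forall i, compact_distribution (Phi i),
      forall xi, vec_fourier Phi (2%:R * xi) = symbol a xi *m vec_fourier Phi xi &
      symbol v 0 *m vec_fourier Phi 0 = 1%:M].

End distributions.

(* Main.v *)
Require Import Defs.
From HB Require Import structures.
From mathcomp Require Import all_boot all_order all_algebra.
From mathcomp Require Import all_classical all_reals all_analysis.
From mathcomp.real_closed Require Import complex.
From mathcomp Require Import zify ring lra.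

Import Order.TTheory GRing.Theory Num.Theory.
Import numFieldNormedType.Exports.
Local Open Scope classical_set_scope.
Local Open Scope complex_scope.
Local Open Scope ring_scope.

(* Write A_n for the n-th subdivision iterate of the Dirac sequence. By the
   definition of sm_infty, A_n * u grows at most like kappa^n, for every
   kappa > 2^-sm, as soon as u annihilates all the moments controlled by the
   sum rules. Splitting u into its two polyphase components extends this to
   sequences annihilating only the moments of order < j, with
   kappa > max(2^-j, 2^-sm), by downward induction on j. Applied to finite sums
   of A_n * u this bounds the powers of the symbol of a at 0 on the kernel of
   the filter, whence the spectral statement; it also forces sr a > m.

   Choose z with v^(0) z = 1 and d = z delta. The sequences
   2^(jn) A_n * nabla^j d, sampled at 2^-n Z, converge geometrically to
   continuous functions L_j; L_0 is the refinable function phi and L_j its j-th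
   derivative. For a general u the increments of 2^(jn) A_n * u under dyadic
   refinement are 2^(jn) A_n * w with w annihilating j + s moments, which gives
   the rate by telescoping.

   For uniqueness, the difference of two solutions has a Fourier transform D
   with D(0) = 0 and D(xi) = 2^-n A_n^(2^-n xi) D(2^-n xi), and the factors
   tend to 0; a compactly supported distribution whose Fourier transform
   vanishes kills the polynomials, which are dense in C^M of a segment. *)

Set Implicit Arguments.
Unset Strict Implicit.
Unset Printing Implicit Defensive.

(** * Finitely supported sums over the integers *)

(** The conditions O(|xi|^k) concern Taylor coefficients at 0 of symbols of finite sequences, which
    are, up to powers of -i, the moments sum k^l u(k). The argument is carried out on moments;
    derivatives of symbols occur only at the interface with the statement. The exponent is defined
    through one filter of order [sr a], while the statement allows any filter of order m + 1. The
    two can be compared only once 1 is known to be simple and 1 - 2^l a^(0) invertible for 1 <= l <=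
    m, since then the value at 0 determines the coefficients up to order m. Hence the spectral facts
    have to precede the analysis. The scale 2^-j comes from the identity (A_(n+1) * u)(2k + g) =
    (A_n * P_g u)(k): if u annihilates the moments below j, then P_g u - 2^-j u annihilates one
    more. For g = 0 the moments do not even mix, the l-th moment of P_0 u being 2^-l times that of
    u. A gap of s vanishing moments thus survives along k, 2k, 4k, ..., that is, at a fixed dyadic
    point, and this is how s enters the rate. *)

Definition zwin (N : nat) : seq int :=
  [seq i%:Z - N%:Z | i <- iota 0 N.*2.+1].

Lemma mem_zwin (N : nat) (k : int) : (k \in zwin N) = (`|k| <= N)%N.
Proof.
apply/mapP/idP => [[x]|kN]; first by rewrite mem_iota => ? ->; lia.
by exists (absz (k + N%:Z)); rewrite ?mem_iota; lia.
Qed.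

Lemma zwin_uniq (N : nat) : uniq (zwin N).
Proof. by rewrite map_inj_uniq ?iota_uniq// => i j; lia. Qed.

Definition fsupp (V : nmodType) (F : int -> V) : Prop :=
  exists N, forall k, (N < `|k|)%N -> F k = 0.

(** The sum over all integers is 0 by convention when infinitely many terms are nonzero, so most
    manipulations first pass to a window containing the support, where the sum is an ordinary finite
    one. *)
Lemma zsum_win (V : nmodType) (N : nat) (F : int -> V) :
  (forall k, (N < `|k|)%N -> F k = 0) ->
  \sum_(k \in [set: int]) F k = \sum_(k <- zwin N) F k.
Proof.
move=> F0; rewrite (fsbigE (zwin N)) ?zwin_uniq//.
  by apply: eq_bigl => k; rewrite in_setT.
by move=> k _; rewrite mem_zwin -ltnNge; exact: F0.
Qed.

Lemma zsumD (V : nmodType) (F G : int -> V) : fsupp F -> fsupp G ->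
  \sum_(k \in [set: int]) (F k + G k) =
  \sum_(k \in [set: int]) F k + \sum_(k \in [set: int]) G k.
Proof.
move=> [N FN] [M GM]; rewrite !(@zsum_win _ (maxn N M)) ?big_split//.
- by move=> k kM; apply: GM; lia.
- by move=> k kM; apply: FN; lia.
- by move=> k kM; rewrite FN ?GM ?addr0//; lia.
Qed.

Lemma zsum_raddf (V W : nmodType) (f : {additive V -> W}) (F : int -> V) :
  fsupp F ->
  f (\sum_(k \in [set: int]) F k) = \sum_(k \in [set: int]) f (F k).
Proof.
move=> [N FN]; rewrite !(@zsum_win _ N) ?raddf_sum// => k /FN ->.
by rewrite raddf0.
Qed.

Lemma zsum_exchange (V : nmodType) (F : int -> int -> V) (N : nat) :
  (forall j k, (N < `|j|)%N || (N < `|k|)%N -> F j k = 0) ->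
  \sum_(j \in [set: int]) \sum_(k \in [set: int]) F j k =
  \sum_(k \in [set: int]) \sum_(j \in [set: int]) F j k.
Proof.
move=> F0.
have FE j : \sum_(k \in [set: int]) F j k = \sum_(k <- zwin N) F j k.
  by apply: zsum_win => k kN; apply: F0; rewrite kN orbT.
have FE' k : \sum_(j \in [set: int]) F j k = \sum_(j <- zwin N) F j k.
  by apply: zsum_win => j jN; apply: F0; rewrite jN.
under eq_fsbigr do rewrite FE.
under [RHS]eq_fsbigr do rewrite FE'.
rewrite !(@zsum_win _ N) 1?exchange_big//.
  by move=> k kN; rewrite big1// => j _; apply: F0; rewrite kN orbT.
by move=> k kN; rewrite big1// => j _; apply: F0; rewrite kN.
Qed.

Lemma zsum_shift (V : nmodType) (c : int) (F : int -> V) :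
  \sum_(k \in [set: int]) F (k + c) = \sum_(k \in [set: int]) F k.
Proof.
symmetry; apply: (reindex_fsbigT (fun k => k + c)).
by exists (fun k => k - c) => k; rewrite ?addrK ?subrK.
Qed.

Lemma zsum_refl (V : nmodType) (c : int) (F : int -> V) :
  \sum_(k \in [set: int]) F (c - k) = \sum_(k \in [set: int]) F k.
Proof.
symmetry; apply: (reindex_fsbigT (fun k => c - k)).
by exists (fun k => c - k) => k; rewrite opprB addrC subrK.
Qed.

(** Zeroing the odd terms, instead of restricting the index set, keeps a sum over all integers;
    twice the right side is then the sum of the F k + (-1)^k F k. *)
Lemma zsum_even (V : nmodType) (F : int -> V) :
  \sum_(k \in [set: int]) F (2 * k) =
  \sum_(k \in [set: int]) (if odd `|k| then 0 else F k).
Proof.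
rewrite -(fsbig_widen [set 2 * k | k in [set: int]] [set: int]
  (fun k => if odd `|k| then 0 else F k))//=; last first.
  move=> k /= [_ /= Hk]; case: ifPn => // kev; exfalso; apply: Hk.
  exists (if 0 <= k then (`|k| %/ 2)%N%:Z else - (`|k| %/ 2)%N%:Z) => //.
  by case: ifPn => ?; lia.
rewrite fsbig_image; last by move=> x y _ _; lia.
by apply: eq_fsbigr => k _; rewrite ifF//; lia.
Qed.

Lemma zsum1 (V : nmodType) (i : int) (F : int -> V) :
  (forall k, k != i -> F k = 0) -> \sum_(k \in [set: int]) F k = F i.
Proof.
move=> F0; rewrite -(fsbig_widen [set i] [set: int] F) ?fsbig_set1//.
by move=> k /= [_ /eqP]; exact: F0.
Qed.

(** * Convolution and subdivision *)

Section sequences.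
Context {R : realType}.
Notation C := R[i].

Lemma zsum_scale (V : lmodType C) (c : C) (F : int -> V) : fsupp F ->
  c *: (\sum_(k \in [set: int]) F k) = \sum_(k \in [set: int]) (c *: F k).
Proof. exact: (@zsum_raddf _ _ ( *:%R c)). Qed.

Lemma zsum_mulmxr (p q s : nat) (A : 'M[C]_(p, q)) (F : int -> 'M[C]_(q, s)) :
  fsupp F ->
  A *m (\sum_(k \in [set: int]) F k) = \sum_(k \in [set: int]) (A *m F k).
Proof. exact: (@zsum_raddf _ _ (mulmx A)). Qed.

Lemma zsum_mulmxl (p q s : nat) (A : 'M[C]_(q, s)) (F : int -> 'M[C]_(p, q)) :
  fsupp F ->
  (\sum_(k \in [set: int]) F k) *m A = \sum_(k \in [set: int]) (F k *m A).
Proof. exact: (@zsum_raddf _ _ (mulmxr A)). Qed.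

Lemma supported_inW (p q N M : nat) (u : int -> 'M[C]_(p, q)) :
  (N <= M)%N -> supported_in N u -> supported_in M u.
Proof. by move=> NM uN k kM; apply: uN; exact: leq_ltn_trans kM. Qed.

Lemma fin_suppD (p q : nat) (u v : int -> 'M[C]_(p, q)) :
  fin_supp u -> fin_supp v -> fin_supp (fun k => u k + v k).
Proof.
move=> [N uN] [M vM]; exists (maxn N M) => k kM.
by rewrite uN ?vM ?addr0//; lia.
Qed.

Lemma fin_suppZ (p q : nat) (f : int -> C) (u : int -> 'M[C]_(p, q)) :
  fin_supp u -> fin_supp (fun k => f k *: u k).
Proof. by move=> [N uN]; exists N => k /uN ->; rewrite scaler0. Qed.

Lemma fin_suppB (p q : nat) (u v : int -> 'M[C]_(p, q)) :
  fin_supp u -> fin_supp v -> fin_supp (fun k => u k - v k).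
Proof.
move=> [N uN] [M vM]; exists (maxn N M) => k kM.
by rewrite uN ?vM ?subr0//; lia.
Qed.

Lemma fin_supp_shift (p q : nat) (c : int) (u : int -> 'M[C]_(p, q)) :
  fin_supp u -> fin_supp (fun k => u (k + c)).
Proof. by move=> [N uN]; exists (N + `|c|)%N => k kM; apply: uN; lia. Qed.

Lemma convolution_supp (p q s N M : nat) (u : int -> 'M[C]_(p, q))
    (v : int -> 'M[C]_(q, s)) : supported_in N u -> supported_in M v ->
  supported_in (N + M) (convolution u v).
Proof.
move=> uN vM k kNM; apply: fsbig1 => j _.
have [jM|jM] := ltnP M `|j|%N; first by rewrite vM// mulmx0.
by rewrite uN ?mul0mx//; lia.
Qed.

Lemma fin_supp_conv (p q s : nat) (u : int -> 'M[C]_(p, q))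
    (v : int -> 'M[C]_(q, s)) :
  fin_supp u -> fin_supp v -> fin_supp (convolution u v).
Proof. by move=> [N uN] [M vM]; exists (N + M)%N; exact: convolution_supp. Qed.

(** The weight [f] is arbitrary so that the identity serves both moments, where it is a polynomial,
    and symbols, where it is an exponential. [subdivision_sum] is its analogue for a subdivision
    step. *)
Lemma conv_sum (p q s : nat) (f : int -> C) (u : int -> 'M[C]_(p, q))
    (v : int -> 'M[C]_(q, s)) : fin_supp u -> fin_supp v ->
  \sum_(j \in [set: int]) f j *: convolution u v j =
  \sum_(x \in [set: int]) \sum_(y \in [set: int]) f (x + y) *: (u x *m v y).
Proof.
move=> [N uN] [M vM].
transitivity (\sum_(j \in [set: int]) \sum_(k \in [set: int])
    f j *: (u (j - k) *m v k)).
  apply: eq_fsbigr => j _; rewrite zsum_scale//.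
  by exists M => k /vM ->; rewrite mulmx0.
have supp0 (j k : int) : (N + M < `|(j + k)%R|)%N || (N + M < `|j|)%N || (N + M < `|k|)%N ->
    u j *m v k = 0.
  move=> jk; have [kM|kM] := ltnP M `|k|%N; first by rewrite vM// mulmx0.
  by rewrite uN ?mul0mx//; lia.
etransitivity.
  apply: (@zsum_exchange _ _ (N + M)) => j k jk /=.
  by rewrite supp0 ?scaler0//; lia.
symmetry; etransitivity.
  apply: (@zsum_exchange _ _ (N + M)) => j k jk /=.
  by rewrite supp0 ?scaler0//; lia.
symmetry.
apply: eq_fsbigr => k _.
rewrite /= -[LHS](zsum_shift k); apply: eq_fsbigr => j _.
by rewrite addrK.
Qed.

(** The factor 2 is the one of the subdivision operator, so that [subdivision_conv] carries no
    constant. *)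
Definition polyphase (r s : nat) (a : int -> 'M[C]_r) (g : int)
    (u : int -> 'M[C]_(r, s)) (k : int) : 'M[C]_(r, s) :=
  2%:R *: convolution a u (2 * k + g).

Lemma fin_supp_polyphase (r s : nat) (a : int -> 'M[C]_r) (g : int)
    (u : int -> 'M[C]_(r, s)) :
  fin_supp a -> fin_supp u -> fin_supp (polyphase a g u).
Proof.
move=> fa fu; have [N uN] := fin_supp_conv fa fu.
by exists (N + `|g|)%N => k kN; rewrite /polyphase uN ?scaler0//; lia.
Qed.

(** Read on one residue class modulo 2, a subdivision step is transferred from [b] to [u]. The
    growth of the iterates can thus be studied through two operators acting on finite sequences. *)
Lemma subdivision_conv (p r s : nat) (a : int -> 'M[C]_r)
    (b : int -> 'M[C]_(p, r)) (u : int -> 'M[C]_(r, s)) (g k : int) :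
  fin_supp a -> fin_supp u ->
  convolution (subdivision a b) u (2 * k + g) =
  convolution b (polyphase a g u) k.
Proof.
move=> [N aN] [M uM].
rewrite {2}/convolution -(zsum_refl k).
transitivity (\sum_(z \in [set: int]) \sum_(x \in [set: int])
    2%:R *: (b x *m a (2 * k + g - z - 2 * x) *m u z)).
  apply: eq_fsbigr => z _; rewrite /subdivision -scalemxAl.
  have fs : fsupp (fun x => b x *m a (2 * k + g - z - 2 * x)).
    exists (N + absz (2 * k + g - z)%R)%N => x xN.
    by rewrite aN ?mulmx0//; lia.
  rewrite zsum_mulmxl ?zsum_scale//.
  by case: fs => L fL; exists L => x /fL ->; rewrite mul0mx.
etransitivity.
  apply: (@zsum_exchange _ _ (N + M + absz (2 * k + g)%R)).
  move=> z x zx; have [kM|kM] := ltnP M `|z|%N.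
    by rewrite uM// mulmx0 scaler0.
  by rewrite aN ?mulmx0 ?mul0mx ?scaler0//; lia.
apply: eq_fsbigr => x _.
rewrite /polyphase -scalemxAr subKr zsum_mulmxr; last first.
  by exists M => z /uM ->; rewrite mulmx0.
rewrite zsum_scale; last by exists M => z /uM ->; rewrite !mulmx0.
apply: eq_fsbigr => z _; rewrite mulmxA.
by have -> : 2 * (k - x) + g - z = 2 * k + g - z - 2 * x by lia.
Qed.

Lemma iter_subdivision_conv (r s : nat) (a : int -> 'M[C]_r)
    (u : int -> 'M[C]_(r, s)) (g k : int) (n : nat) :
  fin_supp a -> fin_supp u ->
  convolution (iter n.+1 (subdivision a) (dirac_id r)) u (2 * k + g) =
  convolution (iter n (subdivision a) (dirac_id r)) (polyphase a g u) k.
Proof. by move=> fa fu; rewrite iterS subdivision_conv. Qed.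

(** The bound solves L_(n+1) = 2 L_n + N with L_0 = 0. Divided by 2^n it stays below N, which
    confines the limit functions to [-N, N]. *)
Lemma iter_subdivision_supp (r N n : nat) (a : int -> 'M[C]_r) :
  supported_in N a ->
  supported_in ((2 ^ n).-1 * N) (iter n (subdivision a) (dirac_id r)).
Proof.
move=> aN; elim: n => [|n IH] k kN.
  by rewrite /= /dirac_id ifF//; apply/negbTE; lia.
rewrite /= /subdivision fsbig1 ?scaler0// => x _.
have [xN|xN] := ltnP ((2 ^ n).-1 * N) `|x|%N; first by rewrite IH// mul0mx.
rewrite aN ?mulmx0//.
have e2 : (2 ^ n.+1).-1 = ((2 ^ n).-1).*2.+1.
  by rewrite expnS; have := expn_gt0 2 n; lia.
by move: kN; rewrite e2 mulSn -doubleMl; lia.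
Qed.

Lemma fin_supp_iter_subdivision (r n : nat) (a : int -> 'M[C]_r) :
  fin_supp a -> fin_supp (iter n (subdivision a) (dirac_id r)).
Proof. by move=> [N aN]; eexists; apply: iter_subdivision_supp aN. Qed.

(** Subdivision turns a shift by l into a shift by 2l, so the general case follows from the Dirac
    sequence by superposition. The support of [w] may be infinite: at a given [j] only finitely many
    terms are nonzero. *)
Lemma iter_subdivisionE (p r n : nat) (a : int -> 'M[C]_r)
    (w : int -> 'M[C]_(p, r)) (j : int) : fin_supp a ->
  iter n (subdivision a) w j =
  \sum_(l \in [set: int])
    (w l *m iter n (subdivision a) (dirac_id r) (j - (2 ^ n)%N%:Z * l)).
Proof.
move=> [N aN]; elim: n j => [|n IH] j.
  rewrite /= (zsum1 (i := j)) => [|k kj].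
    by rewrite /dirac_id mul1r subrr eqxx mulmx1.
  by rewrite /dirac_id ifF ?mulmx0//; apply/negbTE; move: kj; lia.
have fA := @iter_subdivision_supp r N n a aN.
set A := iter n _ (dirac_id r) in IH fA *; set L := ((2 ^ n).-1 * N)%N in fA.
have big (l : int) : (absz l <= absz ((2 ^ n)%N%:Z * l)%R)%N.
  by rewrite abszM leq_pmull// absz_nat expn_gt0.
rewrite iterS /subdivision.
transitivity (2%:R *: \sum_(k \in [set: int]) \sum_(l \in [set: int])
    (w l *m A (k - (2 ^ n)%N%:Z * l) *m a (j - 2 * k))).
  congr (_ *: _); apply: eq_fsbigr => k _; rewrite IH zsum_mulmxl//.
  exists (L + `|k|)%N => l lL; rewrite fA ?mulmx0//.
  by move: (big l); lia.
transitivity (2%:R *: \sum_(l \in [set: int]) \sum_(k \in [set: int])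
    (w l *m A (k - (2 ^ n)%N%:Z * l) *m a (j - 2 * k))).
  congr (_ *: _); apply: (@zsum_exchange _ _ (N + `|j| + L)) => k l kl /=.
  have [kM|kM] := ltnP N (absz (j - 2 * k)%R); first by rewrite aN// mulmx0.
  by rewrite fA ?mulmx0 ?mul0mx//; move: (big l); lia.
rewrite zsum_scale; last first.
  exists (N + `|j| + L)%N => l lN; apply: fsbig1 => k _.
  have [kM|kM] := ltnP N (absz (j - 2 * k)%R); first by rewrite aN// mulmx0.
  rewrite fA ?mulmx0 ?mul0mx//.
  by move: (big l); lia.
apply: eq_fsbigr => l _; rewrite iterS -scalemxAr; congr (_ *: _).
rewrite zsum_mulmxr; last first.
  by exists L => k /fA; rewrite /A => ->; rewrite mul0mx.
rewrite -[LHS](zsum_shift ((2 ^ n)%N%:Z * l)); apply: eq_fsbigr => k _.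
rewrite addrK mulmxA; congr (_ *m a _).
by rewrite expnS PoszM mulrDr mulrA; lia.
Qed.

End sequences.

(** * Moments *)

Section moments.
Context {R : realType}.
Notation C := R[i].

(** For ['X^n] this is the n-th derivative of the symbol at 0 up to the factor (-i)^n, see
    [cderiven_symbol0]. *)
Definition pmom (p q : nat) (f : {poly C}) (u : int -> 'M[C]_(p, q)) :
  'M[C]_(p, q) := \sum_(k \in [set: int]) f.[k%:~R] *: u k.

(** Agreement of two symbols to order n at 0. Quantifying over all polynomials of degree below n,
    rather than over monomials, makes the relation stable under the affine substitutions brought in
    by shifts, convolution and subdivision. *)
Definition mom_eq (p q : nat) (n : nat) (u v : int -> 'M[C]_(p, q)) : Prop :=
  forall f : {poly C}, (size f <= n)%N -> pmom f u = pmom f v.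

(** On symbols this is the shift by pi, see [symbol_shift_pi]. *)
Definition alternate (p q : nat) (u : int -> 'M[C]_(p, q)) :
  int -> 'M[C]_(p, q) := fun k => (-1) ^+ `|k| *: u k.

Definition affpoly (b c : C) (f : {poly C}) : {poly C} :=
  f \Po (b *: 'X + c%:P).

Lemma horner_affpoly (b c : C) (f : {poly C}) (t : C) :
  (affpoly b c f).[t] = f.[b * t + c].
Proof. by rewrite /affpoly horner_comp !hornerE. Qed.

Lemma size_affpoly (b c : C) (f : {poly C}) :
  (size (affpoly b c f) <= size f)%N.
Proof.
have [->|f0] := eqVneq f 0; first by rewrite /affpoly comp_poly0.
rewrite /affpoly; apply: (leq_trans (size_comp_poly_leq _ _)).
have s2 : (size (b *: 'X + c%:P)%R <= 2)%N.
  rewrite (leq_trans (size_polyD _ _))// geq_max.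
  rewrite (leq_trans (size_scale_leq _ _)) ?size_polyX//=.
  by rewrite (leq_trans (size_polyC_leq1 _)).
have : (0 < size f)%N by rewrite lt0n size_poly_eq0.
case: (size f) => // n _ /=; rewrite ltnS.
by case: (size _) s2 => [|[|[|]]]//= _; rewrite ?muln0 ?muln1.
Qed.

Lemma alternate_sign (x y : int) :
  (-1) ^+ `|(x + y)%R| = (-1) ^+ `|x| * (-1) ^+ `|y| :> C.
Proof.
rewrite -exprD -signr_odd -[RHS]signr_odd.
by have -> : odd `|(x + y)%R| = odd (`|x| + `|y|) by lia.
Qed.

Lemma fin_supp_alternate (p q : nat) (u : int -> 'M[C]_(p, q)) :
  fin_supp u -> fin_supp (alternate u).
Proof. exact: fin_suppZ. Qed.

Section fixed_dim.
Variables p q : nat.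
Implicit Types u v : int -> 'M[C]_(p, q).

Lemma fsupp_pmom (f : {poly C}) u : fin_supp u ->
  fsupp (fun k => f.[k%:~R] *: u k).
Proof. by move=> [N uN]; exists N => k /uN ->; rewrite scaler0. Qed.

Lemma pmomDl (f g : {poly C}) u : fin_supp u ->
  pmom (f + g) u = pmom f u + pmom g u.
Proof.
move=> fu; rewrite /pmom -zsumD; try exact: fsupp_pmom.
by apply: eq_fsbigr => k _; rewrite hornerD scalerDl.
Qed.

Lemma pmomZl (c : C) (f : {poly C}) u : fin_supp u ->
  pmom (c *: f) u = c *: pmom f u.
Proof.
move=> fu; rewrite /pmom zsum_scale; last exact: fsupp_pmom.
by apply: eq_fsbigr => k _; rewrite hornerZ scalerA.
Qed.

Lemma pmom0l u : pmom 0 u = 0.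
Proof. by apply: fsbig1 => k _; rewrite horner0 scale0r. Qed.

Lemma pmomDr (f : {poly C}) u v : fin_supp u -> fin_supp v ->
  pmom f (fun k => u k + v k) = pmom f u + pmom f v.
Proof.
move=> fu fv; rewrite /pmom -zsumD; try exact: fsupp_pmom.
by apply: eq_fsbigr => k _; rewrite scalerDr.
Qed.

Lemma pmomZr (c : C) (f : {poly C}) u : fin_supp u ->
  pmom f (fun k => c *: u k) = c *: pmom f u.
Proof.
move=> fu; rewrite /pmom zsum_scale; last exact: fsupp_pmom.
by apply: eq_fsbigr => k _; rewrite !scalerA mulrC.
Qed.

Lemma pmomBr (f : {poly C}) u v : fin_supp u -> fin_supp v ->
  pmom f (fun k => u k - v k) = pmom f u - pmom f v.
Proof.
move=> fu fv; rewrite -scaleN1r -pmomZr// -pmomDr//; last exact: fin_suppZ.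
by apply: eq_fsbigr => k _; rewrite scaleN1r.
Qed.

Lemma pmom_shift (f : {poly C}) u (g : int) :
  pmom f (fun k => u (k + g)) = pmom (affpoly 1 (- g%:~R) f) u.
Proof.
rewrite /pmom -[LHS](zsum_shift (- g)); apply: eq_fsbigr => k _.
by rewrite subrK horner_affpoly mul1r rmorphB.
Qed.

Lemma mom_eqP n u v : fin_supp u -> fin_supp v ->
  (forall l, (l < n)%N -> pmom 'X^l u = pmom 'X^l v) -> mom_eq n u v.
Proof.
move=> fu fv uv f fn.
have E (w : int -> 'M[C]_(p, q)) : fin_supp w -> pmom f w = \sum_(i < size f) f`_i *: pmom 'X^i w.
  move=> fw; rewrite -[in LHS](coefK f) poly_def.
  apply: (big_ind2 (fun g m => pmom g w = m)) => [|f1 m1 f2 m2 <- <-|l _].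
  - exact: pmom0l.
  - exact: pmomDl.
  - exact: pmomZl.
rewrite !E//; apply: eq_bigr => l _; rewrite uv//.
by rewrite (leq_trans (ltn_ord l)).
Qed.

Lemma mom_eqW n n' u v : (n <= n')%N -> mom_eq n' u v -> mom_eq n u v.
Proof. by move=> nn' uv f fn; apply: uv; exact: leq_trans nn'. Qed.

Lemma mom_eq_sym n u v : mom_eq n u v -> mom_eq n v u.
Proof. by move=> uv f fn; rewrite uv. Qed.

Lemma mom_eq_trans n u v w : mom_eq n u v -> mom_eq n v w -> mom_eq n u w.
Proof. by move=> uv vw f fn; rewrite uv// vw. Qed.

Lemma mom_eqZ n (c : C) u v : fin_supp u -> fin_supp v ->
  mom_eq n u v -> mom_eq n (fun k => c *: u k) (fun k => c *: v k).
Proof. by move=> fu fv uv f fn; rewrite !pmomZr// uv. Qed.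

End fixed_dim.

Lemma pmom_conv (p q s : nat) (f : {poly C}) (u : int -> 'M[C]_(p, q))
    (v : int -> 'M[C]_(q, s)) : fin_supp u -> fin_supp v ->
  pmom f (convolution u v) =
  \sum_(y \in [set: int]) pmom (affpoly 1 y%:~R f) u *m v y.
Proof.
move=> fu fv; rewrite /pmom conv_sum//.
case: (fu) (fv) => [N uN] [M vM].
etransitivity.
  apply: (@zsum_exchange _ _ (N + M)) => j k jk /=.
  have [kM|kM] := ltnP M `|k|%N; first by rewrite vM// mulmx0 scaler0.
  by rewrite uN ?mul0mx ?scaler0//; lia.
apply: eq_fsbigr => y _ /=; rewrite zsum_mulmxl; last exact: fsupp_pmom.
by apply: eq_fsbigr => x _; rewrite horner_affpoly mul1r -scalemxAl rmorphD.
Qed.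

Lemma mom_eq_conv (p q s n : nat) (u u' : int -> 'M[C]_(p, q))
    (v : int -> 'M[C]_(q, s)) : fin_supp u -> fin_supp u' -> fin_supp v ->
  mom_eq n u u' -> mom_eq n (convolution u v) (convolution u' v).
Proof.
move=> fu fu' fv uu' f fn; rewrite !pmom_conv//; apply: eq_fsbigr => y _.
by rewrite uu'// (leq_trans (size_affpoly _ _ _)).
Qed.

Lemma subdivision_supp (p r N M : nat) (a : int -> 'M[C]_r)
    (b : int -> 'M[C]_(p, r)) : supported_in N a -> supported_in M b ->
  supported_in (N + M.*2) (subdivision a b).
Proof.
move=> aN bM k kN; rewrite /subdivision fsbig1 ?scaler0// => x _.
have [xM|xM] := ltnP M `|x|%N; first by rewrite bM// mul0mx.
by rewrite aN ?mulmx0//; lia.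
Qed.

Lemma fin_supp_subdivision (p r : nat) (a : int -> 'M[C]_r)
    (b : int -> 'M[C]_(p, r)) :
  fin_supp a -> fin_supp b -> fin_supp (subdivision a b).
Proof.
by move=> [N aN] [M bM]; exists (N + M.*2)%N; exact: subdivision_supp.
Qed.

Lemma fin_supp_iter (p r n : nat) (a : int -> 'M[C]_r)
    (b : int -> 'M[C]_(p, r)) :
  fin_supp a -> fin_supp b -> fin_supp (iter n (subdivision a) b).
Proof. by move=> fa fb; elim: n => //= n; exact: fin_supp_subdivision. Qed.

Lemma subdivision_sum (p r : nat) (f : int -> C) (a : int -> 'M[C]_r)
    (b : int -> 'M[C]_(p, r)) : fin_supp a -> fin_supp b ->
  \sum_(j \in [set: int]) f j *: subdivision a b j =
  2%:R *: \sum_(y \in [set: int]) \sum_(x \in [set: int])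
    f (2 * x + y) *: (b x *m a y).
Proof.
move=> [N aN] [M bM].
have supp0 (x y : int) : (N + M.*2 < `|x|)%N || (N + M.*2 < `|y|)%N ||
    (N + M.*2 < absz (2 * x + y)%R)%N -> b x *m a y = 0.
  move=> xy; have [xM|xM] := ltnP M `|x|%N; first by rewrite bM// mul0mx.
  by rewrite aN ?mulmx0//; lia.
transitivity (\sum_(j \in [set: int]) 2%:R *: \sum_(x \in [set: int])
    f j *: (b x *m a (j - 2 * x))).
  apply: eq_fsbigr => j _; rewrite /subdivision scalerA mulrC -scalerA.
  congr (_ *: _); apply: zsum_scale.
  by exists M => x xM; rewrite bM// mul0mx.
rewrite -zsum_scale; last first.
  exists (N + M.*2)%N => j jN; apply: fsbig1 => x _.
  by rewrite supp0 ?scaler0//; lia.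
congr (_ *: _); etransitivity.
  apply: (@zsum_exchange _ _ (N + M.*2)) => j x jx /=.
  by rewrite supp0 ?scaler0//; lia.
symmetry; etransitivity.
  apply: (@zsum_exchange _ _ (N + M.*2)) => j x jx /=.
  by rewrite supp0 ?scaler0//; lia.
apply: eq_fsbigr => x _ /=; rewrite -[RHS](zsum_shift (2 * x)).
by apply: eq_fsbigr => y _; rewrite addrK addrC.
Qed.

Lemma pmom_subdivision (p r : nat) (f : {poly C}) (a : int -> 'M[C]_r)
    (b : int -> 'M[C]_(p, r)) : fin_supp a -> fin_supp b ->
  pmom f (subdivision a b) =
  2%:R *: \sum_(y \in [set: int]) (pmom (affpoly 2%:R y%:~R f) b *m a y).
Proof.
move=> fa fb; rewrite /pmom subdivision_sum//; congr (_ *: _).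
apply: eq_fsbigr => y _; rewrite zsum_mulmxl; last exact: fsupp_pmom.
apply: eq_fsbigr => x _; rewrite horner_affpoly -scalemxAl.
by rewrite rmorphD rmorphM.
Qed.

Lemma mom_eq_subdivision (p r n : nat) (a : int -> 'M[C]_r)
    (b b' : int -> 'M[C]_(p, r)) : fin_supp a -> fin_supp b -> fin_supp b' ->
  mom_eq n b b' -> mom_eq n (subdivision a b) (subdivision a b').
Proof.
move=> fa fb fb' bb' f fn; rewrite !pmom_subdivision//; congr (_ *: _).
by apply: eq_fsbigr => y _; rewrite bb'// (leq_trans (size_affpoly _ _ _)).
Qed.

Lemma subdivisionZ (p r : nat) (a : int -> 'M[C]_r) (c : C)
    (b : int -> 'M[C]_(p, r)) : fin_supp a ->
  subdivision a (fun k => c *: b k) = (fun k => c *: subdivision a b k).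
Proof.
move=> [N aN]; apply/funext => j.
rewrite /subdivision [RHS]scalerA mulrC -scalerA; congr (_ *: _).
rewrite zsum_scale; first by apply: eq_fsbigr => k _; rewrite scalemxAl.
by exists (N + `|j|)%N => k kN; rewrite aN ?mulmx0//; lia.
Qed.

Section matching.
Variables (r : nat) (a : int -> 'M[C]_r) (v : int -> 'rV[C]_r).
Hypotheses (fa : fin_supp a) (fv : fin_supp v).

(* The matching condition v^(2xi) a^(xi) = v^(xi) + O(xi^n) and the second sum
   rule v^(2xi) a^(xi + pi) = O(xi^n), read off the moments of S_a v. *)
Definition matches (n : nat) :=
  mom_eq n (subdivision a v) (fun k => 2%:R *: v k).

Definition kills (n : nat) :=
  mom_eq n (alternate (subdivision a v)) (fun=> 0).

Lemma iter_matches n N : matches N ->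
  mom_eq N (iter n (subdivision a) v) (fun k => 2%:R ^+ n *: v k).
Proof.
move=> va; elim: n => [|n IH]; first by move=> f _; rewrite pmomZr ?scale1r.
rewrite iterS; apply: (mom_eq_trans (v := subdivision a (fun k => 2%:R ^+ n *: v k))).
  by apply: mom_eq_subdivision => //; [exact: fin_supp_iter|exact: fin_suppZ].
rewrite subdivisionZ// => f fN.
rewrite pmomZr; last exact: fin_supp_subdivision.
by rewrite va// !pmomZr// scalerA exprSr.
Qed.

(* As alternate (S_a v) has no moments, those of S_a v * u agree on even and on
   odd integers. *)
Lemma pmom_polyphase (s : nat) (u : int -> 'M[C]_(r, s)) (g : int) N
    (f : {poly C}) : fin_supp u -> matches N -> kills N -> (size f <= N)%N ->
  pmom (affpoly 2%:R 0 f) (convolution v (polyphase a g u)) =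
  pmom (affpoly 1 (- g%:~R) f) (convolution v u).
Proof.
move=> fu va ka fN; set w := convolution (subdivision a v) u.
have fw : fin_supp w by apply: fin_supp_conv => //; exact: fin_supp_subdivision.
have fS := fin_supp_subdivision fa fv.
have altw : alternate w = convolution (alternate (subdivision a v)) (alternate u).
  apply/funext => k; rewrite /alternate /w /convolution zsum_scale; last first.
    by case: fu => M uM; exists M => y /uM ->; rewrite mulmx0.
  apply: eq_fsbigr => y _; rewrite -[RHS]scalemxAr.
  rewrite -[in RHS]scalemxAl [RHS]scalerA [in RHS]mulrC.
  by rewrite -alternate_sign subrK.
pose G y := f.[(y - g)%:~R] *: w y.
have fG : fin_supp G by apply: fin_suppZ.
have h1 : pmom (affpoly 2%:R 0 f) (convolution v (polyphase a g u)) =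
    \sum_(x \in [set: int]) G (2 * x + g).
  apply: eq_fsbigr => x _; rewrite /G /w subdivision_conv// addrK.
  by rewrite horner_affpoly addr0 rmorphM.
rewrite h1 (zsum_even (fun y => G (y + g))).
apply: (scalerI (a := 2%:R)); first by rewrite pnatr_eq0.
(* Twice the sum over the even integers is the full sum plus the alternating one, and the latter
   will vanish. *)
transitivity (\sum_(k \in [set: int]) (G (k + g) + (-1) ^+ `|k| *: G (k + g))).
  rewrite zsum_scale; last first.
    have [M GM] := fin_supp_shift g fG; exists M => k kM.
    by rewrite GM// if_same.
  apply: eq_fsbigr => k _; rewrite -signr_odd; case: ifP => ok.
    by rewrite expr1 scaleN1r scaler0 subrr.
  by rewrite expr0 scale1r scalerDl scale1r.
rewrite zsumD; [|exact: fin_supp_shift|exact/fin_suppZ/fin_supp_shift].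
rewrite (zsum_shift g G).
rewrite -[X in _ + X](zsum_shift (- g)).
set f' := affpoly 1 (- g%:~R) f.
have f'N : (size f' <= N)%N by rewrite (leq_trans (size_affpoly _ _ _)).
transitivity (pmom f' w + (-1) ^+ `|g| *: pmom f' (alternate w)).
  congr (_ + _).
    by apply: eq_fsbigr => y _; rewrite /G horner_affpoly mul1r rmorphB.
  rewrite /pmom zsum_scale; last first.
    by apply: fsupp_pmom; exact: fin_supp_alternate.
  apply: eq_fsbigr => y _; rewrite /G subrK horner_affpoly mul1r !scalerA.
  by congr (_ *: _); rewrite alternate_sign abszN rmorphB; ring.
(* Since (-1)^k is a character of the integers, alternation distributes over the convolution, and
   [kills] applies to the left factor. *)
have -> : pmom f' (alternate w) = 0.
  rewrite altw pmom_conv; [|exact: fin_supp_alternate..].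
  apply: fsbig1 => y _; rewrite ka ?(leq_trans (size_affpoly _ _ _))//.
  by rewrite /pmom fsbig1 ?mul0mx// => k _; rewrite scaler0.
rewrite scaler0 addr0.
rewrite (mom_eq_conv fS (fin_suppZ (fun=> 2%:R) fv) fu va f'N).
rewrite -pmomZr; last exact: fin_supp_conv.
apply: eq_fsbigr => y _; congr (_ *: _); rewrite /convolution zsum_scale.
  by apply: eq_fsbigr => k _; rewrite -scalemxAl.
by case: fu => M uM; exists M => k /uM ->; rewrite mulmx0.
Qed.

End matching.

End moments.

Section more_moments.
Context {R : realType}.
Notation C := R[i].

Lemma pmom_sum (p q : nat) (I : Type) (s : seq I) (f : I -> {poly C})
    (u : int -> 'M[C]_(p, q)) : fin_supp u ->
  pmom (\sum_(i <- s) f i) u = \sum_(i <- s) pmom (f i) u.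
Proof.
move=> fu; elim: s => [|i s IH]; first by rewrite !big_nil pmom0l.
by rewrite !big_cons pmomDl// IH.
Qed.

Lemma pmom_affpolyX (p q l : nat) (b c : C) (u : int -> 'M[C]_(p, q)) :
  fin_supp u -> pmom (affpoly b c 'X^l) u =
  \sum_(i < l.+1) ('C(l, i)%:R * b ^+ i * c ^+ (l - i)) *: pmom 'X^i u.
Proof.
move=> fu.
have -> : affpoly b c 'X^l =
    \sum_(i < l.+1) ('C(l, i)%:R * b ^+ i * c ^+ (l - i)) *: 'X^i.
  rewrite /affpoly comp_Xn_poly addrC exprDn; apply: eq_bigr => i _.
  rewrite -rmorphXn/= exprZn -scalerAr mul_polyC scalerA -scaler_nat.
  by rewrite scalerA; congr (_ *: _); ring.
by rewrite pmom_sum//; apply: eq_bigr => i _; rewrite pmomZl.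
Qed.

Lemma pmomX_subdivision (p r l : nat) (a : int -> 'M[C]_r)
    (b : int -> 'M[C]_(p, r)) : fin_supp a -> fin_supp b ->
  pmom 'X^l (subdivision a b) =
  2%:R *: \sum_(i < l.+1) ('C(l, i)%:R * 2%:R ^+ i) *:
    (pmom 'X^i b *m pmom 'X^(l - i) a).
Proof.
move=> fa fb; rewrite pmom_subdivision//; congr (_ *: _).
case: (fa) => N aN.
rewrite (@zsum_win _ N); last by move=> k /aN ->; rewrite mulmx0.
under eq_bigr do rewrite pmom_affpolyX// mulmx_suml.
rewrite exchange_big/=; apply: eq_bigr => i _.
rewrite [pmom _ a](@zsum_win _ N); last by move=> k /aN ->; rewrite scaler0.
rewrite mulmx_sumr scaler_sumr; apply: eq_bigr => y _.
by rewrite -scalemxAl -scalemxAr scalerA hornerXn.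
Qed.

Definition nabla (p q : nat) (u : int -> 'M[C]_(p, q)) : int -> 'M[C]_(p, q) :=
  fun k => u k - u (k - 1).
Arguments nabla {p q} u.

Lemma fin_supp_nabla (p q : nat) (u : int -> 'M[C]_(p, q)) :
  fin_supp u -> fin_supp (nabla u).
Proof. by move=> fu; apply: fin_suppB => //; exact: fin_supp_shift. Qed.

Lemma fin_supp_iter_nabla (p q n : nat) (u : int -> 'M[C]_(p, q)) :
  fin_supp u -> fin_supp (iter n nabla u).
Proof. by move=> fu; elim: n => //= n; exact: fin_supp_nabla. Qed.

Lemma pmomX_nabla (p q l : nat) (u : int -> 'M[C]_(p, q)) : fin_supp u ->
  pmom 'X^l (nabla u) = - \sum_(i < l) 'C(l, i)%:R *: pmom 'X^i u.
Proof.
move=> fu; rewrite pmomBr//; last exact: fin_supp_shift.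
rewrite pmom_shift pmom_affpolyX// big_ord_recr/=.
rewrite binn subnn !expr1n expr0 !mulr1 scale1r opprD addrC subrK.
by congr (- _); apply: eq_bigr => i _; rewrite rmorphN opprK !expr1n !mulr1.
Qed.

(** Summation by parts moves the difference onto the weight: k^l becomes k^l - (k+1)^l, of degree l
    - 1. So n differences kill the degrees below n and turn k^n into the constant (-1)^n n!. *)
Lemma pmomX_iter_nabla (p q n : nat) (u : int -> 'M[C]_(p, q)) : fin_supp u ->
  (forall l, (l < n)%N -> pmom 'X^l (iter n nabla u) = 0) /\
  pmom 'X^n (iter n nabla u) = ((-1) ^+ n * n`!%:R) *: pmom 1 u.
Proof.
move=> fu; elim: n => [|n [IH0 IHn]].
  by split => //; rewrite !expr0 mul1r fact0 scale1r.
have fN := fin_supp_iter_nabla n fu; split => [l ln|].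
  rewrite iterS pmomX_nabla// big1 ?oppr0// => i _.
  by rewrite IH0 ?scaler0// (leq_trans (ltn_ord i)).
rewrite iterS pmomX_nabla// big_ord_recr/= big1 => [|i _]; last first.
  by rewrite IH0 ?scaler0.
rewrite add0r IHn scalerA -scaleNr binSn factS natrM exprS.
by congr (_ *: _); ring.
Qed.

Lemma conv_nablar (p q s : nat) (u : int -> 'M[C]_(p, q))
    (v : int -> 'M[C]_(q, s)) : fin_supp v ->
  convolution u (nabla v) = nabla (convolution u v).
Proof.
move=> [N vN]; apply/funext => j; rewrite /nabla /convolution.
rewrite -[X in _ - X](zsum_shift (- 1)).
transitivity (\sum_(k \in [set: int]) (u (j - k) *m v k +
    - (u (j - k) *m v (k - 1)))).
  by apply: eq_fsbigr => k _; rewrite mulmxBr.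
rewrite zsumD; last 2 first.
- by exists N => k /vN ->; rewrite mulmx0.
- by exists N.+1 => k kN; rewrite vN ?mulmx0 ?oppr0//; lia.
congr (_ + _); rewrite (@zsum_raddf _ _ -%R); last first.
  by exists N.+1 => k kN; rewrite vN ?mulmx0//; lia.
by apply: eq_fsbigr => k _; rewrite opprB addrA subrK.
Qed.

Lemma conv_iter_nablar (p q s n : nat) (u : int -> 'M[C]_(p, q))
    (v : int -> 'M[C]_(q, s)) : fin_supp v ->
  convolution u (iter n nabla v) = iter n nabla (convolution u v).
Proof.
move=> fv; elim: n => //= n IH; rewrite conv_nablar ?IH//.
exact: fin_supp_iter_nabla.
Qed.

Lemma convDr (p q s : nat) (u : int -> 'M[C]_(p, q))
    (v w : int -> 'M[C]_(q, s)) (k : int) : fin_supp v -> fin_supp w ->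
  convolution u (fun k => v k + w k) k = convolution u v k + convolution u w k.
Proof.
move=> [N vN] [M wM]; rewrite /convolution -zsumD.
- by apply: eq_fsbigr => y _; rewrite mulmxDr.
- by exists N => y /vN ->; rewrite mulmx0.
- by exists M => y /wM ->; rewrite mulmx0.
Qed.

Lemma convZr (p q s : nat) (c : C) (u : int -> 'M[C]_(p, q))
    (v : int -> 'M[C]_(q, s)) (k : int) : fin_supp v ->
  convolution u (fun k => c *: v k) k = c *: convolution u v k.
Proof.
move=> [N vN]; rewrite /convolution zsum_scale.
  by apply: eq_fsbigr => y _; rewrite scalemxAr.
by exists N => y /vN ->; rewrite mulmx0.
Qed.

Lemma convBr (p q s : nat) (u : int -> 'M[C]_(p, q))
    (v w : int -> 'M[C]_(q, s)) (k : int) : fin_supp v -> fin_supp w ->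
  convolution u (fun k => v k - w k) k = convolution u v k - convolution u w k.
Proof.
move=> fv fw; rewrite -scaleN1r -convZr// -convDr//; last exact: fin_suppZ.
by apply: eq_fsbigr => y _; rewrite scaleN1r.
Qed.

Lemma fin_supp_delta (p q : nat) (A : 'M[C]_(p, q)) :
  fin_supp (fun k => if k == 0 then A else 0).
Proof. by exists 0%N => k k0; rewrite ifF//; apply/negbTE; lia. Qed.

Lemma pmom_delta (p q : nat) (f : {poly C}) (A : 'M[C]_(p, q)) :
  pmom f (fun k => if k == 0 then A else 0) = f.[0] *: A.
Proof.
rewrite /pmom (zsum1 (i := 0)) ?eqxx// => k /negbTE ->.
by rewrite scaler0.
Qed.

Section matching_moments.
Variables (r : nat) (a : int -> 'M[C]_r).
Hypothesis fa : fin_supp a.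
Implicit Types v : int -> 'rV[C]_r.

(** Isolating the top term i = l of the binomial expansion of the l-th moment of S_a v leaves a
    recursion in the lower moments, solvable when 1 - 2^l a^(0) is invertible. It is the formula for
    the values of the filter, freed of the powers of i. *)
Lemma matchesP v n : fin_supp v ->
  matches a v n <-> forall l, (l < n)%N ->
    pmom 'X^l v *m (1%:M - 2%:R ^+ l *: pmom 1 a) =
    \sum_(i < l) ('C(l, i)%:R * 2%:R ^+ i) *:
      (pmom 'X^i v *m pmom 'X^(l - i) a).
Proof.
move=> fv.
have E l : (pmom 'X^l v *m (1%:M - 2%:R ^+ l *: pmom 1 a) =
    \sum_(i < l) ('C(l, i)%:R * 2%:R ^+ i) *:
      (pmom 'X^i v *m pmom 'X^(l - i) a)) <->
    pmom 'X^l (subdivision a v) = pmom 'X^l (fun k => 2%:R *: v k).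
  rewrite pmomX_subdivision// pmomZr// big_ord_recr/= subnn binn mul1r.
  rewrite expr0 mulmxBr mulmx1 -scalemxAr; split => [<-|].
    by rewrite subrK.
  have n2 : (2%:R : C) != 0 by rewrite pnatr_eq0.
  by move=> /(scalerI n2) e; rewrite -[X in X - _]e addrK.
split=> [va l ln|va]; first by apply/E; apply: va; rewrite size_polyXn.
apply: mom_eqP => [||l /va /E//]; first exact: fin_supp_subdivision.
exact: fin_suppZ.
Qed.

(** Adding an n-th difference leaves the moments below n alone and allows a free choice of the n-th
    one, which is set to the value that the recursion demands. *)
Lemma matches_extend v n : fin_supp v ->
  1%:M - 2%:R ^+ n *: pmom 1 a \in unitmx -> matches a v n ->
  exists v', [/\ fin_supp v', matches a v' n.+1 & mom_eq n v v'].
Proof.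
move=> fv ua va; set B := 1%:M - _ in ua.
pose c : 'rV[C]_r := \sum_(i < n) ('C(n, i)%:R * 2%:R ^+ i) *:
  (pmom 'X^i v *m pmom 'X^(n - i) a) *m invmx B - pmom 'X^n v.
pose d (k : int) : 'rV[C]_r := if k == 0 then ((-1) ^+ n * n`!%:R)^-1 *: c else 0.
have fd : fin_supp d by exact: fin_supp_delta.
pose v' (k : int) := v k + iter n nabla d k.
have fN := fin_supp_iter_nabla n fd.
have fv' : fin_supp v' by exact: fin_suppD.
have [N0 Nn] := pmomX_iter_nabla n fd.
have v'l l : (l < n)%N -> pmom 'X^l v' = pmom 'X^l v.
  by move=> ln; rewrite pmomDr// N0// addr0.
have v'n : pmom 'X^n v' = pmom 'X^n v + c.
  rewrite pmomDr// Nn pmom_delta hornerC scale1r scalerA divff ?scale1r//.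
  by rewrite mulf_neq0 ?signr_eq0// pnatr_eq0 -lt0n fact_gt0.
exists v'; split=> //; last by apply: mom_eqP => // l /v'l.
have /matchesP vm := va.
apply/matchesP => // l; rewrite ltnS leq_eqVlt => /predU1P[->|ln].
  rewrite v'n addrC subrK -mulmx_suml mulmxKV//.
  by apply: eq_bigr => i _; rewrite v'l.
rewrite v'l// vm//; apply: eq_bigr => i _; rewrite v'l//.
exact: ltn_trans ln.
Qed.

Lemma matches_unique v v' n (c : C) : fin_supp v -> fin_supp v' ->
  (forall l, (0 < l < n)%N -> 1%:M - 2%:R ^+ l *: pmom 1 a \in unitmx) ->
  matches a v n -> matches a v' n -> pmom 1 v' = c *: pmom 1 v ->
  mom_eq n v' (fun k => c *: v k).
Proof.
move=> fv fv' ua /(matchesP _ fv) va /(matchesP _ fv') va' v0.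
apply: mom_eqP => //; first exact: fin_suppZ.
move=> l ln; rewrite pmomZr//; elim/ltn_ind: l ln => l IH ln.
have [->//|l0] := posnP l.
apply: (can_inj (mulmxK (ua l _))); first by rewrite l0.
rewrite -scalemxAl va// va'// scaler_sumr; apply: eq_bigr => i _.
by rewrite IH ?(ltn_trans _ ln)// -scalemxAl !scalerA mulrC.
Qed.

End matching_moments.

End more_moments.
Arguments nabla {R p q} u.

(** * Growth of the iterates *)

Section norms.
Context {R : realType}.
Notation C := R[i].
Notation normc := (@ComplexField.Normc.normc R).

Lemma normc_ge0 (z : C) : 0 <= normc z.
Proof. by case: z => x y; exact: sqrtr_ge0. Qed.

Lemma normc_eq0 (z : C) : (normc z == 0) = (z == 0).
Proof.
apply/eqP/eqP => [|->]; first exact: ComplexField.Normc.eq0_normc.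
exact: ComplexField.Normc.normc0.
Qed.

Lemma normcX (z : C) (n : nat) : normc (z ^+ n) = normc z ^+ n.
Proof.
elim: n => [|n IH]; first by rewrite !expr0 ComplexField.Normc.normc1.
by rewrite !exprS ComplexField.Normc.normcM IH.
Qed.

Lemma normc_real (x : R) : normc x%:C = `|x|.
Proof. by rewrite /= expr0n/= addr0 sqrtr_sqr. Qed.

Lemma normc_nat (n : nat) : normc n%:R = n%:R.
Proof. by rewrite -(rmorph_nat (real_complex R)) normc_real normr_nat. Qed.

Lemma normc_int (k : int) : normc k%:~R = `|k%:~R|.
Proof. by rewrite -(rmorph_int (real_complex R)) normc_real. Qed.

Lemma normcB (x y : C) : normc (x - y) <= normc x + normc y.
Proof. by rewrite (le_trans (le_normcD _ _))// normcN. Qed.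

Lemma normc_sum (I : Type) (s : seq I) (P : pred I) (F : I -> C) :
  normc (\sum_(i <- s | P i) F i) <= \sum_(i <- s | P i) normc (F i).
Proof.
elim/big_ind2: _ => //; first by rewrite ComplexField.Normc.normc0.
by move=> x1 x2 y1 y2 h1 h2; rewrite (le_trans (le_normcD _ _))// lerD.
Qed.

Lemma normc_Re (z : C) : `|complex.Re z| <= normc z.
Proof.
case: z => x y /=; rewrite -sqrtr_sqr ler_wsqrtr// lerDl sqr_ge0//.
Qed.

Lemma normc_Im (z : C) : `|complex.Im z| <= normc z.
Proof.
case: z => x y /=; rewrite -sqrtr_sqr ler_wsqrtr// lerDr sqr_ge0//.
Qed.

Lemma normc_le_ReIm (z : C) : normc z <= `|complex.Re z| + `|complex.Im z|.
Proof.
case: z => x y /=.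
rewrite -[leRHS]ger0_norm ?addr_ge0// -[leRHS]sqrtr_sqr ler_wsqrtr//.
rewrite sqrrD !real_normK ?num_real// [leRHS]addrAC lerDl.
by rewrite mulrn_wge0// mulr_ge0.
Qed.

Section entry.
Variables p q : nat.
Implicit Types A B : 'M[C]_(p, q).

Lemma entry_norm_ge0 A : 0 <= entry_norm A.
Proof. exact: bigmax_ge_id. Qed.

Lemma le_entry_norm A i j : normc (A i j) <= entry_norm A.
Proof.
rewrite /entry_norm (le_trans _ (le_bigmax _ _ i))//.
exact: (le_bigmax _ (fun j => normc (A i j)) j).
Qed.

Lemma entry_norm_leP A (c : R) : 0 <= c ->
  entry_norm A <= c <-> forall i j, normc (A i j) <= c.
Proof.
move=> c0; split=> [Ac i j|Ac]; first exact: le_trans (le_entry_norm _ _ _) Ac.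
by apply: bigmax_le => // i _; apply: bigmax_le => // j _.
Qed.

Lemma entry_norm0 : entry_norm (0 : 'M[C]_(p, q)) = 0.
Proof.
apply/eqP; rewrite eq_le entry_norm_ge0 andbT; apply/entry_norm_leP => // i j.
by rewrite mxE ComplexField.Normc.normc0.
Qed.

Lemma entry_norm_eq0 A : entry_norm A = 0 -> A = 0.
Proof.
move=> A0; apply/matrixP => i j; rewrite mxE.
apply: ComplexField.Normc.eq0_normc; apply/eqP.
by rewrite eq_le normc_ge0 andbT -A0 le_entry_norm.
Qed.

Lemma entry_normD A B : entry_norm (A + B) <= entry_norm A + entry_norm B.
Proof.
apply/entry_norm_leP => [|i j]; first by rewrite addr_ge0 ?entry_norm_ge0.
by rewrite mxE (le_trans (le_normcD _ _))// lerD// le_entry_norm.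
Qed.

Lemma entry_normZ (c : C) A : entry_norm (c *: A) = normc c * entry_norm A.
Proof.
apply/eqP; rewrite eq_le; apply/andP; split.
  apply/entry_norm_leP => [|i j]; first by rewrite mulr_ge0 ?normc_ge0 ?entry_norm_ge0.
  by rewrite mxE ComplexField.Normc.normcM ler_wpM2l ?normc_ge0 ?le_entry_norm.
have [->|c0] := eqVneq c 0.
  by rewrite ComplexField.Normc.normc0 mul0r entry_norm_ge0.
have nc : 0 < normc c by rewrite lt_neqAle eq_sym normc_eq0 c0 normc_ge0.
rewrite -ler_pdivlMl//; apply/entry_norm_leP => [|i j].
  by rewrite mulr_ge0 ?invr_ge0 ?normc_ge0 ?entry_norm_ge0.
rewrite ler_pdivlMl// -ComplexField.Normc.normcM.
by have := le_entry_norm (c *: A) i j; rewrite mxE.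
Qed.

Lemma entry_normN A : entry_norm (- A) = entry_norm A.
Proof.
by rewrite -scaleN1r entry_normZ normcN ComplexField.Normc.normc1 mul1r.
Qed.

Lemma entry_normB A B : entry_norm (A - B) <= entry_norm A + entry_norm B.
Proof. by rewrite (le_trans (entry_normD _ _))// entry_normN. Qed.

Lemma entry_norm_sum (I : Type) (s : seq I) (P : pred I) (F : I -> 'M[C]_(p, q)) :
  entry_norm (\sum_(i <- s | P i) F i) <= \sum_(i <- s | P i) entry_norm (F i).
Proof.
elim/big_ind2: _ => //; first by rewrite entry_norm0.
by move=> x1 x2 y1 y2 h1 h2; rewrite (le_trans (entry_normD _ _))// lerD.
Qed.

End entry.

Lemma entry_normM (p q s : nat) (A : 'M[C]_(p, q)) (B : 'M[C]_(q, s)) :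
  entry_norm (A *m B) <= q%:R * (entry_norm A * entry_norm B).
Proof.
have AB0 : 0 <= entry_norm A * entry_norm B by rewrite mulr_ge0 ?entry_norm_ge0.
apply/entry_norm_leP => [|i j]; first by rewrite mulr_ge0.
rewrite mxE (le_trans (normc_sum _ _ _))//.
rewrite (@le_trans _ _ (\sum_(k < q) entry_norm A * entry_norm B))//.
  apply: ler_sum => k _; rewrite ComplexField.Normc.normcM.
  by rewrite ler_pM ?normc_ge0 ?le_entry_norm.
by rewrite sumr_const card_ord mulr_natl.
Qed.

Lemma entry_norm11 (A : 'M[C]_1) : entry_norm A = normc (A 0 0).
Proof.
apply/eqP; rewrite eq_le le_entry_norm andbT.
by apply/entry_norm_leP => [|i j]; rewrite ?normc_ge0// !ord1.
Qed.

Lemma fin_supp_bounded (p q : nat) (u : int -> 'M[C]_(p, q)) : fin_supp u ->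
  exists2 B : R, 0 <= B & forall k, entry_norm (u k) <= B.
Proof.
move=> [N uN]; exists (\sum_(k <- zwin N) entry_norm (u k)).
  by apply: sumr_ge0 => k _; exact: entry_norm_ge0.
move=> k; have [kN|kN] := ltnP N `|k|%N.
  by rewrite uN// entry_norm0 sumr_ge0// => *; exact: entry_norm_ge0.
rewrite (bigD1_seq k) ?zwin_uniq ?mem_zwin//= ?lerDl sumr_ge0// => *.
exact: entry_norm_ge0.
Qed.

Lemma size_zwin (N : nat) : size (zwin N) = N.*2.+1.
Proof. by rewrite size_map size_iota. Qed.

Lemma entry_norm_zsum (p q N : nat) (F : int -> 'M[C]_(p, q)) (B : R) :
  (forall k, (N < `|k|)%N -> F k = 0) -> (forall k, entry_norm (F k) <= B) ->
  entry_norm (\sum_(k \in [set: int]) F k) <= (N.*2.+1)%:R * B.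
Proof.
move=> F0 FB; rewrite (zsum_win F0) (le_trans (entry_norm_sum _ _ _))//.
rewrite (@le_trans _ _ (\sum_(k <- zwin N) B)) ?ler_sum//.
by rewrite big_const_seq count_predT size_zwin iter_addr_0 mulr_natl.
Qed.

End norms.

Section growth.
Context {R : realType}.
Notation C := R[i].

Variables (r : nat) (a : int -> 'M[C]_r).
Hypothesis fa : fin_supp a.
Implicit Types (u : int -> 'cV[C]_r) (v : int -> 'rV[C]_r).

Notation A := (fun n => iter n (subdivision a) (dirac_id r)).

Definition growth u (kappa : R) := exists2 B : R, 0 < B &
  forall n k, entry_norm (convolution (A n) u k) <= B * kappa ^+ n.

(* u belongs to V_{j-1,v} *)
Definition annihilates v j u := fin_supp u /\
  mom_eq j (convolution v u) (fun=> 0).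

(** Each iterate is bounded, being finitely supported, so the finitely many early ones are absorbed
    by the constant. *)
Lemma growth_eventually u (kappa : R) (n0 : nat) : fin_supp u -> 0 < kappa ->
  (forall n k, (n0 <= n)%N ->
    entry_norm (convolution (A n) u k) <= kappa ^+ n) -> growth u kappa.
Proof.
move=> fu k0 H.
have fA n : fin_supp (A n) by exact: fin_supp_iter_subdivision.
have Hn n : exists B : R, 0 <= B /\ forall k,
    entry_norm (convolution (A n) u k) <= B.
  have [B B0 HB] := fin_supp_bounded (fin_supp_conv (fA n) fu).
  by exists B; split.
have [B HB] := choice Hn.
exists (1 + \sum_(n < n0) B n / kappa ^+ n).
  rewrite ltr_pwDl// sumr_ge0// => n _.
  by rewrite divr_ge0 ?exprn_ge0 ?(ltW k0)//; case: (HB n).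
move=> n k; have [nn0|n0n] := ltnP n n0; last first.
  rewrite (le_trans (H _ _ n0n))// ler_peMl ?exprn_ge0 ?(ltW k0)//.
  rewrite lerDl; apply: sumr_ge0 => i _.
  by rewrite divr_ge0 ?exprn_ge0 ?(ltW k0)//; case: (HB i).
rewrite (le_trans ((HB n).2 k))// -ler_pdivrMr ?exprn_gt0//.
rewrite (bigD1 (Ordinal nn0))//= addrCA lerDl addr_ge0// sumr_ge0// => i _.
by rewrite divr_ge0 ?exprn_ge0 ?(ltW k0)//; case: (HB i).
Qed.

Lemma growth_rho v j u (kappa : R) : 0 < kappa -> fin_supp u ->
  (rho_infty a j v < kappa%:E)%E -> vanishing_space j v u ->
  growth u kappa.
Proof.
move=> k0 fu rk Vu.
have : (limn_esup (fun n : nat => (linf_norm (convolution (A n) u)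
        `^ (n%:R^-1)) ) < kappa%:E)%E.
  by apply: le_lt_trans rk; apply: ereal_sup_ubound; exists u.
rewrite /limn_esup limf_esupE => /ereal_inf_lt[_ [V [n0 _ VN]] <-] Vk.
(* The threshold is shifted by one because the n-th root can be undone only for positive n. *)
apply: (@growth_eventually _ _ (n0.+1)) => // n k n0n.
have nn0 : (0 < n)%N by exact: leq_ltn_trans n0n.
have : (linf_norm (convolution (A n) u) `^ (n%:R^-1) <= kappa%:E)%E.
  apply: ltW; apply: le_lt_trans Vk; apply: ereal_sup_ubound; exists n => //.
  by apply: VN => /=; exact: ltnW.
have n0' : (n%:R : R) != 0 by rewrite pnatr_eq0 -lt0n.
have lin0 : (0 <= linf_norm (convolution (A n) u))%E.
  apply: (@le_trans _ _ (entry_norm (convolution (A n) u 0))%:E).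
    by rewrite lee_fin entry_norm_ge0.
  by apply: ereal_sup_ubound; exists 0.
move=> h0; have := @gt0_ler_poweR _ n%:R (ler0n _ _) _ _ _ _ h0.
rewrite !in_itv/= !leey !andbT poweR_ge0 lee_fin => /(_ isT (ltW k0)).
rewrite -!poweRrM mulVf// poweRe1// powR_mulrn ?(ltW k0)// => h.
rewrite -lee_fin; apply: le_trans h; apply: ereal_sup_ubound.
by exists k.
Qed.

(* With a_n = sup |A_n * u|, the hypotheses give a_{n+1} <= c a_n + B kappa^n. *)
Lemma growth_polyphase u d0 d1 (c kappa : R) : fin_supp u ->
  0 <= c < kappa ->
  (forall k, polyphase a 0 u k = c%:C *: u k + d0 k) -> fin_supp d0 ->
  (forall k, polyphase a 1 u k = c%:C *: u k + d1 k) -> fin_supp d1 ->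
  growth d0 kappa -> growth d1 kappa -> growth u kappa.
Proof.
move=> fu /andP[c0 ck] ud0 fd0 ud1 fd1 [B0 B00 H0] [B1 B10 H1].
have k0 : 0 < kappa by exact: le_lt_trans ck.
pose B := B0 + B1; have B'0 : 0 < B by rewrite addr_gt0.
have [D D0 HD] := fin_supp_bounded
  (fin_supp_conv (fin_supp_iter_subdivision 0 fa) fu).
(* [D] covers n = 0, and B / (kappa - c) is the fixed point of E -> (c E + B) / kappa, so that the
   bound reproduces itself from n to n + 1. *)
exists (D + B / (kappa - c)); first by rewrite ltr_wpDl// divr_gt0 ?subr_gt0.
elim=> [|n IH] k.
  by rewrite expr0 mulr1 (le_trans (HD k))// lerDl divr_ge0 ?subr_ge0 ?(ltW ck) ?(ltW B'0).
set E := D + _ in IH *.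
have step d : fin_supp d -> (forall n k,
    entry_norm (convolution (A n) d k) <= B * kappa ^+ n) -> forall l,
    entry_norm (convolution (A n) (fun k => c%:C *: u k + d k) l) <=
    E * kappa ^+ n.+1.
  move=> fd Hd l; rewrite convDr//; last exact: fin_suppZ.
  rewrite convZr// (le_trans (entry_normD _ _))// entry_normZ normc_real ger0_norm//.
  rewrite (le_trans (lerD (ler_wpM2l c0 (IH l)) (Hd n l)))//.
  rewrite exprS !mulrA -mulrDl ler_wpM2r ?exprn_ge0 ?(ltW k0)//.
  rewrite -lerBrDl mulrC -mulrBl [leRHS]mulrC /E mulrDl divfK ?subr_eq0 ?gt_eqF//.
  by rewrite lerDr mulr_ge0 ?subr_ge0 ?(ltW ck).
have kE : k = 2 * (k %/ 2)%Z + (k %% 2)%Z by rewrite mulrC -divz_eq.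
have kB n' x y : x <= y -> x * kappa ^+ n' <= y * kappa ^+ n'.
  by move=> xy; rewrite ler_wpM2r ?exprn_ge0 ?(ltW k0).
have : (k %% 2)%Z = 0 \/ (k %% 2)%Z = 1 by lia.
rewrite [in entry_norm _]kE => -[->|->]; rewrite iter_subdivision_conv//.
  rewrite (_ : polyphase a 0 u = fun k => c%:C *: u k + d0 k); last exact/funext.
  apply: step => // n' l; rewrite (le_trans (H0 _ _))// kB// lerDl ltW//.
rewrite (_ : polyphase a 1 u = fun k => c%:C *: u k + d1 k); last exact/funext.
by apply: step => // n' l; rewrite (le_trans (H1 _ _))// kB// lerDr ltW.
Qed.

End growth.

(** * Algebraic simplicity of an eigenvalue *)

Lemma char_poly_conj (F : fieldType) (n : nat) (P A : 'M[F]_n) :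
  P \in unitmx -> char_poly (P *m A *m invmx P) = char_poly A.
Proof.
move=> uP; rewrite /char_poly /char_poly_mx.
have -> : 'X%:M - map_mx polyC (P *m A *m invmx P) =
    map_mx polyC P *m ('X%:M - map_mx polyC A) *m map_mx polyC (invmx P).
  rewrite mulmxBr mulmxBl -!map_mxM; congr (_ - _).
  rewrite scalar_mxC -mulmxA -map_mxM mulmxV// map_scalar_mx/=.
  by rewrite polyC1 mulmx1.
rewrite !det_mulmx mulrAC -det_mulmx -map_mxM mulmxV// map_scalar_mx/=.
by rewrite polyC1 det1 mul1r.
Qed.

(* A vector w with wA = lw + cx is a generalized eigenvector, so the last *)
(* hypothesis says that there is no Jordan block of size 2 for l. *)
Lemma mup_char_poly_simple (F : fieldType) (n : nat) (A : 'M[F]_n)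
    (x : 'rV[F]_n) (l : F) : x != 0 -> x *m A = l *: x ->
  (forall (w : 'rV[F]_n) c, w *m A = l *: w + c *: x -> (w <= x)%MS) ->
  mup l (char_poly A) = 1%N.
Proof.
case: n => [|n] in A x *; first by rewrite [x]thinmx0 eqxx.
(* In a basis whose first row spans the line of [x], the matrix is block lower triangular with [l]
   in the corner. What remains is that [l] is not a root for the lower block. *)
move=> x0 xA hA; pose P := row_ebase x.
have uP : P \in unitmx by exact: row_ebase_unit.
pose e : 'rV[F]_(1 + n) := row_mx 1%:M 0.
have [c c0 xE] : exists2 c : F, c != 0 & x = c *: (e *m P).
  have rx : \rank x = 1%N by rewrite rank_rV x0.
  have xE := mulmx_ebase x; rewrite rx in xE.
  have pe : (pid_mx 1 : 'M[F]_(1, 1 + n)) = e by rewrite pid_mx_row.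
  exists (col_ebase x 0 0).
    apply: contraNneq x0 => c0; rewrite -xE [col_ebase x]mx11_scalar c0.
    by rewrite raddf0 !mul0mx.
  by rewrite -[LHS]xE [col_ebase x]mx11_scalar mul_scalar_mx -scalemxAl pe mxE.
have eP : e *m P = c^-1 *: x by rewrite xE scalerA mulVf// scale1r.
pose B : 'M[F]_(1 + n) := P *m A *m invmx P.
have eB : e *m B = l *: e.
  rewrite /B !mulmxA eP -scalemxAl xA scalerA mulrC -scalerA.
  by rewrite -eP -scalemxAl mulmxK.
have BE : B = block_mx l%:M 0 (dlsubmx B) (drsubmx B).
  have eBr : e *m B = row_mx (ulsubmx B) (ursubmx B).
    by rewrite -{1}[B]submxK /e mul_row_block !mul1mx !mul0mx !addr0.
  have le : l *: e = row_mx l%:M 0.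
    by rewrite /e (@scale_row_mx _ _ 1 n) scaler0 scalemx1.
  have [eul eur] := eq_row_mx (etrans (esym eBr) (etrans eB le)).
  by rewrite -[LHS]submxK eul eur.
rewrite -(char_poly_conj A uP) -/B BE.
set D := drsubmx B; set Dl := dlsubmx B.
have -> : char_poly (block_mx l%:M 0 Dl D) = ('X - l%:P) * char_poly D.
  rewrite /char_poly /char_poly_mx (@map_block_mx _ _ _ 1 n 1 n) map_mx0.
  rewrite (@scalar_mx_block _ 1 n) opp_block_mx add_block_mx !oppr0 !addr0.
  rewrite add0r det_lblock map_scalar_mx/= -raddfB/= det_scalar1.
  by [].
(* An eigenvector of the lower block lifts to a vector as in [hA]. It is then proportional to [x],
   so that its second component is zero, a contradiction. *)
have D1 : ~~ root (char_poly D) l.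
  rewrite -eigenvalue_root_char; apply/negP => /eigenvalueP[t tD t0].
  pose w : 'rV[F]_(1 + n) := row_mx 0 t.
  have wB : w *m B = l *: w + ((t *m Dl) 0 0) *: e.
    rewrite BE -/D -/Dl mul_row_block !mul0mx !add0r tD.
    rewrite /w /e !(@scale_row_mx _ _ 1 n) !scaler0 add_row_mx add0r addr0.
    by rewrite scalemx1 -mx11_scalar.
  have wA : (w *m P) *m A = l *: (w *m P) + ((t *m Dl) 0 0 * c^-1) *: x.
    have BP : B *m P = P *m A by rewrite /B mulmxKV.
    rewrite -mulmxA -BP mulmxA wB.
    by rewrite mulmxDl -!scalemxAl eP scalerA.
  have /submxP[d dE] := hA _ _ wA.
  have : w = (d *m (c%:M)) *m e.
    apply: (can_inj (mulmxK uP)).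
    by rewrite dE -!mulmxA mul_scalar_mx -xE.
  rewrite /w /e mul_mx_row mulmx0 => /eq_row_mx[_ t0'].
  by rewrite t0' eqxx in t0.
rewrite mupMl// (_ : 'X - l%:P = ('X - l%:P) ^+ 1)// mup_XsubCX eqxx.
by [].
Qed.

(** * Decay of the powers of the symbol at 0 *)

Section spectral.
Context {R : realType}.
Notation C := R[i].
Notation normc := (@ComplexField.Normc.normc R).

Lemma bernoulli (x : R) (n : nat) : 0 <= x -> 1 + n%:R * x <= (1 + x) ^+ n.
Proof.
move=> x0; elim: n => [|n IH]; first by rewrite mul0r addr0 expr0.
rewrite exprSr -natr1.
rewrite (le_trans _ (ler_wpM2r _ IH)) ?addr_ge0//.
have : 0 <= n%:R * x * x by rewrite !mulr_ge0.
lra.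
Qed.

(** Otherwise (x / y)^n would be bounded, against the Bernoulli inequality. *)
Lemma expr_le_geometric (x y B : R) : 0 < y ->
  (forall n, x ^+ n <= B * y ^+ n) -> x <= y.
Proof.
move=> y0 H; rewrite leNgt; apply/negP => yx.
pose d := x / y - 1.
have d0 : 0 < d by rewrite subr_gt0 ltr_pdivlMr// mul1r.
have Hq n : (1 + d) ^+ n <= B.
  by rewrite addrC subrK expr_div_n ler_pdivrMr ?exprn_gt0.
pose n := Num.bound (B / d).
have := le_trans (bernoulli n (ltW d0)) (Hq n).
apply/negP; rewrite -ltNge.
have B0 : 0 <= B by apply: le_trans (Hq 0%N); rewrite expr0.
have : B / d < n%:R.
  by apply: archi_boundP; rewrite divr_ge0// ltW.
by rewrite ltr_pdivrMr// => h; rewrite (lt_trans h)// ltrDr.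
Qed.

Variables (r : nat) (a : int -> 'M[C]_r).
Hypothesis fa : fin_supp a.
Implicit Types (u : int -> 'cV[C]_r) (v : int -> 'rV[C]_r).

Notation A := (fun n => iter n (subdivision a) (dirac_id r)).
Notation a0 := (pmom 1 a).

Lemma pmom1_conv (p q s : nat) (u : int -> 'M[C]_(p, q))
    (v : int -> 'M[C]_(q, s)) : fin_supp u -> fin_supp v ->
  pmom 1 (convolution u v) = pmom 1 u *m pmom 1 v.
Proof.
move=> fu fv; rewrite pmom_conv// [pmom 1 v]/pmom zsum_mulmxr; last exact: fsupp_pmom.
have aff1 c : affpoly 1 c 1 = 1 :> {poly C} by rewrite /affpoly comp_polyC.
by apply: eq_fsbigr => k _; rewrite hornerC scale1r aff1.
Qed.

Lemma pmom1_subdivision (p : nat) (b : int -> 'M[C]_(p, r)) : fin_supp b ->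
  pmom 1 (subdivision a b) = 2%:R *: (pmom 1 b *m a0).
Proof.
move=> fb; have := pmomX_subdivision 0 fa fb.
by rewrite big_ord1 bin0 mul1r expr0 scale1r.
Qed.

Lemma pmom1_iter (y : 'cV[C]_r) n :
  pmom 1 (A n) *m y = 2%:R ^+ n *: iter n (mulmx a0) y.
Proof.
elim: n y => [|n IH] y.
  by rewrite pmom_delta hornerC scale1r mul1mx expr0 scale1r.
rewrite iterS pmom1_subdivision; last exact: fin_supp_iter_subdivision.
by rewrite -scalemxAl -mulmxA IH scalerA -exprS -iterSr.
Qed.

Lemma pmom_norm_le (p q N : nat) (u : int -> 'M[C]_(p, q)) (B : R) :
  supported_in N u -> (forall k, entry_norm (u k) <= B) ->
  forall l, entry_norm (pmom 'X^l u) <= (N.*2.+1)%:R * (N%:R ^+ l * B).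
Proof.
move=> uN uB l; have B0 := le_trans (entry_norm_ge0 _) (uB 0).
apply: entry_norm_zsum => [k /uN ->|k]; first by rewrite scaler0.
have [kN|kN] := ltnP N `|k|%N.
  by rewrite uN// scaler0 entry_norm0 mulr_ge0// exprn_ge0.
rewrite entry_normZ hornerXn normcX normc_int ler_pM ?exprn_ge0//.
  exact: entry_norm_ge0.
by rewrite lerXn2r ?nnegrE// -intr_norm -abszE ler_nat.
Qed.

Section with_filter.
Variable v : int -> 'rV[C]_r.
Hypotheses (fv : fin_supp v) (v0 : pmom 1 v != 0).

Lemma right_inverse : exists z : 'cV[C]_r, pmom 1 v *m z = 1%:M.
Proof.
have /rV0Pn[k vk] := v0.
exists ((pmom 1 v 0 k)^-1 *: delta_mx k 0); rewrite -scalemxAr.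
apply/matrixP => x y; rewrite !ord1 -colE !mxE mulVf//.
Qed.

Lemma conv_delta (p q s : nat) (w : int -> 'M[C]_(p, q)) (B : 'M[C]_(q, s)) k :
  convolution w (fun k => if k == 0 then B else 0) k = w k *m B.
Proof.
rewrite /convolution (zsum1 (i := 0)) ?eqxx ?subr0// => x /negbTE ->.
by rewrite mulmx0.
Qed.

(* The value of the symbol of u at 0 can be prescribed in the kernel of that *)
(* of v, the remaining Taylor coefficients being used to kill those of v*u.  *)
Lemma annihilates_exists (y : 'cV[C]_r) n : pmom 1 v *m y = 0 ->
  exists2 u, annihilates v n u & pmom 1 u = y.
Proof.
move=> vy; have [z vz] := right_inverse.
(* The induction runs at n + 1 so that its base case is the hypothesis on [y]. The corrections are
   then differences of positive order, which do not change the value of the symbol at 0. *)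
have : exists2 u, annihilates v n.+1 u & pmom 1 u = y.
  elim: n => [|n [u [fu Vu] u0]].
    pose d (k : int) : 'cV[C]_r := if k == 0 then y else 0.
    have fd : fin_supp d by exact: fin_supp_delta.
    exists d; last by rewrite pmom_delta hornerC scale1r.
    split=> //; apply: mom_eqP; [exact: fin_supp_conv|by exists 0%N|].
    move=> [|//] _; rewrite expr0 pmom1_conv// pmom_delta hornerC scale1r vy.
    by rewrite /pmom fsbig1// => k _; rewrite scaler0.
  pose c := - pmom 'X^(n.+1) (convolution v u) 0 0 / ((-1) ^+ n.+1 * (n.+1)`!%:R).
  pose d (k : int) : 'cV[C]_r := if k == 0 then c *: z else 0.
  have fd : fin_supp d by exact: fin_supp_delta.
  have fN := fin_supp_iter_nabla n.+1 fd.
  have [d0 _] := pmomX_iter_nabla n.+1 fd.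
  have fvd := fin_supp_conv fv fd.
  have [w0 wn] := pmomX_iter_nabla n.+1 fvd.
  exists (fun k => u k + iter n.+1 nabla d k); last first.
    by have := d0 0%N isT; rewrite expr0 pmomDr// u0 => ->; rewrite addr0.
  split; first exact: fin_suppD.
  rewrite (_ : convolution v _ = fun k => convolution v u k +
      iter n.+1 nabla (convolution v d) k); last first.
    by apply/funext => k; rewrite convDr// conv_iter_nablar.
  have z0 l : pmom 'X^l (fun _ : int => 0 : 'M[C]_1) = 0.
    by rewrite /pmom fsbig1// => k _; rewrite scaler0.
  have fvu := fin_supp_conv fv fu.
  apply: mom_eqP; [|by exists 0%N|].
    by apply: fin_suppD => //; exact: fin_supp_iter_nabla.
  move=> l; rewrite ltnS leq_eqVlt z0 pmomDr//; last exact: fin_supp_iter_nabla.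
  move=> /predU1P[->|ln]; last by rewrite w0// addr0 Vu ?z0 ?size_polyXn.
  rewrite wn pmom1_conv// pmom_delta hornerC scale1r -scalemxAr vz.
  have den : (-1) ^+ n.+1 * (n.+1)`!%:R != 0 :> C.
    by rewrite mulf_neq0 ?signr_eq0// pnatr_eq0 -lt0n fact_gt0.
  rewrite scalerA /c mulrC divfK//.
  by apply/matrixP => x1 x2; rewrite !ord1 !mxE mulr1 subrr.
case=> u [fu Vu] u0; exists u => //; split=> //.
exact: mom_eqW Vu.
Qed.

Variables (J : nat) (kappa : R).
Hypotheses (kappa0 : 0 < kappa)
  (Hgrow : forall u, annihilates v J u -> growth a u kappa).

(** Summing A_n * u over the integers gives 2^n a^(0)^n y. The sum has O(2^n) terms of size
    O(kappa^n), and the powers of 2 cancel. *)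
Lemma iter_symbol_decay (y : 'cV[C]_r) : pmom 1 v *m y = 0 ->
  exists B : R, forall n, entry_norm (iter n (mulmx a0) y) <= B * kappa ^+ n.
Proof.
move=> vy; have [u Vu uy] := annihilates_exists J vy.
have [fu _] := Vu; have [D D0 HD] := Hgrow Vu.
case: (fa) (fu) => N aN [M uM].
exists ((N + M).*2.+1%:R * D) => n.
have p2 : 0 < (2%:R : R) ^+ n by rewrite exprn_gt0.
have supp : supported_in (2 ^ n * (N + M)) (convolution (A n) u).
  apply: supported_inW; last first.
    exact: (convolution_supp (iter_subdivision_supp (n := n) aN) uM).
  rewrite mulnDr leq_add// ?leq_mul ?leq_pred//.
  by rewrite leq_pmull ?expn_gt0.
have := pmom_norm_le supp (HD n) 0.
rewrite pmom1_conv//; last exact: fin_supp_iter_subdivision.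
rewrite uy pmom1_iter entry_normZ normcX normc_nat expr0 mul1r.
rewrite -ler_pdivlMl// => h; apply: (le_trans h).
rewrite ler_pdivrMl// !mulrA ler_wpM2r ?exprn_ge0 ?(ltW kappa0)//.
rewrite ler_wpM2r ?(ltW D0)// -natrX -natrM ler_nat.
by rewrite mulnS -doubleMr -[X in (X < _)%N]add0n -addSn leq_add ?expn_gt0.
Qed.

(** If [w] is not a multiple of v^(0), some [y] in the kernel of v^(0) has w y nonzero. Then w
    a^(0)^n y = z^n w y, whereas a^(0)^n y is O(kappa^n). The extra term in [c] is invisible on that
    kernel; allowing it also covers generalized eigenvectors, as simplicity requires. *)
Lemma left_eigen_dichotomy (w : 'rV[C]_r) (z c : C) :
  matches a v 1 -> w *m a0 = z *: w + c *: pmom 1 v ->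
  (w <= pmom 1 v)%MS \/ normc z <= kappa.
Proof.
move=> va wz.
have va0 : pmom 1 v *m a0 = pmom 1 v.
  have := (matchesP fa 1 fv).1 va 0 isT.
  by rewrite big_ord0 !expr0 scale1r mulmxBr mulmx1 => /eqP; rewrite subr_eq0 => /eqP <-.
have [wv|] := boolP (w <= pmom 1 v)%MS; first by left.
rewrite submxE => /rV0Pn[k wk]; right.
pose y := col k (cokermx (pmom 1 v)).
have vy : pmom 1 v *m y = 0.
  by rewrite /y colE mulmxA mulmx_coker mul0mx.
have wy : (w *m y) 0 0 != 0 by rewrite /y colE mulmxA -colE mxE.
have vn n : pmom 1 v *m iter n (mulmx a0) y = 0.
  by elim: n => //= n IH; rewrite mulmxA va0.
have wn n : w *m iter n (mulmx a0) y = z ^+ n *: (w *m y).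
  elim: n => [|n IH]; first by rewrite expr0 scale1r.
  rewrite iterS mulmxA wz mulmxDl -!scalemxAl vn scaler0 addr0 IH scalerA.
  by rewrite exprS.
have [B HB] := iter_symbol_decay vy.
have wy0 : 0 < normc ((w *m y) 0 0).
  by rewrite lt_neqAle eq_sym normc_eq0 wy normc_ge0.
apply: (@expr_le_geometric _ _ (r%:R * entry_norm w * B / normc ((w *m y) 0 0))) => // n.
rewrite mulrAC ler_pdivlMr// -normcX -ComplexField.Normc.normcM.
have -> : z ^+ n * (w *m y) 0 0 = (w *m iter n (mulmx a0) y) 0 0.
  by rewrite wn [in RHS]mxE.
rewrite -entry_norm11 (le_trans (entry_normM _ _))//.
by rewrite !mulrA -[leRHS]mulrA ler_wpM2l ?mulr_ge0 ?entry_norm_ge0// HB.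
Qed.

End with_filter.
End spectral.

(** * Vanishing moments and growth rates *)

Section orders.
Context {R : realType}.
Notation C := R[i].
Notation normc := (@ComplexField.Normc.normc R).
Variables (r : nat) (a : int -> 'M[C]_r).
Hypothesis fa : fin_supp a.
Implicit Types (u : int -> 'cV[C]_r) (v : int -> 'rV[C]_r).

Notation A := (fun n => iter n (subdivision a) (dirac_id r)).

Lemma iter_subdivision_convE (p n : nat) (w : int -> 'M[C]_(p, r)) u (k : int) :
  fin_supp u ->
  convolution (iter n (subdivision a) w) u k =
  \sum_(l \in [set: int]) w l *m convolution (A n) u (k - (2 ^ n)%N%:Z * l).
Proof.
move=> [M uM].
have [L AL] := fin_supp_iter_subdivision n fa.
have big (l : int) : (absz l <= absz ((2 ^ n)%N%:Z * l)%R)%N.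
  by rewrite abszM leq_pmull// absz_nat expn_gt0.
transitivity (\sum_(z \in [set: int]) \sum_(l \in [set: int])
    w l *m A n (k - z - (2 ^ n)%N%:Z * l) *m u z).
  apply: eq_fsbigr => z _; rewrite (iter_subdivisionE _ _ _ fa) zsum_mulmxl//.
  exists (L + absz (k - z)%R)%N => l lL; rewrite AL ?mulmx0//.
  by move: (big l); lia.
transitivity (\sum_(l \in [set: int]) \sum_(z \in [set: int])
    w l *m A n (k - z - (2 ^ n)%N%:Z * l) *m u z).
  apply: (@zsum_exchange _ _ (M + L + `|k|)) => z l zl /=.
  have [zM|zM] := ltnP M `|z|%N; first by rewrite uM// mulmx0.
  by rewrite AL ?mulmx0 ?mul0mx//; move: (big l); lia.
apply: eq_fsbigr => l _; rewrite /convolution zsum_mulmxr; last first.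
  by exists M => z /uM ->; rewrite mulmx0.
apply: eq_fsbigr => z _; rewrite mulmxA.
by have -> : k - z - (2 ^ n)%N%:Z * l = k - (2 ^ n)%N%:Z * l - z by lia.
Qed.

(** The J-th moment of S_a^n v * u is exactly 2^n times a nonzero number. On the other hand it is a
    sum of O(2^n) terms of size O(kappa^n) with weights O(2^(Jn)); comparing the two, (2^J kappa)^n
    cannot tend to 0. *)
Lemma growth_lower v u (J : nat) (kappa : R) : fin_supp v -> fin_supp u ->
  matches a v J.+1 -> pmom 'X^J (convolution v u) != 0 ->
  0 < kappa -> growth a u kappa -> 2%:R ^- J <= kappa.
Proof.
move=> [N' vN] [M uM] va vu0 k0 [B B0 HB]; case: (fa) => N aN.
have fv : fin_supp v by exists N'. have fu : fin_supp u by exists M.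
have [W W0 HW] := fin_supp_bounded fv.
pose L := (N' + (N + M))%N.
pose w n := convolution (iter n (subdivision a) v) u.
have wE n k : w n k = \sum_(l \in [set: int]) v l *m
    convolution (A n) u (k - (2 ^ n)%N%:Z * l) by exact: iter_subdivision_convE.
have suppA n : supported_in (2 ^ n * (N + M)) (convolution (A n) u).
  apply: supported_inW; last first.
    exact: (convolution_supp (iter_subdivision_supp (n := n) aN) uM).
  rewrite mulnDr leq_add// ?leq_mul ?leq_pred//.
  by rewrite leq_pmull ?expn_gt0.
have suppw n : supported_in (2 ^ n * L) (w n).
  move=> k kL; rewrite wE fsbig1// => l _.
  have [lN|lN] := ltnP N' `|l|%N; first by rewrite vN// mul0mx.
  rewrite suppA ?mulmx0//.
  have : (absz ((2 ^ n)%N%:Z * l)%R <= 2 ^ n * N')%N.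
    by rewrite abszM leq_mul.
  by move: kL; rewrite /L mulnDr; lia.
pose D := (N'.*2.+1)%:R * (r%:R * (W * B)).
have boundw n k : entry_norm (w n k) <= D * kappa ^+ n.
  rewrite wE /D -mulrA -mulrA -mulrA; apply: entry_norm_zsum => [l lN|l].
    by rewrite vN// mul0mx.
  rewrite (le_trans (entry_normM _ _))// ler_wpM2l// ler_pM ?entry_norm_ge0//.
have pw n : 2%:R ^+ n * normc (pmom 'X^J (convolution v u) 0 0) =
    entry_norm (pmom 'X^J (w n)).
  have -> : pmom 'X^J (w n) = 2%:R ^+ n *: pmom 'X^J (convolution v u).
    have fvn : fin_supp (fun k => (2%:R : C) ^+ n *: v k) by exact: fin_suppZ.
    rewrite (mom_eq_conv (fin_supp_iter n fa fv) fvn fu (iter_matches fa fv n va)).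
      rewrite -pmomZr; last exact: fin_supp_conv.
      apply: eq_fsbigr => k _; congr (_ *: _).
      rewrite /convolution zsum_scale.
        by apply: eq_fsbigr => z _; rewrite scalemxAl.
      by exists M => z /uM ->; rewrite mulmx0.
    by rewrite size_polyXn.
  by rewrite entry_normZ entry_norm11 normcX normc_nat.
set c := normc _ in pw.
have c0 : 0 < c.
  rewrite /c -entry_norm11 lt_neqAle entry_norm_ge0 andbT eq_sym.
  by apply: contraNneq vu0 => /entry_norm_eq0 ->.
apply: (@expr_le_geometric _ _ _ ((L.*2.+1)%:R * L%:R ^+ J * D / c)) => // n.
have := pmom_norm_le (suppw n) (boundw n) J; rewrite -pw => h.
have p2 : 0 < (2%:R : R) ^+ n by rewrite exprn_gt0.
have D0 : 0 <= D by rewrite /D !mulr_ge0// ltW.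
have {}h : 2%:R ^+ n * c <=
    2%:R ^+ n * ((L.*2.+1)%:R * L%:R ^+ J * D * (2%:R ^+ J * kappa) ^+ n).
  apply: (le_trans h).
  rewrite natrM natrX !exprMn -!exprM [(n * J)%N]mulnC exprM.
  set x := _ ^+ n in p2 *; set y := (2%:R ^+ J) ^+ n.
  have -> : x * ((L.*2.+1)%:R * L%:R ^+ J * D * (y * kappa ^+ n)) =
     (x * (L.*2.+1)%:R) * (y * L%:R ^+ J * (D * kappa ^+ n)) by ring.
  rewrite ler_wpM2r//.
    by rewrite !mulr_ge0// ?exprn_ge0// ltW.
  rewrite /x -natrX -natrM ler_nat.
  by rewrite mulnS -doubleMr -[X in (X < _)%N]add0n -addSn leq_add ?expn_gt0.
move: h; rewrite ler_pM2l// exprMn => h.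
rewrite mulrAC ler_pdivlMr// exprVn ler_pdivrMl ?exprn_gt0//.
by rewrite mulrCA.
Qed.

Section polyphase_moments.
Variables (v : int -> 'rV[C]_r) (J : nat).
Hypotheses (fv : fin_supp v) (va : matches a v J) (ka : kills a v J).

Lemma pmom_scale2X (p q l : nat) (w : int -> 'M[C]_(p, q)) : fin_supp w ->
  pmom (affpoly 2%:R 0 'X^l) w = 2%:R ^+ l *: pmom 'X^l w.
Proof.
move=> fw; rewrite -pmomZl//; congr (pmom _ _).
by rewrite /affpoly comp_Xn_poly addr0 exprZn.
Qed.

Lemma pmomX_polyphase u l (g : int) : fin_supp u -> (l < J)%N ->
  2%:R ^+ l *: pmom 'X^l (convolution v (polyphase a g u)) =
  \sum_(i < l.+1) ('C(l, i)%:R * (- g%:~R) ^+ (l - i)) *: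
    pmom 'X^i (convolution v u).
Proof.
move=> fu lJ; have fp := fin_supp_polyphase g fa fu.
rewrite -pmom_scale2X; last exact: fin_supp_conv.
rewrite (pmom_polyphase fa fv _ fu va ka) ?size_polyXn//.
rewrite pmom_affpolyX; last exact: fin_supp_conv.
by apply: eq_bigr => i _; rewrite expr1n mulr1.
Qed.

(** For l <= j only the term i = l survives in [pmomX_polyphase], so the l-th moment of the
    component is 2^-l times that of [u]. Both vanish below j, and subtracting 2^-j u cancels the one
    of order j. *)
Lemma annihilates_polyphase u j (g : int) : (j < J)%N ->
  annihilates v j u ->
  annihilates v j.+1 (fun k => polyphase a g u k - (2%:R ^- j)%:C *: u k).
Proof.
move=> jJ [fu Vu]; have fp := fin_supp_polyphase g fa fu.
have fcu : fin_supp (fun k => (2%:R ^- j : R)%:C *: u k) by exact: fin_suppZ.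
have z0 l : pmom 'X^l (fun _ : int => 0 : 'M[C]_1) = 0.
  by rewrite /pmom fsbig1// => k _; rewrite scaler0.
split; first exact: fin_suppB.
rewrite (_ : convolution v _ = fun k => convolution v (polyphase a g u) k -
  (2%:R ^- j : R)%:C *: convolution v u k); last first.
  by apply/funext => k; rewrite convBr// convZr.
have fvu := fin_supp_conv fv fu; have fvp := fin_supp_conv fv fp.
have Vl l : (l < j)%N -> pmom 'X^l (convolution v u) = 0.
  by move=> lj; rewrite Vu ?z0// size_polyXn.
apply: mom_eqP; [|by exists 0%N|move=> l lj].
  by apply: fin_suppB => //; exact: fin_suppZ.
rewrite z0 pmomBr//; last exact: fin_suppZ.
rewrite pmomZr//; apply/eqP; rewrite subr_eq0; apply/eqP.
have n2 : (2%:R : C) ^+ l != 0 by rewrite expf_neq0// pnatr_eq0.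
apply: (scalerI n2); rewrite pmomX_polyphase//; last exact: leq_trans jJ.
rewrite big_ord_recr/= binn subnn expr0 mul1r scale1r big1 => [|i _]; last first.
  by rewrite Vl ?scaler0//; exact: leq_trans (ltn_ord i) lj.
rewrite add0r; move: lj; rewrite ltnS leq_eqVlt => /predU1P[->|lj]; last first.
  by rewrite Vl// !scaler0.
by rewrite scalerA rmorphV ?unitfE ?expf_neq0 ?pnatr_eq0// rmorphXn rmorph_nat
  divff ?scale1r// expf_neq0// pnatr_eq0.
Qed.

(** [annihilates_polyphase] passes from j to j + 1, and [growth_polyphase] with c = 2^-j comes back,
    which requires 2^-j < kappa. *)
Lemma growth_order (kappa : R) : 0 < kappa ->
  (forall u, annihilates v J u -> growth a u kappa) ->
  forall j u, (j <= J)%N -> (2%:R ^- j < kappa) ->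
  annihilates v j u -> growth a u kappa.
Proof.
move=> k0 HJ; suff H d j u : (j + d = J)%N -> 2%:R ^- j < kappa ->
    annihilates v j u -> growth a u kappa.
  by move=> j u jJ; apply: (H (J - j)%N); rewrite subnKC.
elim: d j u => [|d IH] j u; first by rewrite addn0 => -> _; exact: HJ.
move=> jd jk Vu; have jJ : (j < J)%N by rewrite -jd -addSnnS leq_addr.
have [fu _] := Vu.
have V0 := annihilates_polyphase 0 jJ Vu.
have V1 := annihilates_polyphase 1 jJ Vu.
have jk1 : 2%:R ^- j.+1 < kappa.
  apply: lt_trans jk; rewrite ltf_pV2 ?posrE ?exprn_gt0//.
  by rewrite ltr_eXn2l// ltr1n.
have jd' : (j.+1 + d = J)%N by rewrite addSnnS.
apply: (@growth_polyphase _ _ _ fa u _ _ (2%:R ^- j) kappa fu _ _ (proj1 V0) _ (proj1 V1)).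
- by rewrite invr_ge0 exprn_ge0.
- by move=> k; rewrite addrC subrK.
- by move=> k; rewrite addrC subrK.
- exact: IH V0.
- exact: IH V1.
Qed.

End polyphase_moments.
End orders.

(** * Derivatives of symbols *)

Section calculus.
Context {R : realType}.
Notation C := R[i].
Notation normc := (@ComplexField.Normc.normc R).

Lemma is_derive_funD (f g : R -> R) (x a b : R) :
  is_derive x 1 f a -> is_derive x 1 g b ->
  is_derive x 1 (fun t => f t + g t) (a + b).
Proof. exact: is_deriveD. Qed.

Lemma is_derive_funZ (c : R) (f : R -> R) (x a : R) :
  is_derive x 1 f a -> is_derive x 1 (fun t => c * f t) (c * a).
Proof. exact: is_deriveZ. Qed.

Lemma is_derive_affine (f : R -> R) (l m x a : R) :
  is_derive (l * x + m) 1 f a -> is_derive x 1 (fun t => f (l * t + m)) (l * a).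
Proof.
move=> fa; rewrite mulrC.
apply: (@is_derive1_comp _ f (fun t => l * t + m)).
rewrite -[X in is_derive _ _ _ X]addr0; apply: is_derive_funD.
rewrite -[X in is_derive _ _ _ X]mulr1.
exact: (@is_derive_funZ l id).
Qed.

Definition is_cderive (f : R -> C) (x : R) (d : C) : Prop :=
  is_derive x 1 (fun t => complex.Re (f t)) (complex.Re d) /\
  is_derive x 1 (fun t => complex.Im (f t)) (complex.Im d).

Lemma ReM (z w : C) :
  complex.Re (z * w) = complex.Re z * complex.Re w - complex.Im z * complex.Im w.
Proof. by case: z w => [a b] [c d]. Qed.

Lemma ImM (z w : C) :
  complex.Im (z * w) = complex.Re z * complex.Im w + complex.Im z * complex.Re w.
Proof. by case: z w => [a b] [c d]. Qed.

Lemma ReD (z w : C) : complex.Re (z + w) = complex.Re z + complex.Re w.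
Proof. by case: z w => [a b] [c d]. Qed.

Lemma ImD (z w : C) : complex.Im (z + w) = complex.Im z + complex.Im w.
Proof. by case: z w => [a b] [c d]. Qed.

Lemma is_cderiveD (f g : R -> C) (x : R) (a b : C) :
  is_cderive f x a -> is_cderive g x b ->
  is_cderive (fun t => f t + g t) x (a + b).
Proof.
move=> [f1 f2] [g1 g2]; split.
  under eq_fun do rewrite ReD.
  by rewrite ReD; exact: is_derive_funD.
under eq_fun do rewrite ImD.
by rewrite ImD; exact: is_derive_funD.
Qed.

Lemma is_cderiveZ (c : C) (f : R -> C) (x : R) (a : C) :
  is_cderive f x a -> is_cderive (fun t => c * f t) x (c * a).
Proof.
move=> [f1 f2]; split.
  under eq_fun do rewrite ReM -mulNr.
  by rewrite ReM -mulNr; apply: is_derive_funD; exact: is_derive_funZ.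
under eq_fun do rewrite ImM.
by rewrite ImM; apply: is_derive_funD; exact: is_derive_funZ.
Qed.

Lemma is_cderive_cst (c : C) (x : R) : is_cderive (fun=> c) x 0.
Proof. by split; exact: is_derive_cst. Qed.

Lemma is_cderive_sum (I : Type) (s : seq I) (f : I -> R -> C) (x : R)
    (a : I -> C) : (forall i, is_cderive (f i) x (a i)) ->
  is_cderive (fun t => \sum_(i <- s) f i t) x (\sum_(i <- s) a i).
Proof.
move=> fa; elim: s => [|i s IH].
  by rewrite big_nil; under eq_fun do rewrite big_nil; exact: is_cderive_cst.
rewrite big_cons; under eq_fun do rewrite big_cons.
exact: is_cderiveD.
Qed.

Lemma is_cderive_affine (f : R -> C) (l m x : R) (a : C) :
  is_cderive f (l * x + m) a ->
  is_cderive (fun t => f (l * t + m)) x (l%:C * a).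
Proof.
move=> [f1 f2]; split.
  rewrite ReM/= mul0r subr0.
  exact: (is_derive_affine (f := fun t => complex.Re (f t))).
rewrite ImM/= mul0r addr0.
exact: (is_derive_affine (f := fun t => complex.Im (f t))).
Qed.

Lemma is_cderive_cis (x : R) : is_cderive cis x ('i%C * cis x).
Proof.
split; rewrite ?ReM ?ImM /= !(mul0r, mul1r, sub0r, add0r).
  exact: is_derive_cos.
exact: is_derive_sin.
Qed.

Lemma is_cderive_cisZ (l x : R) :
  is_cderive (fun t => cis (l * t)) x ('i%C * l%:C * cis (l * x)).
Proof.
rewrite -mulrA mulrCA -[X in cis X]addr0.
have -> : (fun t => cis (l * t)) = (fun t => cis (l * t + 0)) :> (R -> C).
  by apply/funext => t; rewrite addr0.
exact/is_cderive_affine/is_cderive_cis.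
Qed.

(** Iterated derivatives are identified by proposing a candidate for each order and comparing
    consecutive candidates only. Exponential sums, limit functions and Taylor remainders are all
    treated through such chains. *)
Lemma derive1n_chain (m : nat) (G : nat -> R -> R) :
  (forall n (x : R), (n < m)%N -> is_derive x 1 (G n) (G n.+1 x)) ->
  forall n, (n <= m)%N -> derive1n n (G 0%N) = G n.
Proof.
move=> GD; elim=> [|n IH] nm; first exact: derive1n0.
have nm' := ltnW nm.
have -> : derive1n n.+1 (G 0%N) = derive1 (derive1n n (G 0%N)) by [].
rewrite (IH nm'); apply/funext => x; rewrite derive1E.
by have H := GD n x nm; rewrite (@derive_val _ _ _ _ _ _ _ H).
Qed.

Lemma real_class_C_chain (m : nat) (G : nat -> R -> R) :
  (forall n (x : R), (n < m)%N -> is_derive x 1 (G n) (G n.+1 x)) ->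
  (forall n, (n <= m)%N -> continuous (G n)) -> real_class_C m (G 0%N).
Proof.
move=> GD GC; split=> [n x nm|n nm].
  by rewrite (derive1n_chain GD (ltnW nm)); have := GD n x nm => /@ex_derive.
by rewrite (derive1n_chain GD nm); exact: GC.
Qed.

Lemma cderiven_chain (m : nat) (F : nat -> R -> C) :
  (forall n x, (n < m)%N -> is_cderive (F n) x (F n.+1 x)) ->
  forall n, (n <= m)%N -> cderiven n (F 0%N) = F n.
Proof.
move=> FD n nm; apply/funext => x; rewrite /cderiven.
have hR k (y : R) : (k < m)%N -> is_derive y 1
    (fun t => complex.Re (F k t)) (complex.Re (F k.+1 y)).
  by move=> km; have [] := FD k y km.
have hI k (y : R) : (k < m)%N -> is_derive y 1
    (fun t => complex.Im (F k t)) (complex.Im (F k.+1 y)).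
  by move=> km; have [] := FD k y km.
have eR := @derive1n_chain m (fun n t => complex.Re (F n t)) hR n nm.
have eI := @derive1n_chain m (fun n t => complex.Im (F n t)) hI n nm.
rewrite eR eI.
by case: (F n x).
Qed.

Lemma is_derive_continuous (f : R -> R) (x a : R) :
  is_derive x 1 f a -> {for x, continuous f}.
Proof.
by move=> /@ex_derive; rewrite derivable1_diffP => /differentiable_continuous.
Qed.

Lemma smooth_chain (F : nat -> R -> C) :
  (forall n x, is_cderive (F n) x (F n.+1 x)) ->
  smooth (F 0%N) /\ forall n, cderiven n (F 0%N) = F n.
Proof.
move=> FD; split=> [m|n]; last exact: (cderiven_chain (m := n)).
split.
  apply: (@real_class_C_chain _ (fun n t => complex.Re (F n t))) => n x.
    by move=> _; have [] := FD n x.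
  by move=> y; have [/is_derive_continuous] := FD n y.
apply: (@real_class_C_chain _ (fun n t => complex.Im (F n t))) => n x.
  by move=> _; have [] := FD n x.
by move=> y; have [_ /is_derive_continuous] := FD n y.
Qed.

Lemma cis0 : cis 0 = 1 :> C.
Proof. by rewrite /cis cos0 sin0. Qed.

Lemma cisD (x y : R) : cis (x + y) = cis x * cis y :> C.
Proof. by rewrite /cis cosD sinD /=; apply/eqP; rewrite eq_complex/= eqxx addrC eqxx. Qed.

Lemma normc_cis (x : R) : normc (cis x) = 1.
Proof. by rewrite /= cos2Dsin2 sqrtr1. Qed.

Lemma expsum_chain (I : Type) (s : seq I) (c : I -> C) (l : I -> R) :
  smooth (fun t => \sum_(i <- s) c i * cis (l i * t)) /\
  forall n, cderiven n (fun t => \sum_(i <- s) c i * cis (l i * t)) =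
    (fun t => \sum_(i <- s) c i * ('i%C * (l i)%:C) ^+ n * cis (l i * t)).
Proof.
pose F n t := \sum_(i <- s) (c i * ('i%C * (l i)%:C) ^+ n) * cis (l i * t).
have F0 : (fun t => \sum_(i <- s) c i * cis (l i * t)) = F 0%N.
  by apply/funext => t; apply: eq_bigr => j _; rewrite expr0 mulr1.
rewrite F0; apply: smooth_chain => n x; apply: is_cderive_sum => j.
rewrite exprSr mulrA -mulrA; apply: is_cderiveZ; exact: is_cderive_cisZ.
Qed.

End calculus.

(** * Symbols in terms of moments *)

Section symbols.
Context {R : realType}.
Notation C := R[i].

Lemma symbol_win (p q N : nat) (u : int -> 'M[C]_(p, q)) (t : R) :
  supported_in N u ->
  symbol u t = \sum_(k <- zwin N) cis (- (k%:~R * t)) *: u k.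
Proof. by move=> uN; apply: zsum_win => k /uN ->; rewrite scaler0. Qed.

Lemma symbol_entry (p q N : nat) (u : int -> 'M[C]_(p, q)) x y :
  supported_in N u ->
  (fun t => symbol u t x y) =
  (fun t => \sum_(k <- zwin N) u k x y * cis (- k%:~R * t)).
Proof.
move=> uN; apply/funext => t; rewrite (symbol_win _ uN) summxE.
by apply: eq_bigr => k _; rewrite mxE mulrC mulNr.
Qed.

Lemma cderiven_symbol0 (p q n : nat) (u : int -> 'M[C]_(p, q)) x y :
  fin_supp u ->
  cderiven n (fun t => symbol u t x y) 0 = (- 'i%C) ^+ n * pmom 'X^n u x y.
Proof.
move=> [N uN]; rewrite (symbol_entry x y uN).
rewrite (proj2 (expsum_chain _ _ _) n) /pmom (@zsum_win _ N); last first.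
  by move=> k /uN ->; rewrite scaler0.
rewrite summxE mulr_sumr; apply: eq_bigr => k _.
rewrite mulr0 cis0 mulr1 mxE hornerXn mulrC mulrA rmorphN mulrN -mulNr exprMn.
by rewrite rmorph_int.
Qed.

Lemma mxderiven_symbol0 (p q n : nat) (u : int -> 'M[C]_(p, q)) :
  fin_supp u -> mxderiven n (symbol u) 0 = (- 'i%C) ^+ n *: pmom 'X^n u.
Proof. by move=> fu; apply/matrixP => x y; rewrite !mxE cderiven_symbol0. Qed.

Lemma Ni_neq0 n : (- 'i%C : C) ^+ n != 0.
Proof. by rewrite expf_neq0// oppr_eq0 eq_complex/= eqxx oner_eq0. Qed.

Lemma mxeqO_symbol (p q n : nat) (u w : int -> 'M[C]_(p, q)) :
  fin_supp u -> fin_supp w ->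
  mxeqO n (symbol u) (symbol w) <-> mom_eq n u w.
Proof.
move=> fu fw; split=> [H|H x y l ln]; last first.
  by rewrite !cderiven_symbol0// H// size_polyXn.
apply: mom_eqP => // l ln; apply/matrixP => x y.
by have := H x y l ln; rewrite !cderiven_symbol0// => /(mulfI (Ni_neq0 l)).
Qed.

Lemma symbol0_fun (p q : nat) : symbol (fun=> 0 : 'M[C]_(p, q)) = (fun _ : R => 0).
Proof. by apply/funext => t; apply: fsbig1 => k _; rewrite scaler0. Qed.

Lemma symbol_at0 (p q : nat) (u : int -> 'M[C]_(p, q)) : symbol u 0 = pmom 1 u.
Proof.
by apply: eq_fsbigr => k _; rewrite mulr0 oppr0 cis0 hornerC.
Qed.

Lemma symbolZ (p q : nat) (c : C) (u : int -> 'M[C]_(p, q)) (t : R) :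
  fin_supp u -> symbol (fun k => c *: u k) t = c *: symbol u t.
Proof.
move=> [N uN]; rewrite /symbol zsum_scale; last first.
  by exists N => k /uN ->; rewrite scaler0.
by apply: eq_fsbigr => k _; rewrite !scalerA [X in _ = X *: _]mulrC.
Qed.

Lemma symbol_conv (p q s : nat) (u : int -> 'M[C]_(p, q))
    (v : int -> 'M[C]_(q, s)) (t : R) : fin_supp u -> fin_supp v ->
  symbol (convolution u v) t = symbol u t *m symbol v t.
Proof.
move=> fu fv; rewrite /symbol (conv_sum (fun j => cis (- (j%:~R * t))))//.
case: (fu) (fv) => N uN [M vM].
rewrite zsum_mulmxl; last by exists N => k /uN ->; rewrite scaler0.
apply: eq_fsbigr => x _; rewrite zsum_mulmxr; last first.
  by exists M => k /vM ->; rewrite scaler0.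
apply: eq_fsbigr => y _; rewrite rmorphD mulrDl opprD cisD.
by rewrite -scalemxAl -scalemxAr scalerA.
Qed.

Lemma symbol_subdivision (p r : nat) (a : int -> 'M[C]_r)
    (b : int -> 'M[C]_(p, r)) (t : R) : fin_supp a -> fin_supp b ->
  symbol (subdivision a b) t = 2%:R *: (symbol b (2%:R * t) *m symbol a t).
Proof.
move=> fa fb; rewrite /symbol (subdivision_sum (fun j => cis (- (j%:~R * t))))//.
case: (fa) (fb) => N aN [M bM]; congr (_ *: _).
rewrite zsum_mulmxr; last by exists N => k /aN ->; rewrite scaler0.
apply: eq_fsbigr => y _; rewrite zsum_mulmxl; last first.
  by exists M => k /bM ->; rewrite scaler0.
apply: eq_fsbigr => x _; rewrite rmorphD rmorphM/= mulrDl opprD cisD.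
by rewrite -scalemxAl -scalemxAr scalerA [2%:~R * _]mulrC -[_ * 2%:~R * t]mulrA.
Qed.

Lemma cis_natpi (n : nat) : cis (n%:R * pi) = (-1) ^+ n :> C.
Proof.
elim: n => [|n IH]; first by rewrite mul0r cis0 expr0.
rewrite -natr1 mulrDl mul1r cisD IH exprSr; congr (_ * _).
by rewrite /cis cospi sinpi; apply/eqP; rewrite eq_complex/= oppr0 !eqxx.
Qed.

Lemma cis_intpi (k : int) : cis (- (k%:~R * pi)) = (-1) ^+ `|k| :> C.
Proof.
have N n : cis (- (n%:R * pi)) = (-1) ^+ n :> C.
  have : cis (n%:R * pi) * cis (- (n%:R * pi)) = 1 :> C by rewrite -cisD subrr cis0.
  rewrite cis_natpi => /(congr1 (fun z => (-1) ^+ n * z)).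
  by rewrite mulrA -exprD addnn -signr_odd odd_double expr0 mul1r mulr1.
case: k => n; first exact: N.
by rewrite NegzE rmorphN mulNr opprK abszN cis_natpi.
Qed.

Lemma symbol_shift_pi (p q : nat) (u : int -> 'M[C]_(p, q)) (t : R) :
  symbol u (t + pi) = symbol (alternate u) t.
Proof.
apply: eq_fsbigr => k _; rewrite mulrDr opprD cisD cis_intpi.
by rewrite /alternate scalerA.
Qed.

(** The integers j and j - 2k have the same parity, so the sign passes from the mask to the
    result. *)
Lemma alternate_subdivision (p r : nat) (a : int -> 'M[C]_r)
    (b : int -> 'M[C]_(p, r)) : fin_supp b ->
  subdivision (alternate a) b = alternate (subdivision a b).
Proof.
move=> [N bN]; apply/funext => j.
rewrite /alternate /subdivision [RHS]scalerA [X in _ = X *: _]mulrC -[RHS]scalerA.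
congr (_ *: _).
rewrite [RHS]zsum_scale; last by exists N => k /bN ->; rewrite mul0mx.
apply: eq_fsbigr => k _; rewrite -scalemxAr; congr (_ *: _).
rewrite -signr_odd -[RHS]signr_odd; congr (_ ^+ nat_of_bool _).
by lia.
Qed.

Section filters.
Variables (r : nat) (a : int -> 'M[C]_r).
Hypothesis fa : fin_supp a.
Implicit Types (u : int -> 'cV[C]_r) (v : int -> 'rV[C]_r).

Lemma symbol_refine v (t : R) : fin_supp v ->
  symbol v (2%:R * t) *m symbol a t =
  symbol (fun k => 2%:R^-1 *: subdivision a v k) t.
Proof.
move=> fv; have fS := fin_supp_subdivision fa fv.
rewrite symbolZ// symbol_subdivision// scalerA mulVf ?pnatr_eq0//.
by rewrite scale1r.
Qed.

Lemma half_mom_eq k (s t : int -> 'rV[C]_r) : fin_supp s -> fin_supp t ->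
  mom_eq k (fun k => 2%:R^-1 *: s k) t <-> mom_eq k s (fun k => 2%:R *: t k).
Proof.
move=> fs ft; have n2 : (2%:R : C) != 0 by rewrite pnatr_eq0.
split=> H f fk; have := H f fk; rewrite !pmomZr//.
  by move=> <-; rewrite scalerA divff// scale1r.
by move=> ->; rewrite scalerA mulVf// scale1r.
Qed.

Lemma mxeqO_refine k v : fin_supp v ->
  mxeqO k (fun xi => symbol v (2%:R * xi) *m symbol a xi) (symbol v) <->
  matches a v k.
Proof.
move=> fv; have fS := fin_supp_subdivision fa fv.
have fh : fin_supp (fun k => 2%:R^-1 *: subdivision a v k) by exact: fin_suppZ.
have -> : (fun xi => symbol v (2%:R * xi) *m symbol a xi) =
    symbol (fun k => 2%:R^-1 *: subdivision a v k).
  by apply/funext => t; exact: symbol_refine.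
apply: (iff_trans (mxeqO_symbol k fh fv)).
exact: half_mom_eq.
Qed.

Lemma matching_filterP k v :
  matching_filter a k v <-> [/\ fin_supp v, pmom 1 v != 0 & matches a v k].
Proof.
rewrite -symbol_at0.
by split=> -[fv v0 H]; split=> //; apply/(mxeqO_refine k fv).
Qed.

Lemma mxeqO_kills k v : fin_supp v ->
  mxeqO k (fun xi => symbol v (2%:R * xi) *m symbol a (xi + pi)) (fun=> 0) <->
  kills a v k.
Proof.
move=> fv; have fS := fin_supp_subdivision fa fv.
have falt := fin_supp_alternate fa.
have fz : fin_supp (fun _ : int => 0 : 'rV[C]_r) by exists 0%N.
have faS := fin_supp_alternate fS.
have E : symbol (alternate (subdivision a v)) =
    (fun xi => 2%:R *: (symbol v (2%:R * xi) *m symbol a (xi + pi))).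
  apply/funext => t; rewrite symbol_shift_pi -alternate_subdivision//.
  exact: symbol_subdivision.
have -> : (fun xi => symbol v (2%:R * xi) *m symbol a (xi + pi)) =
    symbol (fun k => 2%:R^-1 *: alternate (subdivision a v) k).
  apply/funext => t; rewrite symbolZ// E scalerA mulVf ?pnatr_eq0//.
  by rewrite scale1r.
rewrite -symbol0_fun; have fh := fin_suppZ (fun=> 2%:R^-1) faS.
apply: (iff_trans (mxeqO_symbol k fh fz)).
apply: (iff_trans (half_mom_eq k faS fz)).
rewrite /kills; have -> // : (fun _ : int => 2%:R *: 0 : 'rV[C]_r) = fun=> 0.
by apply/funext => x; rewrite scaler0.
Qed.

Lemma sum_rulesP k v : sum_rules a k v <->
  [/\ fin_supp v, pmom 1 v != 0, matches a v k & kills a v k].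
Proof.
split=> [[/matching_filterP[fv v0 va] /(mxeqO_kills k fv) ka]//|[fv v0 va ka]].
by split; [apply/matching_filterP|apply/mxeqO_kills].
Qed.

Lemma vanishing_spaceP j v u : fin_supp v ->
  vanishing_space j v u <-> annihilates v j u.
Proof.
move=> fv; have fz : fin_supp (fun _ : int => 0 : 'M[C]_1) by exists 0%N.
have E : fin_supp u ->
    (fun xi => symbol v xi *m symbol u xi) = symbol (convolution v u).
  by move=> fu; apply/funext => t; rewrite symbol_conv.
split=> -[fu H]; split=> //; move: H.
  rewrite E// -symbol0_fun => /mxeqO_symbol; apply=> //.
  exact: fin_supp_conv.
by move=> H; rewrite E// -symbol0_fun; apply/mxeqO_symbol => //; exact: fin_supp_conv.
Qed.

End filters.
End symbols.

(** * Spectrum of the symbol at 0 *)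

Section setup.
Context {R : realType}.
Notation C := R[i].
Notation normc := (@ComplexField.Normc.normc R).

(** The two bounds exclude the degenerate cases: a spectral quantity [rho] equal to 0 would give the
    exponent +oo, and an infinite one -oo. *)
Lemma rho_sm (r : nat) (a : int -> 'M[C]_r) (s1 s2 : R) :
  (s1%:E <= sm_infty a)%E -> (sm_infty a <= s2%:E)%E ->
  exists s : R, sm_infty a = s%:E /\
    rho_infty a (sr a) (sr_filter a) = (2%:R `^ (- s))%:E.
Proof.
have l2 : 0 < ln (2%:R : R) by rewrite ln_gt0// ltr1n.
rewrite /sm_infty; set rho := rho_infty _ _ _.
have [|rho0] := leP rho 0%E.
  move=> /le0_lneNy ->; rewrite mulNyr gtr0_sg ?invr_gt0// mul1e.
  by move=> _; rewrite leye_eq.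
case: rho rho0 => [x| |//]; rewrite ?lte_fin => x0.
  rewrite lne_EFin// -EFinM -EFinN => h1 h2.
  exists (- (ln x * (ln 2%:R)^-1)); split=> //.
  rewrite opprK /powR pnatr_eq0/= -mulrA mulVf ?gt_eqF// mulr1.
  by rewrite lnK.
by rewrite /= mulyr gtr0_sg ?invr_gt0// mul1e leeNy_eq.
Qed.

Variables (r : nat) (a : int -> 'M[C]_r).
Hypothesis fa : fin_supp a.
Implicit Types (u : int -> 'cV[C]_r) (v : int -> 'rV[C]_r).

(** [sr] takes the default value 0 when there is no largest order; a positive value rules this case
    out. *)
Lemma sr_filterP : (0 < sr a)%N -> sum_rules a (sr a) (sr_filter a) /\
  forall k v, sum_rules a k v -> (k <= sr a)%N.
Proof.
move=> sr0.
have [[v vs] H] : [set k | (exists v, sum_rules a k v) /\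
    forall k' v, sum_rules a k' v -> (k' <= k)%N] (sr a).
  move: sr0; rewrite /sr; case: xgetP => [k ->//|]; by rewrite ltnn.
split=> //; rewrite /sr_filter.
by case: xgetP => [w ->//|/(_ v)].
Qed.

Lemma pmom0z (p q : nat) (f : {poly C}) :
  pmom f (fun _ : int => 0 : 'M[C]_(p, q)) = 0.
Proof. by rewrite /pmom fsbig1// => k _; rewrite scaler0. Qed.

Lemma annihilates_congr v w (c : C) j u : fin_supp v -> fin_supp w ->
  mom_eq j w (fun k => c *: v k) -> annihilates v j u -> annihilates w j u.
Proof.
move=> fv fw wv [fu Vu]; split=> // f fj.
have fcv : fin_supp (fun k => c *: v k) by exact: fin_suppZ.
rewrite (mom_eq_conv fw fcv fu wv fj) pmom0z.
have -> : convolution (fun k => c *: v k) u = fun k => c *: convolution v u k.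
  apply/funext => k; rewrite /convolution zsum_scale.
    by apply: eq_fsbigr => y _; rewrite scalemxAl.
  by case: fu => M uM; exists M => y /uM ->; rewrite mulmx0.
by rewrite pmomZr ?Vu ?pmom0z ?scaler0//; exact: fin_supp_conv.
Qed.

Lemma kills_congr v w (c : C) j : fin_supp v -> fin_supp w ->
  mom_eq j w (fun k => c *: v k) -> kills a v j -> kills a w j.
Proof.
move=> fv fw wv kv f fj.
have fcv : fin_supp (fun k => c *: v k) by exact: fin_suppZ.
have fal := fin_supp_alternate fa.
have fS := fin_supp_subdivision fal fv.
rewrite -alternate_subdivision// (mom_eq_subdivision fal fw fcv wv fj).
rewrite subdivisionZ// pmomZr// alternate_subdivision// kv// !pmom0z.
by rewrite scaler0.
Qed.

Section spectral_facts.
Variables (m J : nat) (v : int -> 'rV[C]_r) (kappa : R).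
Hypotheses (fv : fin_supp v) (v0 : pmom 1 v != 0) (J0 : (0 < J)%N).
Hypotheses (va : matches a v J) (kappa0 : 0 < kappa) (km : kappa < 2%:R ^- m).
Hypothesis Hgrow : forall u, annihilates v J u -> growth a u kappa.

Lemma matches1 : matches a v 1.
Proof. exact: mom_eqW va. Qed.

Lemma filter_fixed : pmom 1 v *m pmom 1 a = pmom 1 v.
Proof.
have := (matchesP fa 1 fv).1 matches1 0 isT.
by rewrite big_ord0 !expr0 scale1r mulmxBr mulmx1 => /eqP; rewrite subr_eq0 => /eqP <-.
Qed.

Lemma kappa_lt1 : kappa < 1.
Proof.
rewrite (lt_le_trans km)// invf_le1 ?exprn_gt0// exprn_ege1// ler1n//.
Qed.

Lemma eigen1_unique (w : 'rV[C]_r) : w *m pmom 1 a = w ->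
  exists c : C, w = c *: pmom 1 v.
Proof.
move=> wa; have := left_eigen_dichotomy fa fv v0 kappa0 Hgrow
  (w := w) (z := 1) (c := 0) matches1.
rewrite scale1r scale0r addr0 => /(_ wa)[/sub_rVP//|].
by rewrite ComplexField.Normc.normc1 leNgt kappa_lt1.
Qed.

Lemma mup_symbol : mup 1 (char_poly (pmom 1 a)) = 1%N.
Proof.
apply: (mup_char_poly_simple v0) => [|w c wE]; first by rewrite scale1r filter_fixed.
have [//|] := left_eigen_dichotomy fa fv v0 kappa0 Hgrow matches1 wE.
by rewrite ComplexField.Normc.normc1 leNgt kappa_lt1.
Qed.

Lemma eigenvalue_symbol (z : C) : eigenvalue (pmom 1 a) z -> z != 1 ->
  normc z < 2%:R ^- m.
Proof.
move=> /eigenvalueP[w wE w0] z1; apply: le_lt_trans km.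
have wE' : w *m pmom 1 a = z *: w + 0 *: pmom 1 v by rewrite scale0r addr0.
have [/sub_rVP[c wc]|//] := left_eigen_dichotomy fa fv v0 kappa0 Hgrow matches1 wE'.
move: wE; rewrite wc -scalemxAl filter_fixed scalerA => /eqP.
rewrite -subr_eq0 -scalerBl scaler_eq0 (negbTE v0) orbF subr_eq0.
rewrite -{1}[c]mul1r => /eqP/mulIf e; case/negP: z1; rewrite e//.
by apply: contraNneq w0 => c0; rewrite wc c0 scale0r.
Qed.

(** A singular matrix would make 2^-l an eigenvalue of a^(0) other than 1, yet 2^-l >= 2^-m. *)
Lemma unit_symbol l : (0 < l <= m)%N ->
  1%:M - 2%:R ^+ l *: pmom 1 a \in unitmx.
Proof.
move=> /andP[l0 lm]; rewrite -row_free_unit -kermx_eq0.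
apply/negPn/negP => /rowV0Pn[w /sub_kermxP wB w0].
have n2 : (2%:R : C) ^+ l != 0 by rewrite expf_neq0// pnatr_eq0.
have wE : w *m pmom 1 a = 2%:R ^- l *: w.
  move: wB; rewrite mulmxBr mulmx1 -scalemxAr => /eqP; rewrite subr_eq0 => /eqP e.
  by rewrite {2}e scalerA mulVf// scale1r.
have /eigenvalue_symbol : eigenvalue (pmom 1 a) (2%:R ^- l).
  by apply/eigenvalueP; exists w.
have nE : normc (2%:R ^- l) = 2%:R ^- l.
  by rewrite ComplexField.Normc.normcV normcX normc_nat.
rewrite nE => H; have : (2%:R : R) ^- l < 2%:R ^- m.
  apply: H; apply/eqP => /(congr1 normc); rewrite nE ComplexField.Normc.normc1.
  move/eqP; rewrite -[X in _ == X]invr1 (inj_eq invr_inj) => /eqP e.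
  have : (1 : R) < 2%:R ^+ l by rewrite exprn_egt1 -?lt0n ?ltr1n.
  by rewrite e ltxx.
apply/negP; rewrite -leNgt lef_pV2 ?posrE ?exprn_gt0//.
by rewrite ler_eXn2l// ltr1n.
Qed.

(* If J were at most m, the filter could be extended to order J+1, and the  *)
(* moment of order J would force a decay no faster than 2^-J.               *)
Lemma order_gt : (m < J)%N.
Proof.
rewrite ltnNge; apply/negP => Jm.
have uJ : 1%:M - 2%:R ^+ J *: pmom 1 a \in unitmx by rewrite unit_symbol ?J0.
have [w [fw wa vw]] := matches_extend fa fv uJ va.
have [z vz] := right_inverse v0.
pose d (k : int) : 'cV[C]_r := if k == 0 then z else 0.
have fd : fin_supp d by exact: fin_supp_delta.
pose u := iter J nabla d.
have fu : fin_supp u by exact: fin_supp_iter_nabla.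
have fvd := fin_supp_conv fv fd; have fwd := fin_supp_conv fw fd.
have [N0 _] := pmomX_iter_nabla J fvd; have [_ NJ] := pmomX_iter_nabla J fwd.
have Vu : annihilates v J u.
  split=> //; apply: mom_eqP => [||l lJ]; first exact: fin_supp_conv.
    by exists 0%N.
  by rewrite conv_iter_nablar// N0// pmom0z.
have := @growth_lower _ _ _ fa w u J kappa fw fu wa _ kappa0 (Hgrow Vu).
have -> : pmom 'X^J (convolution w u) != 0.
  rewrite conv_iter_nablar// NJ pmom1_conv// pmom_delta hornerC scale1r.
  rewrite -(vw 1) ?size_polyC ?oner_eq0// vz scaler_eq0.
  rewrite mulf_eq0 signr_eq0/= pnatr_eq0 gtn_eqF ?fact_gt0//=.
  by apply/eqP => /matrixP/(_ 0 0); rewrite !mxE => /eqP; rewrite oner_eq0.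
move=> /(_ isT); apply/negP; rewrite -ltNge (lt_le_trans km)//.
by rewrite lef_pV2 ?posrE ?exprn_gt0// ler_eXn2l// ltr1n.
Qed.

End spectral_facts.
End setup.

(** * Taylor coefficients of matching filters *)

Section filter_values.
Context {R : realType}.
Notation C := R[i].
Variables (r : nat) (a : int -> 'M[C]_r).
Hypothesis fa : fin_supp a.
Implicit Types (u : int -> 'cV[C]_r) (v : int -> 'rV[C]_r).

Lemma binomial_quotient (j k : nat) : (k <= j)%N ->
  (2%:R ^+ k * j`!%:R) / (k`!%:R * (j - k)`!%:R) = 'C(j, k)%:R * 2%:R ^+ k :> C.
Proof.
move=> kj; rewrite -(bin_fact kj) !natrM mulrA.
have f0 n : (n`!%:R : C) != 0 by rewrite pnatr_eq0 -lt0n fact_gt0.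
rewrite -mulrA divff ?mulf_neq0// mulr1 mulrC//.
Qed.

(** Every product on the right has total order of differentiation k + (j - k) = j, so the factor
    (-i)^j is common to both sides and drops out. *)
Lemma derivative_recursion v (j : nat) : fin_supp v ->
  1%:M - 2%:R ^+ j *: pmom 1 a \in unitmx ->
  mxderiven j (symbol v) 0 =
    \sum_(0 <= k < j) ((2%:R ^+ k * j`!%:R) / (k`!%:R * (j - k)`!%:R)) *:
      (mxderiven k (symbol v) 0 *m mxderiven (j - k) (symbol a) 0
        *m invmx (1%:M - 2%:R ^+ j *: pmom 1 a)) <->
  pmom 'X^j v *m (1%:M - 2%:R ^+ j *: pmom 1 a) =
    \sum_(i < j) ('C(j, i)%:R * 2%:R ^+ i) *:
      (pmom 'X^i v *m pmom 'X^(j - i) a).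
Proof.
move=> fv uB; set B := 1%:M - _ in uB *.
have -> : \sum_(0 <= k < j) ((2%:R ^+ k * j`!%:R) / (k`!%:R * (j - k)`!%:R)) *:
    (mxderiven k (symbol v) 0 *m mxderiven (j - k) (symbol a) 0 *m invmx B) =
    (- 'i%C) ^+ j *: ((\sum_(i < j) ('C(j, i)%:R * 2%:R ^+ i) *:
      (pmom 'X^i v *m pmom 'X^(j - i) a)) *m invmx B).
  rewrite big_mkord mulmx_suml scaler_sumr; apply: eq_bigr => k _.
  have kj := ltnW (ltn_ord k).
  rewrite binomial_quotient// !mxderiven_symbol0//.
  rewrite -!scalemxAl -!scalemxAr -!scalemxAl !scalerA; congr (_ *: _).
  by rewrite -exprD subnKC// [RHS]mulrC.
rewrite mxderiven_symbol0//; split=> [/(scalerI (Ni_neq0 j)) ->|<-].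
  by rewrite mulmxKV.
by rewrite mulmxK.
Qed.

Lemma matching_values m v : fin_supp v ->
  (forall l, (0 < l <= m)%N -> 1%:M - 2%:R ^+ l *: pmom 1 a \in unitmx) ->
  matching_filter a m.+1 v <->
  [/\ symbol v 0 != 0,
      symbol v 0 *m symbol a 0 = symbol v 0 &
      forall j, (1 <= j <= m)%N ->
        1%:M - 2%:R ^+ j *: symbol a 0 \in unitmx /\
        mxderiven j (symbol v) 0 =
        \sum_(0 <= k < j)
          ((2%:R ^+ k * j`!%:R) / (k`!%:R * (j - k)`!%:R)) *:
          (mxderiven k (symbol v) 0 *m mxderiven (j - k) (symbol a) 0
            *m invmx (1%:M - 2%:R ^+ j *: symbol a 0))].
Proof.
move=> fv uB; rewrite !symbol_at0; split.
  move=> /matching_filterP-/(_ fa)[_ v0 va]; split=> //.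
    exact: (@filter_fixed _ _ _ fa m.+1).
  move=> j jm; split; first exact: uB.
  apply/derivative_recursion => //; first exact: uB.
  by apply: (matchesP fa m.+1 fv).1 => //; case/andP: jm.
move=> [v0 va H]; apply/matching_filterP => //; split=> //.
apply/matchesP => // l; rewrite ltnS => lm.
have [->|l0] := posnP l.
  by rewrite big_ord0 !expr0 scale1r mulmxBr mulmx1 va subrr.
have [] := H l; first by rewrite l0.
by move=> ul /derivative_recursion; apply.
Qed.

Section comparison.
Variables (m J : nat) (v w : int -> 'rV[C]_r) (kappa : R).
Hypotheses (fv : fin_supp v) (v0 : pmom 1 v != 0) (mJ : (m < J)%N).
Hypotheses (va : matches a v J) (kappa0 : 0 < kappa) (km : kappa < 2%:R ^- m).
Hypothesis Hgrow : forall u, annihilates v J u -> growth a u kappa.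

Lemma J_gt0 : (0 < J)%N. Proof. exact: leq_ltn_trans mJ. Qed.

(** At 0 both filters are fixed by a^(0), hence proportional; the recursion propagates the scalar to
    the coefficients of order at most m. *)
Lemma matching_scalar : fin_supp w -> pmom 1 w != 0 -> matches a w m.+1 ->
  exists2 c : C, c != 0 & mom_eq m.+1 w (fun k => c *: v k).
Proof.
move=> fw w0 wa.
have wfix := @filter_fixed _ _ _ fa m.+1 w fw isT wa.
have [c wc] := eigen1_unique fa fv v0 J_gt0 va kappa0 km Hgrow wfix.
exists c; first by apply: contraNneq w0 => c0; rewrite wc c0 scale0r.
apply: (matches_unique fa fv fw) => // [l /andP[l0 lm]|].
  by apply: (unit_symbol fa fv v0 J_gt0 va kappa0 km Hgrow); rewrite l0.
exact: mom_eqW va.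
Qed.

End comparison.
End filter_values.

Lemma int_dist_lt2 (k l : int) : k < l + 2 -> l < k + 2 ->
  k = l \/ k = l + 1 \/ l = k + 1.
Proof. lia. Qed.

Lemma int_le_distE (k l : int) : k <= l -> l = k + (absz (l - k))%:Z.
Proof. lia. Qed.

Lemma int_add0 (k : int) : k + 0%N%:Z = k.
Proof. lia. Qed.

Lemma int_addSB (k : int) (d : nat) : k + d.+1%:Z - 1 = k + d%:Z.
Proof. lia. Qed.

(** * Limits on dyadic grids *)

Section dyadic.
Context {R : realType}.

(** With D = B / (1 - q), the intervals of radius D q^n around [u n] are nested, and the limit is
    their common point. *)
Lemma geometric_limit (u : nat -> R) (B q : R) : 0 < q < 1 -> 0 <= B ->
  (forall n, `|u n.+1 - u n| <= B * q ^+ n) ->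
  exists l, forall n, `|u n - l| <= B / (1 - q) * q ^+ n.
Proof.
move=> /andP[q0 q1] B0 H; set D := B / (1 - q).
have q1' : 0 < 1 - q by rewrite subr_gt0.
have D0 : 0 <= D by rewrite divr_ge0// ltW.
have DE n : D * q ^+ n - D * q ^+ n.+1 = B * q ^+ n.
  rewrite exprS /D; have : 1 - q != 0 by rewrite gt_eqF.
  by move=> ?; field.
pose v n := u n - D * q ^+ n; pose w n := u n + D * q ^+ n.
have vS n : v n <= v n.+1.
  by have := H n; rewrite ler_norml /v => /andP[+ _]; have := DE n; lra.
have wS n : w n.+1 <= w n.
  by have := H n; rewrite ler_norml /w => /andP[_ +]; have := DE n; lra.
have vw n : v n <= w n.
  have : 0 <= D * q ^+ n by rewrite mulr_ge0// exprn_ge0// ltW.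
  by rewrite /v /w; lra.
have vmono n k : v n <= v (n + k)%N.
  by elim: k => [|k IH]; rewrite ?addn0// addnS (le_trans IH).
have wmono n k : w (n + k)%N <= w n.
  by elim: k => [|k IH]; rewrite ?addn0// addnS (le_trans _ IH).
have vwnm n k : v n <= w k.
  rewrite (le_trans (vmono n k))// (le_trans (vw _))//.
  by rewrite addnC wmono.
have ub k : ubound (range v) (w k) by move=> _ [n _ <-].
have hs : has_sup (range v).
  by split; [exists (v 0%N); exists 0%N|exists (w 0%N); exact: ub].
exists (sup (range v)) => n; rewrite ler_norml.
have h1 : v n <= sup (range v) by apply: ub_le_sup; [exact: hs.2|exists n].
have h2 : sup (range v) <= w n by apply: ge_sup => //; exact: hs.1.
by move: h1 h2; rewrite /v /w -/D => h1 h2; apply/andP; split; lra.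
Qed.

Lemma geometric_small (B q e : R) : 0 < q < 1 -> 0 < e ->
  exists n, B * q ^+ n < e.
Proof.
move=> /andP[q0 q1] e0; apply: contrapT => /forallNP H.
have : 1 <= q.
  apply: (@expr_le_geometric _ _ _ (B / e)) => // n.
  rewrite expr1n mulrAC ler_pdivlMr// mul1r leNgt; apply/negP; exact: H.
by rewrite leNgt q1.
Qed.

Lemma geometric_le (B q x y : R) : 0 < q < 1 ->
  (forall n, x <= y + B * q ^+ n) -> x <= y.
Proof.
move=> q01 H; rewrite leNgt; apply/negP => yx.
have [n Hn] := @geometric_small B q (x - y) q01 ltac:(by rewrite subr_gt0).
by have := H n; lra.
Qed.

(** A sequence at level n is read as a step function, its value at k being taken on the interval
    from 2^-n k to 2^-n (k + 1); this is the index of the step containing [x]. *)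
Definition dyfloor (n : nat) (x : R) : int := Num.floor (2%:R ^+ n * x).

Lemma dyfloor_le n x : (dyfloor n x)%:~R <= 2%:R ^+ n * x.
Proof. exact: floor_le. Qed.

Lemma dyfloor_gt n x : 2%:R ^+ n * x < (dyfloor n x)%:~R + 1.
Proof. by have := floorD1_gt (2%:R ^+ n * x); rewrite rmorphD. Qed.

Lemma dyfloor_def n x (k : int) :
  k%:~R <= 2%:R ^+ n * x < k%:~R + 1 -> dyfloor n x = k.
Proof. by move=> H; apply/floor_def; rewrite rmorphD. Qed.

Lemma dyfloorS n x : dyfloor n.+1 x = 2 * dyfloor n x \/
  dyfloor n.+1 x = 2 * dyfloor n x + 1.
Proof.
have h1 := dyfloor_le n x; have h2 := dyfloor_gt n x.
set k := dyfloor n x in h1 h2 *; set y := 2%:R ^+ n * x in h1 h2.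
have yE : 2%:R ^+ n.+1 * x = 2%:R * y by rewrite exprS -mulrA.
have [h|h] := ltP (2%:R * y) (2 * k + 1)%:~R; [left|right].
  apply: dyfloor_def; rewrite yE; move: h; rewrite !rmorphD !rmorphM /=; lra.
apply: dyfloor_def; rewrite yE; move: h; rewrite !rmorphD !rmorphM /=; lra.
Qed.

Lemma dyfloor_dyadic n (k : int) : dyfloor n (2%:R ^- n * k%:~R) = k.
Proof.
apply: dyfloor_def; rewrite mulVKf ?expf_neq0 ?pnatr_eq0//.
by rewrite lexx ltrDl ltr01.
Qed.

Lemma dyfloor_mono n x y : x <= y -> dyfloor n x <= dyfloor n y.
Proof. by move=> xy; apply: le_floor; rewrite ler_pM2l ?exprn_gt0. Qed.

(** Both parities have to be controlled because the next floor of [x] may be either 2k or 2k + 1. *)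
Lemma dyadic_limit (F : nat -> int -> R) (B q : R) : 0 < q < 1 -> 0 <= B ->
  (forall n k, `|F n.+1 (2 * k) - F n k| <= B * q ^+ n) ->
  (forall n k, `|F n.+1 (2 * k + 1) - F n k| <= B * q ^+ n) ->
  exists g : R -> R,
    forall n x, `|F n (dyfloor n x) - g x| <= B / (1 - q) * q ^+ n.
Proof.
move=> q01 B0 H0 H1.
suff H x : exists l, forall n, `|F n (dyfloor n x) - l| <= B / (1 - q) * q ^+ n.
  have [g Hg] := choice H; exists g => n x; exact: Hg.
apply: geometric_limit => // n.
by have [->|->] := dyfloorS n x.
Qed.

(** Points closer than 2^-n lie on the same step or on neighbouring ones, and the jump between these
    is at most D q^n. *)
Lemma dyadic_limit_continuous (F : nat -> int -> R) (g : R -> R) (B D q : R) :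
  0 < q < 1 ->
  (forall n x, `|F n (dyfloor n x) - g x| <= B * q ^+ n) ->
  (forall n k, `|F n (k + 1) - F n k| <= D * q ^+ n) -> continuous g.
Proof.
move=> q01 Fg FD x; apply/cvgrPdist_lt => e e0.
have D0 : 0 <= D by have := le_trans (normr_ge0 _) (FD 0%N 0); rewrite expr0 mulr1.
have [n Hn] := @geometric_small (2%:R * B + D) q e q01 e0.
have p2 : 0 < (2%:R : R) ^- n by rewrite invr_gt0 exprn_gt0.
near=> y.
have xy : `|x - y| < 2%:R ^- n.
  by near: y; apply: cvgr_dist_lt => //; exact: cvg_id.
have p2' : 0 < (2%:R : R) ^+ n by rewrite exprn_gt0.
have {xy}xy : `|2%:R ^+ n * x - 2%:R ^+ n * y| < 1.
  by rewrite -mulrBr normrM gtr0_norm// -ltr_pdivlMl// mulr1.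
have close : `|F n (dyfloor n x) - F n (dyfloor n y)| <= D * q ^+ n.
  have [a1 a2] := (dyfloor_le n x, dyfloor_gt n x).
  have [b1 b2] := (dyfloor_le n y, dyfloor_gt n y).
  move: xy; rewrite ltr_norml => /andP[xy1 xy2].
  have d1 : dyfloor n x < dyfloor n y + 2.
    by rewrite -(ltr_int R) rmorphD/=; lra.
  have d2 : dyfloor n y < dyfloor n x + 2.
    by rewrite -(ltr_int R) rmorphD/=; lra.
  have : dyfloor n x = dyfloor n y \/ dyfloor n x = dyfloor n y + 1 \/
    dyfloor n y = dyfloor n x + 1.
    exact: int_dist_lt2.
  move=> [->|[->|->]]; rewrite ?subrr ?normr0 ?FD//; last by rewrite distrC FD.
  by rewrite mulr_ge0// exprn_ge0//; case/andP: q01 => /ltW.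
rewrite (le_lt_trans _ Hn)//.
have := Fg n x; have := Fg n y; move: close.
rewrite !ler_norml => /andP[? ?] /andP[? ?] /andP[? ?].
by apply/andP; split; lra.
Unshelve. all: by end_near. Qed.

Lemma telescope_slope (F : int -> R) (c e h : R) (k : int) (d : nat) :
  (forall l : int, k < l <= k + d%:Z -> `|F l - F (l - 1) - h * c| <= h * e) ->
  `|F (k + d%:Z) - F k - h * d%:R * c| <= h * d%:R * e.
Proof.
elim: d => [|d IH] H; first by rewrite int_add0 subrr mulr0n mulr0 !mul0r subrr normr0.
have {}IH : `|F (k + d%:Z) - F k - h * d%:R * c| <= h * d%:R * e.
  by apply: IH => l /andP[kl ld]; apply: H; rewrite kl (le_trans ld)// lerD2l lez_nat.
have := H (k + d.+1%:Z); rewrite int_addSB lexx andbT.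
have -> : k < k + d.+1%:Z by rewrite ltrDl.
move=> /(_ isT); move: IH; rewrite -natr1.
rewrite !ler_norml => /andP[? ?] /andP[? ?].
by apply/andP; split; lra.
Qed.

(** A discrete mean value inequality: [G n] being the difference quotient of [F n], the increment of
    [F n] between two floors is a sum of values of [G n], all close to [c]. It leads to the
    derivative of a limit without exchanging limit and derivative. *)
Lemma dyadic_slope (F G : nat -> int -> R) (f g : R -> R) (B q c e x y : R) :
  0 < q < 1 -> 0 <= B -> 0 <= e ->
  (forall n k, G n k = 2%:R ^+ n * (F n k - F n (k - 1))) ->
  (forall n x, `|F n (dyfloor n x) - f x| <= B * q ^+ n) ->
  (forall n x, `|G n (dyfloor n x) - g x| <= B * q ^+ n) ->
  x <= y -> (forall t, x <= t <= y -> `|g t - c| <= e) ->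
  `|f y - f x - c * (y - x)| <= e * (y - x).
Proof.
move=> q01 B0 e0 GE Ff Gg xy gc; have [q0 q1] := andP q01.
(* Two errors must vanish: the approximation error q^n and the mesh 2^-n. [Q] dominates both. *)
pose Q := Num.max q 2%:R^-1.
have Q01 : 0 < Q < 1.
  rewrite /Q lt_max q0/= gt_max q1/= invf_lt1 ?ltr1n//.
have Q0 : 0 <= Q by case/andP: Q01 => /ltW.
have qleQ : q <= Q by rewrite /Q le_max lexx.
have hleQ : 2%:R^-1 <= Q by rewrite /Q le_max lexx orbT.
have qQ n : q ^+ n <= Q ^+ n by rewrite lerXn2r ?nnegrE// ltW.
have hQ n : 2%:R ^- n <= Q ^+ n by rewrite -exprVn lerXn2r ?nnegrE// invr_ge0.
have xy0 : 0 <= y - x by rewrite subr_ge0.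
apply: (@geometric_le (2%:R * B + `|c| + B * (y - x + 1) + e) Q) => // n.
set kx := dyfloor n x; set ky := dyfloor n y.
pose h : R := 2%:R ^- n.
have h0 : 0 < h by rewrite invr_gt0 exprn_gt0.
have hK z : h * (2%:R ^+ n * z) = z by rewrite /h mulKf// expf_neq0// pnatr_eq0.
have kxy : kx <= ky by exact: dyfloor_mono.
pose d := absz (ky - kx).
have kE : ky = kx + d%:Z by exact: int_le_distE.
have qn0 : 0 <= q ^+ n by rewrite exprn_ge0// ltW.
have T : `|F n (kx + d%:Z) - F n kx - h * d%:R * c| <=
    h * d%:R * (B * q ^+ n + e).
  apply: telescope_slope => l /andP[kl lk].
  have kl1 : kx + 1 <= l by rewrite lezD1.
  have lin : x <= h * l%:~R <= y.
    have a2 := dyfloor_gt n x; have b1 := dyfloor_le n y.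
    have : (kx + 1)%:~R <= l%:~R :> R by rewrite ler_int.
    have : l%:~R <= ky%:~R :> R by rewrite ler_int kE.
    rewrite rmorphD/= => l1 l2; apply/andP; split.
      by rewrite -[leLHS]hK ler_pM2l// (le_trans _ l2)// ltW.
    by rewrite -[leRHS]hK ler_pM2l// (le_trans l1).
  have -> : F n l - F n (l - 1) = h * G n l by rewrite GE hK.
  rewrite -mulrBr normrM gtr0_norm// ler_pM2l//.
  have := Gg n (h * l%:~R); rewrite dyfloor_dyadic => g1.
  have g2 := gc _ lin.
  rewrite (_ : G n l - c = (G n l - g (h * l%:~R)) + (g (h * l%:~R) - c)); last by lra.
  by rewrite (le_trans (ler_normD _ _))// lerD.
(* The grid points below [x] and [y] are each off by less than one mesh, in the same direction. *)
have hd : `|h * d%:R - (y - x)| <= h.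
  have [a1 a2] := (dyfloor_le n x, dyfloor_gt n x).
  have [b1 b2] := (dyfloor_le n y, dyfloor_gt n y).
  have dE : (d%:R : R) = ky%:~R - kx%:~R.
    by rewrite kE rmorphD/= addrAC subrr add0r.
  have -> : h * d%:R - (y - x) = h * (d%:R - (2%:R ^+ n * y - 2%:R ^+ n * x)).
    by rewrite mulrBr [h * (_ - _)]mulrBr !hK.
  rewrite normrM gtr0_norm// -[leRHS]mulr1 ler_pM2l// dE ler_norml.
  by apply/andP; split; move: a1 a2 b1 b2; rewrite -/kx -/ky; lra.
have Fx := Ff n x; have Fy := Ff n y; rewrite -/kx in Fx; rewrite -/ky in Fy.
have c1 : `|f y - f x - c * (y - x)| <= 2%:R * (B * q ^+ n) +
    `|F n ky - F n kx - h * d%:R * c| + `|c| * h.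
  have -> : f y - f x - c * (y - x) = - (F n ky - f y) + (F n kx - f x) +
    (F n ky - F n kx - h * d%:R * c) + c * (h * d%:R - (y - x)) by ring.
  rewrite (le_trans (ler_normD _ _))// lerD//; last first.
    by rewrite normrM ler_wpM2l.
  rewrite (le_trans (ler_normD _ _))// lerD//.
  rewrite (le_trans (ler_normD _ _))// normrN mulrDl !mul1r.
  by rewrite (le_trans (lerD Fy Fx)).
have hd1 : h * d%:R <= y - x + h.
  by move: hd; rewrite ler_norml => /andP[_]; lra.
rewrite kE in c1; have := le_trans c1 (lerD (lerD (lexx _) T) (lexx _)).
have c2 : h * d%:R * (B * q ^+ n + e) <= (y - x + h) * (B * q ^+ n + e).
  by rewrite ler_wpM2r// addr_ge0// mulr_ge0.
move=> c3; have {c3}c3 := le_trans c3 (lerD (lerD (lexx _) c2) (lexx _)).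
apply: (le_trans c3).
have h1 : h <= 1 by rewrite invf_le1 ?exprn_gt0// exprn_ege1// ler1n.
have Qn := qQ n; have hn := hQ n; rewrite -/h in hn.
have Bq : B * q ^+ n <= B * Q ^+ n by rewrite ler_wpM2l.
have ch : `|c| * h <= `|c| * Q ^+ n by rewrite ler_wpM2l.
have eh : e * h <= e * Q ^+ n by rewrite ler_wpM2l.
have BQ0 : 0 <= B * Q ^+ n by rewrite mulr_ge0// exprn_ge0.
have b3 : (y - x + h) * (B * q ^+ n) <= (y - x + 1) * (B * Q ^+ n).
  apply: ler_pM => //; last by rewrite lerD2l.
    by rewrite addr_ge0// ltW.
  by rewrite mulr_ge0.
rewrite [leRHS](_ : _ = 2%:R * (B * Q ^+ n) + `|c| * Q ^+ n +
  (y - x + 1) * (B * Q ^+ n) + e * Q ^+ n + e * (y - x)); last by ring.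
rewrite mulrDr; move: b3; rewrite [(y - x + h) * e]mulrC [e * (_ + _)]mulrDr.
by set X := (y - x + h) * _; set Y := (y - x + 1) * _; lra.
Qed.

Lemma is_derive_slope (f : R -> R) (x c : R) :
  (forall e, 0 < e -> exists2 d, 0 < d & forall y, `|y - x| <= d ->
    `|f y - f x - c * (y - x)| <= e * `|y - x|) -> is_derive x 1 f c.
Proof.
move=> H.
have cvgD : h^-1 *: (f (h *: 1 + x) - f x) @[h --> 0^'] --> c.
  apply/cvgrPdist_le => e e0; have [d d0 Hd] := H e e0.
  near=> h.
  have h0 : h != 0 by near: h; exact: nbhs_dnbhs_neq.
  have hd : `|h| <= d.
    near: h; apply: nbhs_dnbhs; near=> h.
    have : `|0 - h| <= d by near: h; apply: cvgr_dist_le => //; exact: cvg_id.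
    by rewrite sub0r normrN.
  have hh : h%:A = h :> R by rewrite /GRing.scale/= mulr1.
  have := Hd (h + x); rewrite addrK => /(_ hd) Hh.
  rewrite hh distrC /GRing.scale/=.
  rewrite -(ler_pM2l (x := `|h|)) ?normr_gt0// -normrM mulrBr mulVKf//.
  by rewrite [h * c]mulrC [`|h| * e]mulrC.
apply: DeriveDef; first by apply/cvg_ex; exists c.
exact: cvg_lim cvgD.
Unshelve. all: by end_near. Qed.

Lemma dyadic_limit_derive (F G : nat -> int -> R) (f g : R -> R) (B q x : R) :
  0 < q < 1 -> 0 <= B ->
  (forall n k, G n k = 2%:R ^+ n * (F n k - F n (k - 1))) ->
  (forall n x, `|F n (dyfloor n x) - f x| <= B * q ^+ n) ->
  (forall n x, `|G n (dyfloor n x) - g x| <= B * q ^+ n) ->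
  {for x, continuous g} -> is_derive x 1 f (g x).
Proof.
move=> q01 B0 GE Ff Gg gx; apply: is_derive_slope => e e0.
have /cvgrPdist_le/(_ e e0)/nbhs_ballP[d /= d0 Hd] := gx.
exists (d / 2%:R); first by rewrite divr_gt0.
move=> y yx; have dd : d / 2%:R < d by rewrite ltr_pdivrMr// mulr_natr mulr2n ltrDl.
have inner t : `|t - x| <= d / 2%:R -> `|g t - g x| <= e.
  move=> tx; rewrite distrC; apply: Hd; rewrite /ball/= distrC.
  exact: le_lt_trans tx dd.
have [xy|yx'] := leP x y.
  rewrite [`|y - x|]ger0_norm ?subr_ge0//.
  apply: (@dyadic_slope F G f g B q) => // [|t /andP[xt ty]]; first exact: ltW.
  apply: inner; move: yx; rewrite !ger0_norm ?subr_ge0//; lra.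
have -> : f y - f x - g x * (y - x) = - (f x - f y - g x * (x - y)) by ring.
rewrite normrN [`|y - x|]distrC [`|x - y|]ger0_norm ?subr_ge0 ?(ltW yx')//.
apply: (@dyadic_slope F G f g B q) => //; [exact: ltW|exact: ltW|].
move=> t /andP[yt tx].
by apply: inner; move: yx; rewrite !ler0_norm ?subr_le0 ?(ltW yx')//; lra.
Qed.

End dyadic.

(** * Convergence of the scaled iterates *)

Section limits.
Context {R : realType}.
Notation C := R[i].
Notation normc := (@ComplexField.Normc.normc R).

Lemma ltr_powR2 (x y : R) : x < y -> 2%:R `^ x < 2%:R `^ y :> R.
Proof.
move=> xy; rewrite /powR pnatr_eq0/= ltr_expR ltr_pM2r// ln_gt0//.
by rewrite ltr1n.
Qed.

Lemma vector_dyadic_limit (r : nat) (F : nat -> int -> 'cV[C]_r) (B q : R) :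
  0 < q < 1 -> 0 <= B ->
  (forall n k, entry_norm (F n.+1 (2 * k) - F n k) <= B * q ^+ n) ->
  (forall n k, entry_norm (F n.+1 (2 * k + 1) - F n k) <= B * q ^+ n) ->
  (forall n k, entry_norm (F n (k + 1) - F n k) <= B * q ^+ n) ->
  exists L : R -> 'cV[C]_r, exists2 D : R, 0 <= D &
    (forall n x, entry_norm (F n (dyfloor n x) - L x) <= D * q ^+ n) /\
    forall i, continuous (fun x => complex.Re (L x i 0)) /\
      continuous (fun x => complex.Im (L x i 0)).
Proof.
move=> q01 B0 H0 H1 HD; have [q0 q1] := andP q01.
(* [p] stands for the real or the imaginary part, so that both are treated at once. *)
have entryB (p : C -> R) n k n' k' i : (forall z w, p (z - w) = p z - p w) ->
    (forall z, `|p z| <= normc z) ->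
    `|p (F n k i 0) - p (F n' k' i 0)| <= entry_norm (F n k - F n' k').
  move=> pB pn; rewrite -pB (le_trans (pn _))//.
  by have := le_entry_norm (F n k - F n' k') i 0; rewrite !mxE.
have lim (p : C -> R) : (forall z w, p (z - w) = p z - p w) ->
    (forall z, `|p z| <= normc z) ->
    exists g : 'I_r -> R -> R, forall i, (forall n x,
     `|p (F n (dyfloor n x) i 0) - g i x| <= B / (1 - q) * q ^+ n) /\
     continuous (g i).
  move=> pB pn; suff H i : exists g : R -> R, (forall n x,
     `|p (F n (dyfloor n x) i 0) - g x| <= B / (1 - q) * q ^+ n) /\ continuous g.
    by have [g Hg] := choice H; exists g.
  have [g Hg] := @dyadic_limit R (fun n k => p (F n k i 0)) B q q01 B0
    (fun n k => le_trans (entryB p _ _ _ _ i pB pn) (H0 n k))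
    (fun n k => le_trans (entryB p _ _ _ _ i pB pn) (H1 n k)).
  exists g; split=> //.
  apply: (@dyadic_limit_continuous R (fun n k => p (F n k i 0)) g _ B q q01 Hg).
  by move=> n k; exact: le_trans (entryB p _ _ _ _ i pB pn) (HD n k).
have [gR HR] := lim (@complex.Re R) ltac:(by case=> ? ? [? ?]) normc_Re.
have [gI HI] := lim (@complex.Im R) ltac:(by case=> ? ? [? ?]) normc_Im.
have D0 : 0 <= B / (1 - q) by rewrite divr_ge0// subr_ge0 ltW.
exists (fun x => \col_i (gR i x +i* gI i x)).
exists (2%:R * (B / (1 - q))); first by rewrite mulr_ge0.
split=> [n x|i].
  apply/entry_norm_leP => [|i j].
    by apply: mulr_ge0; [exact: mulr_ge0|rewrite exprn_ge0// ltW].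
  rewrite !mxE ord1 (le_trans (normc_le_ReIm _))// -mulrA mulrDl !mul1r.
  have [hR _] := HR i; have [hI _] := HI i; move: (hR n x) (hI n x).
  by case: (F n (dyfloor n x) i 0) => z w /= h1 h2; rewrite lerD.
have [_ hR] := HR i; have [_ hI] := HI i.
by split; under eq_fun do rewrite mxE/=.
Qed.

Variables (r : nat) (a : int -> 'M[C]_r) (v : int -> 'rV[C]_r) (m : nat) (s : R).
Hypotheses (fa : fin_supp a) (fv : fin_supp v).
Hypotheses (va : matches a v m.+1) (ka : kills a v m.+1) (ms : m%:R < s).
Hypothesis Hgrow : forall (kappa : R) j (u : int -> 'cV[C]_r),
  0 < kappa -> (j <= m.+1)%N -> 2%:R ^- j < kappa -> 2%:R `^ (- s) < kappa ->
  annihilates v j u -> growth a u kappa.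
Implicit Types (u : int -> 'cV[C]_r).

Notation A := (fun n => iter n (subdivision a) (dirac_id r)).

Definition scaled j u n k : 'cV[C]_r :=
  2%:R ^+ (j * n) *: convolution (A n) u k.

(* any q < 1 exceeding 1/2 and 2^(m-s) *)
Definition rate : R := (Num.max 2%:R^-1 (2%:R `^ (m%:R - s)) + 1) / 2%:R.

Lemma rate_bounds : [/\ 0 < rate < 1, 2%:R^-1 < rate & 2%:R `^ (m%:R - s) < rate].
Proof.
set x : R := 2%:R `^ (m%:R - s).
have x1 : x < 1.
  rewrite /x /powR pnatr_eq0/= expR_lt1 pmulr_llt0 ?subr_lt0//.
  by rewrite ln_gt0// ltr1n.
have h1 : (2%:R : R)^-1 < 1 by rewrite invf_lt1// ltr1n.
have hl : 2%:R^-1 <= Num.max 2%:R^-1 x :> R by rewrite le_max lexx.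
have xl : x <= Num.max 2%:R^-1 x by rewrite le_max lexx orbT.
have ml : Num.max 2%:R^-1 x < 1 by rewrite gt_max h1.
have h0 : (0 : R) < 2%:R^-1 by [].
by rewrite /rate -/x; split; lra.
Qed.

Lemma scaled_decay j u (kappa : R) : 0 < kappa -> growth a u kappa ->
  exists2 B : R, 0 <= B & forall n k,
    entry_norm (scaled j u n k) <= B * (2%:R ^+ j * kappa) ^+ n.
Proof.
move=> k0 [B B0 H]; exists B; first exact: ltW.
move=> n k; rewrite /scaled entry_normZ normcX normc_nat exprMn -exprM.
by rewrite mulrCA ler_wpM2l ?exprn_ge0.
Qed.

(** The growth rate used is 2^-j [rate]. It exceeds 2^-(j+1) because [rate] > 1/2, and 2^-s = 2^-m
    2^(m-s) because [rate] > 2^(m-s) and j <= m. *)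
Lemma scaled_decay_next j u : (j <= m)%N -> annihilates v j.+1 u ->
  exists2 B : R, 0 <= B & forall n k,
    entry_norm (scaled j u n k) <= B * rate ^+ n.
Proof.
move=> jm Vu; have [/andP[q0 q1] hq xq] := rate_bounds.
have p2 : 0 < (2%:R : R) ^+ j by rewrite exprn_gt0.
have k0 : 0 < 2%:R ^- j * rate by rewrite mulr_gt0// invr_gt0.
have g : growth a u (2%:R ^- j * rate).
  apply: (Hgrow k0 _ _ _ Vu) => //.
    by rewrite exprSr invfM ltr_pM2l// invr_gt0.
  have e : (2%:R : R) `^ (- s) = 2%:R `^ (- m%:R) * 2%:R `^ (m%:R - s).
    by rewrite -powRD ?pnatr_eq0 ?implybT// addKr.
  rewrite e (@lt_le_trans _ _ (2%:R `^ (- m%:R) * rate))//.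
    by rewrite ltr_pM2l// powR_gt0.
  rewrite ler_wpM2r ?(ltW q0)// powRN powR_mulrn// lef_pV2 ?posrE ?exprn_gt0//.
  by rewrite ler_eXn2l// ltr1n.
have [B B0 H] := scaled_decay j k0 g; exists B => // n k.
by have := H n k; rewrite mulVKf// gt_eqF.
Qed.

(** When [u] annihilates the moments below j, the sequence on the right annihilates one more, so the
    increments decay geometrically by [scaled_decay_next]. *)
Lemma scaled_polyphase j u n (g k : int) : fin_supp u ->
  scaled j u n.+1 (2 * k + g) - scaled j u n k =
  2%:R ^+ j *: scaled j
    (fun k => polyphase a g u k - (2%:R ^- j : R)%:C *: u k) n k.
Proof.
move=> fu; rewrite /scaled convBr; last 2 first.
- exact: fin_supp_polyphase.
- exact: fin_suppZ.
rewrite convZr// -iter_subdivision_conv// scalerBr scalerBr !scalerA.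
rewrite mulnS exprD; congr (_ - _ *: _).
rewrite [RHS](_ : _ = 2%:R ^+ (j * n) * (((2%:R ^- j : R)%:C) * 2%:R ^+ j)); last by ring.
rewrite rmorphV ?unitfE ?expf_neq0 ?pnatr_eq0//.
by rewrite rmorphXn rmorph_nat mulVf ?mulr1// expf_neq0// pnatr_eq0.
Qed.

Lemma annihilates_nabla j u : annihilates v j u -> annihilates v j.+1 (nabla u).
Proof.
move=> [fu Vu]; have fvu := fin_supp_conv fv fu.
split; first exact: fin_supp_nabla.
rewrite conv_nablar//; apply: mom_eqP => [||l lj].
- exact: fin_supp_nabla.
- by exists 0%N.
rewrite pmomX_nabla// big1 ?oppr0 ?pmom0z// => i _.
by rewrite Vu ?pmom0z ?scaler0// size_polyXn (leq_trans (ltn_ord i)).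
Qed.

Lemma scaled_nabla j u n k : fin_supp u ->
  scaled j u n (k + 1) - scaled j u n k = scaled j (nabla u) n (k + 1).
Proof.
by move=> fu; rewrite /scaled conv_nablar// -scalerBr /nabla addrK.
Qed.

Lemma scaled_limit j u : (j <= m)%N -> annihilates v j u ->
  exists L : R -> 'cV[C]_r, exists2 D : R, 0 <= D &
    (forall n x, entry_norm (scaled j u n (dyfloor n x) - L x) <= D * rate ^+ n) /\
    forall i, continuous (fun x => complex.Re (L x i 0)) /\
      continuous (fun x => complex.Im (L x i 0)).
Proof.
move=> jm Vu; have [fu _] := Vu; have [q01 _ _] := rate_bounds.
have [q0 q1] := andP q01.
have jm1 : (j < m.+1)%N by [].
have [B0 B00 H0] := scaled_decay_next jm (annihilates_polyphase fa fv va ka 0 jm1 Vu).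
have [B1 B10 H1] := scaled_decay_next jm (annihilates_polyphase fa fv va ka 1 jm1 Vu).
have [B2 B20 H2] := scaled_decay_next jm (annihilates_nabla Vu).
pose B := 2%:R ^+ j * B0 + 2%:R ^+ j * B1 + B2.
have p2 : 0 <= (2%:R : R) ^+ j by rewrite exprn_ge0.
have qn n : 0 <= rate ^+ n by rewrite exprn_ge0// ltW.
have [C0 C1] : 0 <= 2%:R ^+ j * B0 /\ 0 <= 2%:R ^+ j * B1.
  by rewrite !mulr_ge0.
apply: (@vector_dyadic_limit _ _ B) => // [|n k|n k|n k].
- by rewrite /B !addr_ge0.
- rewrite -[2 * k]addr0 scaled_polyphase// entry_normZ normcX normc_nat.
  rewrite (le_trans (ler_wpM2l p2 (H0 n k)))// mulrA ler_wpM2r//.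
  by rewrite /B -addrA lerDl addr_ge0.
- rewrite scaled_polyphase// entry_normZ normcX normc_nat.
  rewrite (le_trans (ler_wpM2l p2 (H1 n k)))// mulrA ler_wpM2r//.
  by rewrite /B addrAC lerDr addr_ge0.
- rewrite scaled_nabla// (le_trans (H2 n _))// ler_wpM2r//.
  by rewrite /B lerDr addr_ge0.
Qed.

End limits.

(** * The refinable function *)

Section refinable.
Context {R : realType}.
Notation C := R[i].
Notation normc := (@ComplexField.Normc.normc R).
Variables (r : nat) (a : int -> 'M[C]_r) (v : int -> 'rV[C]_r) (m : nat) (s : R).
Hypotheses (fa : fin_supp a) (fv : fin_supp v).
Hypotheses (va : matches a v m.+1) (ka : kills a v m.+1) (ms : m%:R < s).
Hypothesis Hgrow : forall (kappa : R) j (u : int -> 'cV[C]_r),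
  0 < kappa -> (j <= m.+1)%N -> 2%:R ^- j < kappa -> 2%:R `^ (- s) < kappa ->
  annihilates v j u -> growth a u kappa.
Implicit Types (u : int -> 'cV[C]_r).

Notation A := (fun n => iter n (subdivision a) (dirac_id r)).
Notation scaled := (scaled a).
Notation rate := (rate m s).

Variable d : int -> 'cV[C]_r.
Hypotheses (fd : fin_supp d) (d1 : pmom 1 (convolution v d) = 1%:M).
Notation U := (fun j => iter j nabla d).

Lemma annihilates_U j : annihilates v j (U j).
Proof.
have fU := fin_supp_iter_nabla j fd.
split=> //; rewrite conv_iter_nablar//.
have [H _] := pmomX_iter_nabla j (fin_supp_conv fv fd).
apply: mom_eqP => [||l lj].
- by rewrite -conv_iter_nablar//; exact: fin_supp_conv.
- by exists 0%N.
- by rewrite H// pmom0z.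
Qed.

Lemma pmomX_U j : pmom 'X^j (convolution v (U j)) = ((-1) ^+ j * j`!%:R)%:M.
Proof.
rewrite conv_iter_nablar//.
have [_ ->] := pmomX_iter_nabla j (fin_supp_conv fv fd).
by rewrite d1 scalemx1.
Qed.

(* L j is the limit of 2^(jn) A_n * nabla^j d, and phi = L 0; as
   A_n * nabla^j d = nabla^j (A_n * d), L j is the j-th derivative of phi. *)
Definition limit_family (L : nat -> R -> 'cV[C]_r) (D : R) :=
  [/\ 0 <= D,
      forall j n x, (j <= m)%N ->
        entry_norm (scaled j (U j) n (dyfloor n x) - L j x) <= D * rate ^+ n &
      forall j i, (j <= m)%N -> continuous (fun x => complex.Re (L j x i 0)) /\
      continuous (fun x => complex.Im (L j x i 0))].

Lemma limit_family_exists : exists L D, limit_family L D.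
Proof.
have [/andP[q0 q1] _ _] := rate_bounds ms.
have H j : exists LD : (R -> 'cV[C]_r) * R, 0 <= LD.2 /\ ((j <= m)%N ->
    (forall n x, entry_norm (scaled j (U j) n (dyfloor n x) - LD.1 x) <=
       LD.2 * rate ^+ n) /\
    forall i, continuous (fun x => complex.Re (LD.1 x i 0)) /\
      continuous (fun x => complex.Im (LD.1 x i 0))).
  (* Beyond m the zero function stands in, as the choice ranges over all orders. *)
  have [jm|jm] := leqP j m; last by exists (fun=> 0, 0).
  have [L [D D0 HL]] :=
    scaled_limit fa fv va ka ms Hgrow jm (annihilates_U j).
  by exists (L, D).
have [LD HLD] := choice H.
exists (fun j => (LD j).1), (\sum_(j < m.+1) (LD j).2); split.
- by apply: sumr_ge0 => j _; case: (HLD j).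
- move=> j n x jm; have [D0 /(_ jm)[Hj _]] := HLD j.
  rewrite (le_trans (Hj n x))// ler_wpM2r ?exprn_ge0 ?(ltW q0)//.
  rewrite (bigD1 (Ordinal (jm : (j < m.+1)%N)))//= lerDl.
  by apply: sumr_ge0 => k _; case: (HLD k).
- by move=> j i jm; have [D0 /(_ jm)[_]] := HLD j; apply.
Qed.

Variables (L : nat -> R -> 'cV[C]_r) (D : R).
Hypothesis LD : limit_family L D.

(** As differences commute with convolution, the family of order j + 1 is exactly the difference
    quotient with step 2^-n of the family of order j, the form that [dyadic_limit_derive]
    requires. *)
Lemma scaled_U_succ j n k : scaled j.+1 (U j.+1) n k =
  2%:R ^+ n *: (scaled j (U j) n k - scaled j (U j) n (k - 1)).
Proof.
have fU := fin_supp_iter_nabla j fd.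
rewrite /scaled iterS conv_nablar// /nabla -scalerBr scalerA.
by rewrite -exprD mulSn.
Qed.

Lemma limit_derive j i x : (j < m)%N ->
  is_cderive (fun t => L j t i 0) x (L j.+1 x i 0).
Proof.
move=> jm; have [D0 HL HC] := LD; have [q01 _ _] := rate_bounds ms.
have [cR cI] := HC j.+1 i jm.
have key (p : C -> R) : (forall z w, p (z - w) = p z - p w) ->
    (forall n z, p (2%:R ^+ n * z) = 2%:R ^+ n * p z) ->
    (forall z, `|p z| <= normc z) ->
    continuous (fun x => p (L j.+1 x i 0)) ->
    is_derive x 1 (fun t => p (L j t i 0)) (p (L j.+1 x i 0)).
  move=> pB pZ pn pC.
  have bnd l n y : (l <= m)%N ->
      `|p (scaled l (U l) n (dyfloor n y) i 0) - p (L l y i 0)| <= D * rate ^+ n.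
    move=> lm; rewrite -pB (le_trans (pn _))// (le_trans _ (HL l n y lm))//.
    by have := le_entry_norm (scaled l (U l) n (dyfloor n y) - L l y) i 0;
      rewrite !mxE.
  apply: (@dyadic_limit_derive R (fun n k => p (scaled j (U j) n k i 0))
    (fun n k => p (scaled j.+1 (U j.+1) n k i 0))
    (fun t => p (L j t i 0)) (fun t => p (L j.+1 t i 0)) D rate) => //.
  - by move=> n k; rewrite scaled_U_succ !mxE pZ pB.
  - by move=> n y; apply: bnd; exact: ltnW.
  - by move=> n y; exact: bnd.
  - exact: pC.
have two n z : (2%:R ^+ n * z : C) = (2%:R ^+ n : R)%:C * z.
  by rewrite rmorphXn rmorph_nat.
split; apply: key => //.
- by case=> ? ? [? ?].
- by move=> n z; rewrite two ReM/= mul0r subr0.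
- exact: normc_Re.
- by case=> ? ? [? ?].
- by move=> n z; rewrite two ImM/= mul0r addr0.
- exact: normc_Im.
Qed.

Lemma limit_class_C i : class_C m (fun x => L 0%N x i 0).
Proof.
have [_ _ HC] := LD.
split.
  apply: (@real_class_C_chain _ _ (fun j t => complex.Re (L j t i 0))) => j.
    by move=> x jm; have [] := limit_derive i x jm.
  by move=> jm; have [] := HC j i jm.
apply: (@real_class_C_chain _ _ (fun j t => complex.Im (L j t i 0))) => j.
  by move=> x jm; have [] := limit_derive i x jm.
by move=> jm; have [] := HC j i jm.
Qed.

Lemma limit_mxderiven j x : (j <= m)%N -> mxderiven j (L 0%N) x = L j x.
Proof.
move=> jm; apply/matrixP => i k; rewrite mxE ord1.
by rewrite (cderiven_chain (F := fun n t => L n t i 0) (m := m))// => n y nm;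
  exact: limit_derive.
Qed.

Lemma limit_small (w : 'cV[C]_r) (B : R) (n0 : nat) :
  (forall n, (n0 <= n)%N -> entry_norm w <= B * rate ^+ n) -> w = 0.
Proof.
move=> H; have [q01 _ _] := rate_bounds ms; have [q0 q1] := andP q01.
apply: entry_norm_eq0; apply/eqP; rewrite eq_le entry_norm_ge0 andbT.
have B0 : 0 <= B.
  have := le_trans (entry_norm_ge0 w) (H n0 (leqnn _)).
  by rewrite pmulr_lge0// exprn_gt0.
apply: (@geometric_le _ (B * rate ^+ n0) rate) => // n; rewrite add0r.
rewrite (le_trans (H (n0 + n)%N (leq_addr _ _)))// exprD mulrA.
by rewrite lexx.
Qed.

(** The iterate is supported in radius (2^n - 1) N + M, and the floor of 2^n x leaves that interval
    once 2^n (|x| - N) > M + 1. From then on the approximants of [L j x] vanish. *)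
Lemma limit_support j N x : (j <= m)%N -> supported_in N a -> N%:R < `|x| ->
  L j x = 0.
Proof.
move=> jm aN Nx; have [D0 HL _] := LD.
have [M dM] := fin_supp_iter_nabla j fd.
have xN : 0 < `|x| - N%:R by rewrite subr_gt0.
have [n0 Hn0] := @geometric_small R (M%:R + 1) 2%:R^-1 (`|x| - N%:R)
  ltac:(by rewrite invr_gt0 ltr0n/= invf_lt1 ?ltr1n) xN.
apply: (@limit_small _ D n0) => n n0n.
have := HL j n x jm; rewrite /scaled.
have -> : convolution (A n) (U j) (dyfloor n x) = 0; last first.
  by rewrite scaler0 sub0r entry_normN.
apply: (convolution_supp (iter_subdivision_supp (n := n) aN) dM).
rewrite -(ltr_nat R) natr_absz intr_norm.
have p2 : 0 < (2%:R : R) ^+ n by rewrite exprn_gt0.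
have b1 := dyfloor_le n x; have b2 := dyfloor_gt n x.
have e1 : M%:R + 1 < 2%:R ^+ n * (`|x| - N%:R).
  have : (M%:R + 1) * 2%:R^-1 ^+ n < `|x| - N%:R.
    apply: le_lt_trans Hn0; rewrite ler_wpM2l//.
    by rewrite ler_wiXn2l// ?invr_ge0// invf_le1 ?ler1n.
  by rewrite exprVn ltr_pdivrMr// [ltRHS]mulrC.
rewrite natrD natrM -subn1 natrB ?expn_gt0// natrX.
have NN : (0 : R) <= N%:R by [].
have [x0|x0] := leP 0 x.
  rewrite (ger0_norm x0) in e1.
  rewrite (lt_le_trans _ (ler_norm _))//.
  by move: e1 b2; rewrite mulrBr mulrBl mul1r; lra.
rewrite (ltr0_norm x0) in e1.
rewrite -normrN (lt_le_trans _ (ler_norm _))//.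
by move: e1 b1; rewrite mulrBr mulrBl mul1r mulrN; lra.
Qed.

End refinable.

Section refinable_properties.
Context {R : realType}.
Notation C := R[i].
Notation normc := (@ComplexField.Normc.normc R).
Variables (r : nat) (a : int -> 'M[C]_r) (v : int -> 'rV[C]_r) (m : nat) (s : R).
Hypotheses (fa : fin_supp a) (fv : fin_supp v).
Hypotheses (va : matches a v m.+1) (ka : kills a v m.+1) (ms : m%:R < s).
Hypothesis Hgrow : forall (kappa : R) j (u : int -> 'cV[C]_r),
  0 < kappa -> (j <= m.+1)%N -> 2%:R ^- j < kappa -> 2%:R `^ (- s) < kappa ->
  annihilates v j u -> growth a u kappa.
Implicit Types (u : int -> 'cV[C]_r).

Notation scaled := (scaled a).
Notation rate := (rate m s).

Variable d : int -> 'cV[C]_r.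
Hypotheses (fd : fin_supp d) (d1 : pmom 1 (convolution v d) = 1%:M).
Notation U := (fun j => iter j nabla d).

Variables (L : nat -> R -> 'cV[C]_r) (D : R).
Hypothesis LD : limit_family a m s d L D.

(** For the even component the mixing coefficients (-g)^(l-i) vanish unless i = l, so each moment is
    scaled separately. The t orders from j on are therefore gained at once, instead of a single one
    as in [annihilates_polyphase]. *)
Lemma annihilates_polyphase0 j t u : (0 < t)%N -> (j + t <= m.+1)%N ->
  fin_supp u ->
  (forall l, (l < j + t)%N -> l != j -> pmom 'X^l (convolution v u) = 0) ->
  annihilates v (j + t)
    (fun k => polyphase a 0 u k - (2%:R ^- j : R)%:C *: u k).
Proof.
move=> t0 jt fu Hu; have fp := fin_supp_polyphase 0 fa fu.
have fcu : fin_supp (fun k => (2%:R ^- j : R)%:C *: u k) by exact: fin_suppZ.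
have fvu := fin_supp_conv fv fu; have fvp := fin_supp_conv fv fp.
split; first exact: fin_suppB.
rewrite (_ : convolution v _ = fun k => convolution v (polyphase a 0 u) k -
  (2%:R ^- j : R)%:C *: convolution v u k); last first.
  by apply/funext => k; rewrite convBr// convZr.
apply: mom_eqP => [||l lj]; [|by exists 0%N|].
  by apply: fin_suppB => //; exact: fin_suppZ.
rewrite pmom0z pmomBr//; last exact: fin_suppZ.
rewrite pmomZr//; apply/eqP; rewrite subr_eq0; apply/eqP.
have n2 n : (2%:R : C) ^+ n != 0 by rewrite expf_neq0// pnatr_eq0.
apply: (scalerI (n2 l)).
rewrite (pmomX_polyphase fa fv va ka)//; last exact: leq_trans jt.
rewrite big_ord_recr/= binn subnn expr0 mul1r scale1r big1 => [|i _]; last first.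
  by rewrite oppr0 expr0n subn_eq0 leqNgt ltn_ord/= mulr0 scale0r.
rewrite add0r; have [->|lnj] := eqVneq l j; last by rewrite Hu// !scaler0.
by rewrite scalerA rmorphV ?unitfE ?expf_neq0 ?pnatr_eq0// rmorphXn rmorph_nat
  divff ?scale1r.
Qed.

Lemma scaledB j u w n k : fin_supp u -> fin_supp w ->
  scaled j (fun k => u k - w k) n k = scaled j u n k - scaled j w n k.
Proof. by move=> fu fw; rewrite /scaled convBr// scalerBr. Qed.

Lemma scaledZ j u (c : C) n k : fin_supp u ->
  scaled j (fun k => c *: u k) n k = c *: scaled j u n k.
Proof. by move=> fu; rewrite /scaled convZr// !scalerA mulrC. Qed.

Lemma dyfloor_refine n t (k : int) :
  dyfloor (n + t) (2%:R ^- n * k%:~R : R) = (2 ^ t)%N%:Z * k.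
Proof.
have -> : 2%:R ^- n * k%:~R = 2%:R ^- (n + t) * ((2 ^ t)%N%:Z * k)%:~R :> R.
  by rewrite rmorphM/= -pmulrn natrX exprD invfM -!mulrA mulKf//.
exact: dyfloor_dyadic.
Qed.

(* At a fixed dyadic point the increment from level n to n + 1 is
   2^(jn) A_n * (2^j P u - u), P u the even polyphase component, and the sequence
   2^j P u - u annihilates j + t moments, so that the increments sum up
   geometrically. The limit is identified by comparing u with beta nabla^j d. *)
Lemma limit_rate j t u (e : R) : (0 < t)%N -> (j + t <= m.+1)%N ->
  fin_supp u ->
  (forall l, (l < j + t)%N -> l != j -> pmom 'X^l (convolution v u) = 0) ->
  0 < e -> e < t%:R -> e < s - j%:R ->
  let beta := pmom 'X^j (convolution v u) 0 0 / ((-1) ^+ j * j`!%:R) in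
  exists2 B : R, 0 <= B & forall n k,
    entry_norm (scaled j u n k - beta *: L j (2%:R ^- n * k%:~R)) <=
    B * (2%:R `^ (- e)) ^+ n.
Proof.
move=> t0 jt fu Hu e0 et es beta.
have jm : (j <= m)%N by rewrite -ltnS (leq_trans _ jt)// -[X in (X < _)%N]addn0 ltn_add2l.
have [D0 HL _] := LD; have [q01 _ _] := rate_bounds ms.
have [q0 q1] := andP q01.
set p := 2%:R `^ (- e).
have p0 : 0 < p by rewrite powR_gt0.
have p1 : p < 1.
  rewrite /p /powR pnatr_eq0/= expR_lt1 pmulr_llt0 ?oppr_lt0//.
  by rewrite ln_gt0// ltr1n.
have Vd := annihilates_polyphase0 t0 jt fu Hu.
set w := fun k => _ in Vd.
(* The assumptions e < t and e < s - j place this rate above 2^-(j+t) and 2^-s, and 2^j kappa is the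
   announced ratio 2^-e. *)
pose kappa : R := 2%:R `^ (- (j%:R + e)).
have k0 : 0 < kappa by rewrite powR_gt0.
have g : growth a w kappa.
  apply: (Hgrow k0 jt _ _ Vd); last by apply: ltr_powR2; lra.
  by rewrite -powR_mulrn// -powRN; apply: ltr_powR2; rewrite natrD; lra.
have kp : 2%:R ^+ j * kappa = p.
  rewrite -powR_mulrn// /kappa -powRD ?pnatr_eq0 ?implybT//.
  by congr (_ `^ _); lra.
have [B1 B10 H1] := scaled_decay j k0 g; rewrite kp in H1.
pose B := 2%:R ^+ j * B1 / (1 - p).
have B0 : 0 <= B.
  by rewrite /B divr_ge0 ?mulr_ge0 ?exprn_ge0// subr_ge0 ltW.
(* The geometric sum is kept in closed form so that the induction on [i] closes; dropping p^(n+i)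
   afterwards gives a bound uniform in [i]. *)
have step n i k : entry_norm (scaled j u (n + i) ((2 ^ i)%N%:Z * k) -
    scaled j u n k) <= B * (p ^+ n - p ^+ (n + i)).
  elim: i => [|i IH]; first by rewrite addn0 mul1r !subrr mulr0 entry_norm0.
  have -> : (2 ^ i.+1)%N%:Z * k = 2 * ((2 ^ i)%N%:Z * k) + 0.
    by rewrite addr0 expnS PoszM mulrA.
  rewrite addnS; set k' := (2 ^ i)%N%:Z * k in IH *.
  rewrite -[X in entry_norm X](subrKA (scaled j u (n + i) k')).
  rewrite (le_trans (entry_normD _ _))//.
  have -> : B * (p ^+ n - p ^+ (n + i).+1) = 2%:R ^+ j * (B1 * p ^+ (n + i)) +
      B * (p ^+ n - p ^+ (n + i)).
    by rewrite /B exprS; field; rewrite subr_eq0 gt_eqF.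
  rewrite lerD// scaled_polyphase// entry_normZ normcX normc_nat.
  by rewrite ler_wpM2l ?exprn_ge0// H1.
have fU := fin_supp_iter_nabla j fd.
(* [beta] is chosen to match the j-th moments. The difference then annihilates one more moment and
   its scaled iterates tend to 0, which identifies the limit as [beta] times [L j]. *)
have VbU : annihilates v j.+1 (fun k => u k - beta *: U j k).
  have fbU : fin_supp (fun k => beta *: U j k) by exact: fin_suppZ.
  split; first exact: fin_suppB.
  rewrite (_ : convolution v _ = fun k => convolution v u k -
      beta *: convolution v (U j) k); last first.
    by apply/funext => k; rewrite convBr// convZr.
  have fvu := fin_supp_conv fv fu; have fvU := fin_supp_conv fv fU.
  apply: mom_eqP => [||l lj]; [|by exists 0%N|].
    by apply: fin_suppB => //; exact: fin_suppZ.
  rewrite pmom0z pmomBr//; last exact: fin_suppZ.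
  rewrite pmomZr//; move: lj; rewrite ltnS leq_eqVlt => /predU1P[->|lj].
    rewrite (pmomX_U fv fd d1) scale_scalar_mx /beta divfK.
      by rewrite [X in X - _]mx11_scalar subrr.
    by rewrite mulf_neq0 ?signr_eq0// pnatr_eq0 -lt0n fact_gt0.
  have [_ VU] : annihilates v j (U j) by exact: annihilates_U.
  rewrite VU ?size_polyXn// pmom0z scaler0 subr0 Hu//.
    by rewrite (leq_trans lj) ?leq_addr.
  by rewrite ltn_eqF.
have [B2 B20 H2] := scaled_decay_next ms Hgrow jm VbU.
exists B => // n k; set x := _ * k%:~R.
(* The comparison is made at level n + i: the two identification errors are O([rate]^i) and
   disappear as [i] grows, leaving only the telescoped B p^n. *)
apply: (@geometric_le _ (B2 + normc beta * D) rate) => // i.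
pose K := (2 ^ i)%N%:Z * k.
have xK : dyfloor (n + i) x = K by exact: dyfloor_refine.
have -> : scaled j u n k - beta *: L j x =
    - (scaled j u (n + i) K - scaled j u n k) +
    (scaled j u (n + i) K - beta *: scaled j (U j) (n + i) K) +
    beta *: (scaled j (U j) (n + i) K - L j x).
  by rewrite scalerBr opprB !addrA !subrK.
have qi : rate ^+ (n + i) <= rate ^+ i.
  by rewrite ler_wiXn2l ?leq_addl// ltW.
rewrite (le_trans (entry_normD _ _))// mulrDl [leRHS]addrA lerD//.
  rewrite (le_trans (entry_normD _ _))// lerD//.
    rewrite entry_normN (le_trans (step n i k))//.
    by rewrite ler_wpM2l// gerBl exprn_ge0// ltW.
  have := H2 (n + i)%N K; rewrite scaledB//; last exact: fin_suppZ.
  rewrite scaledZ// => h; rewrite (le_trans h)//.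
  by rewrite ler_wpM2l.
rewrite entry_normZ -mulrA ler_wpM2l ?normc_ge0//.
have := HL j (n + i)%N x jm; rewrite xK => h; rewrite (le_trans h)//.
by rewrite ler_wpM2l.
Qed.

End refinable_properties.

(** * Integer translates and the refinement equation *)

Section refinable_equations.
Context {R : realType}.
Notation C := R[i].
Variables (r : nat) (a : int -> 'M[C]_r) (v : int -> 'rV[C]_r) (m : nat) (s : R).
Hypotheses (fa : fin_supp a) (fv : fin_supp v).
Hypotheses (va : matches a v m.+1) (ka : kills a v m.+1) (ms : m%:R < s).
Hypothesis Hgrow : forall (kappa : R) j (u : int -> 'cV[C]_r),
  0 < kappa -> (j <= m.+1)%N -> 2%:R ^- j < kappa -> 2%:R `^ (- s) < kappa ->
  annihilates v j u -> growth a u kappa.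
Implicit Types (u : int -> 'cV[C]_r).

Notation A := (fun n => iter n (subdivision a) (dirac_id r)).
Notation scaled := (scaled a).
Notation rate := (rate m s).

Variable d : int -> 'cV[C]_r.
Hypotheses (fd : fin_supp d) (d1 : pmom 1 (convolution v d) = 1%:M).

Variables (L : nat -> R -> 'cV[C]_r) (D : R).
Hypothesis LD : limit_family a m s d L D.

Lemma window_of (x : R) : exists M : nat, `|x| < M%:R.
Proof. by exists (Num.bound `|x|); exact: archi_boundP. Qed.

Lemma translate_vanish j (N M : nat) (x : R) (l : int) : (j <= m)%N ->
  supported_in N a -> `|x| <= M%:R -> (N + M < `|l|)%N -> L j (x - l%:~R) = 0.
Proof.
move=> jm aN xM lNM; apply: (limit_support ms fd LD jm aN).
have : (N + M)%:R < `|l%:~R| :> R by rewrite -intr_norm -natr_absz ltr_nat.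
rewrite natrD => h; have := ler_distD x l%:~R 0; rewrite !subr0 distrC; lra.
Qed.

Lemma translates_derive j (w0 : int -> 'rV[C]_r) (x : R) : (j < m)%N ->
  is_cderive (fun t => (\sum_(k \in [set: int]) (w0 k *m L j (t - k%:~R))) 0 0) x
    ((\sum_(k \in [set: int]) (w0 k *m L j.+1 (x - k%:~R))) 0 0).
Proof.
move=> jm; case: (fa) => N aN.
have [M xM] := window_of x.
(* One more than [x] itself needs, so that the same finite window serves every point within distance
   1 of [x]. *)
pose W := (N + M.+1)%N.
have win l t : (l <= m)%N -> `|t| <= M.+1%:R ->
    \sum_(k \in [set: int]) (w0 k *m L l (t - k%:~R)) =
    \sum_(k <- zwin W) (w0 k *m L l (t - k%:~R)).
  move=> lm tM; apply: zsum_win => k kW.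
  by rewrite (translate_vanish lm aN tM kW) mulmx0.
have fin : is_cderive
    (fun t => \sum_(k <- zwin W) \sum_i w0 k 0 i * L j (t - k%:~R) i 0) x
    (\sum_(k <- zwin W) \sum_i w0 k 0 i * L j.+1 (x - k%:~R) i 0).
  apply: is_cderive_sum => k; apply: is_cderive_sum => i; apply: is_cderiveZ.
  have h := limit_derive ms fd LD i (x - k%:~R) jm.
  have := @is_cderive_affine _ (fun t => L j t i 0) 1 (- k%:~R) x _.
  rewrite mul1r => /(_ _ h); rewrite mul1r.
  by under eq_fun do rewrite mul1r.
rewrite win//; last by rewrite (le_trans (ltW xM))// ler_nat.
rewrite summxE; under eq_bigr do rewrite mxE.
have near : \forall t \near x,
    \sum_(k <- zwin W) \sum_i w0 k 0 i * L j (t - k%:~R) i 0 =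
    (\sum_(k \in [set: int]) (w0 k *m L j (t - k%:~R))) 0 0.
  near=> t; rewrite win ?(ltnW jm)//.
    by rewrite summxE; apply: eq_bigr => k _; rewrite mxE.
  have : `|x - t| < 1 by near: t; apply: cvgr_dist_lt => //; exact: cvg_id.
  have := ler_normB x (x - t); rewrite subKr => h1 h2.
  rewrite (le_trans h1)// -natr1 lerD// ltW//.
have [fR fI] := fin; split; [apply: near_eq_is_derive fR|apply: near_eq_is_derive fI];
  by near=> t; congr complex.Re + congr complex.Im; near: t.
Unshelve. all: by end_near. Qed.

Lemma translates_mxderiven j (w0 : int -> 'rV[C]_r) (x : R) : (j <= m)%N ->
  mxderiven j (fun t => \sum_(k \in [set: int]) (w0 k *m L 0%N (t - k%:~R))) x =
  \sum_(k \in [set: int]) (w0 k *m L j (x - k%:~R)).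
Proof.
move=> jm; apply/matrixP => y z; rewrite !ord1 mxE.
rewrite (cderiven_chain (m := m) (F := fun n t =>
  (\sum_(k \in [set: int]) (w0 k *m L n (t - k%:~R))) 0 0))// => n t nm.
exact: translates_derive.
Qed.

(** By superposition, S_a^n w0 * u is the sum over l of [w0 l] times the Dirac iterate shifted by
    2^n l. For |l| > K + N this iterate and the translated limit both vanish at the points
    considered, so the Dirac error [X n] is multiplied by the remaining weights. The factor r comes
    from the matrix product. *)
Lemma limit_rate_general j (N : nat) u (beta : C) (X : nat -> R)
    (w0 : int -> 'rV[C]_r) (K : R) (n : nat) (k : int) : (j <= m)%N ->
  supported_in N a -> supported_in N u -> 0 < K -> 0 <= X n ->
  (forall k : int, entry_norm (scaled j u n k - beta *: L j (2%:R ^- n * k%:~R)) <= X n) ->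
  `|k%:~R| <= 2%:R ^+ n * K ->
  entry_norm ((2%:R ^+ (j * n)) *: convolution (iter n (subdivision a) w0) u k
    - beta *: mxderiven j (fun x => \sum_(k \in [set: int]) (w0 k *m L 0%N (x - k%:~R)))
        (2%:R ^- n * k%:~R)) <=
  r%:R * X n * \sum_(l \in [set l : int | `|l%:~R| <= K + N%:R]) entry_norm (w0 l).
Proof.
move=> jm aN uN K0 X0 HX kK; have fu : fin_supp u by exists N.
rewrite translates_mxderiven// (iter_subdivision_convE fa)//.
set x := _ * k%:~R.
have p2 : 0 < (2%:R : R) ^+ n by rewrite exprn_gt0.
have xK : `|x| <= K.
  by rewrite /x normrM gtr0_norm ?invr_gt0// ler_pdivrMl.
have [M KM] := window_of (K + N%:R).
have KN0 : 0 <= K + N%:R by rewrite addr_ge0// ltW.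
rewrite ger0_norm// in KM.
have suppA : supported_in (2 ^ n * N) (convolution (A n) u).
  apply: supported_inW; last first.
    exact: (convolution_supp (iter_subdivision_supp (n := n) aN) uN).
  by rewrite -[X in (_ + X <= _)%N]mul1n -mulnDl addn1 prednK ?expn_gt0.
have far (l : int) : K + N%:R < `|l%:~R| ->
    convolution (A n) u (k - (2 ^ n)%N%:Z * l) = 0 /\ L j (x - l%:~R) = 0.
  move=> lK; have xl : N%:R < `|x - l%:~R|.
    have := ler_distD x l%:~R 0; rewrite !subr0 distrC; lra.
  split; last exact: (limit_support ms fd LD jm aN).
  apply: suppA; rewrite -(ltr_nat R) natr_absz intr_norm natrM natrX.
  have -> : (k - (2 ^ n)%N%:Z * l)%:~R = 2%:R ^+ n * (x - l%:~R) :> R.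
    by rewrite intrB intrM -pmulrn natrX mulrBr /x mulVKf// gt_eqF.
  by rewrite normrM gtr0_norm// ltr_pM2l.
have farM (l : int) : (M < `|l|)%N -> K + N%:R < `|l%:~R|.
  by move=> lM; rewrite (lt_trans KM)// -intr_norm -natr_absz ltr_nat.
rewrite (@zsum_win _ M); last by move=> l /farM/far[-> _]; rewrite mulmx0.
rewrite (@zsum_win _ M); last by move=> l /farM/far[_ ->]; rewrite mulmx0.
rewrite !scaler_sumr -sumrB.
have -> : \sum_(l \in [set l : int | `|l%:~R| <= K + N%:R]) entry_norm (w0 l) =
    \sum_(l <- zwin M | `|l%:~R| <= K + N%:R) entry_norm (w0 l).
  symmetry; apply: bigfs; first exact: zwin_uniq.
  by move=> l lK; rewrite mem_zwin -ltnNge => /farM; rewrite ltNge lK.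
rewrite (le_trans (entry_norm_sum _ _ _))// mulr_sumr [leRHS]big_mkcond/=.
apply: ler_sum => l _; case: ifPn => lK; last first.
  rewrite -ltNge in lK; have [-> ->] := far l lK.
  by rewrite !mulmx0 !scaler0 subrr entry_norm0.
have -> : 2%:R ^+ (j * n) *: (w0 l *m convolution (A n) u (k - (2 ^ n)%N%:Z * l)) -
    beta *: (w0 l *m L j (x - l%:~R)) =
    w0 l *m (scaled j u n (k - (2 ^ n)%N%:Z * l) - beta *: L j (x - l%:~R)).
  by rewrite mulmxBr -!scalemxAr.
rewrite (le_trans (entry_normM _ _))// -mulrA ler_wpM2l// mulrC.
rewrite ler_wpM2r ?entry_norm_ge0//.
have -> : x - l%:~R = 2%:R ^- n * (k - (2 ^ n)%N%:Z * l)%:~R.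
  by rewrite intrB intrM -pmulrn natrX mulrBr mulKf//.
exact: HX.
Qed.

Lemma limit_near (n : nat) (x : R) :
  entry_norm (convolution (A n) d (dyfloor n x) - L 0%N x) <= D * rate ^+ n.
Proof.
have [_ H _] := LD; have := H 0%N n x (leq0n _).
by rewrite /scaled expr0 scale1r.
Qed.

Lemma dyfloor_scale n (x : R) (l : int) :
  dyfloor n (2%:R * x - l%:~R) = dyfloor n.+1 x - (2 ^ n)%N%:Z * l.
Proof.
apply: dyfloor_def; have h1 := dyfloor_le n.+1 x; have h2 := dyfloor_gt n.+1 x.
rewrite intrB intrM -pmulrn natrX mulrBr mulrA -exprSr.
by apply/andP; split; move: h1 h2; lra.
Qed.

Lemma dyfloor_sub n (x : R) (l : int) :
  dyfloor n (x - l%:~R) = dyfloor n x - (2 ^ n)%N%:Z * l.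
Proof.
apply: dyfloor_def; have h1 := dyfloor_le n x; have h2 := dyfloor_gt n x.
rewrite intrB intrM -pmulrn natrX mulrBr.
by apply/andP; split; move: h1 h2; lra.
Qed.

(** The first subdivision step, not the last, is peeled off: S_a of the Dirac sequence is 2a, and
    superposition gives the equation at level n before passing to the limit. *)
Lemma refinement_equation (x : R) :
  L 0%N x = 2%:R *: \sum_(l \in [set: int]) (a l *m L 0%N (2%:R * x - l%:~R)).
Proof.
have [N aN] := fa; have [D0 _ _] := LD.
have [/andP[q0 q1] _ _] := rate_bounds ms.
have Sd l : subdivision a (dirac_id r) l = 2%:R *: a l.
  rewrite /subdivision (zsum1 (i := 0)) => [|k k0].
    by rewrite /dirac_id eqxx mul1mx mulr0 subr0.
  by rewrite /dirac_id ifF ?mul0mx//; apply/negbTE.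
have E n k : convolution (A n.+1) d k =
    2%:R *: \sum_(l <- zwin N) (a l *m convolution (A n) d (k - (2 ^ n)%N%:Z * l)).
  rewrite iterSr (iter_subdivision_convE fa)//.
  rewrite (@zsum_win _ N) => [|l lN]; last by rewrite Sd aN// scaler0 mul0mx.
  by rewrite scaler_sumr; apply: eq_bigr => l _; rewrite Sd scalemxAl.
rewrite (@zsum_win _ N) => [|l lN]; last by rewrite aN// mul0mx.
apply/eqP; rewrite -subr_eq0; apply/eqP.
pose Ba := \sum_(l <- zwin N) r%:R * entry_norm (a l).
have Ba0 : 0 <= Ba.
  by apply: sumr_ge0 => l _; rewrite mulr_ge0// entry_norm_ge0.
apply: (limit_small ms (B := D + 2%:R * (Ba * D)) (n0 := 0%N)) => n _.
rewrite -(subrKA (convolution (A n.+1) d (dyfloor n.+1 x))).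
apply: (le_trans (entry_normD _ _)); rewrite [leRHS]mulrDl; apply: lerD.
  rewrite -entry_normN opprB (le_trans (limit_near _ _))//.
  by rewrite ler_wpM2l// exprS ler_piMl ?exprn_ge0// ltW.
rewrite E -scalerBr -sumrB entry_normZ normc_nat -!mulrA ler_wpM2l//.
rewrite (le_trans (entry_norm_sum _ _ _))// /Ba mulr_suml.
apply: ler_sum => l _; rewrite -mulmxBr (le_trans (entry_normM _ _))//.
rewrite -!mulrA ler_wpM2l// ler_wpM2l ?entry_norm_ge0//.
by rewrite -dyfloor_scale limit_near.
Qed.

(** The constant sequence v^(0) is fixed by S_a, so the sum of the translates of v^(0) (A_n * d) by
    multiples of 2^n equals v^(0) d^(0) = 1 at every level; the limit inherits it. *)
Lemma partition_of_unity (x : R) :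
  \sum_(l \in [set: int]) (pmom 1 v *m L 0%N (x - l%:~R)) = 1%:M.
Proof.
have [N aN] := fa; have [D0 _ _] := LD.
have [/andP[q0 q1] _ _] := rate_bounds ms.
have fdir : fin_supp (dirac_id r : int -> 'M[C]_r) by exact: fin_supp_delta.
(* [pmom_polyphase] for the constant polynomial and the Dirac sequence: on each residue class modulo
   2 the mask sums, against v^(0), to half of v^(0). *)
have cst n : iter n (subdivision a) (fun=> pmom 1 v) = fun=> pmom 1 v.
  elim: n => //= n ->; apply/funext => g; rewrite /subdivision.
  have conv_dir k : convolution a (dirac_id r) k = a k.
    by rewrite (conv_delta a) mulmx1.
  have := @pmom_polyphase _ _ _ _ fa fv _ (dirac_id r) g _ 1 fdir va ka.
  rewrite size_poly1 => /(_ isT).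
  have aff b c : affpoly b c 1 = 1 :> {poly C} by rewrite /affpoly comp_polyC.
  have fp := fin_supp_polyphase g fa fdir.
  rewrite !aff !pmom1_conv// pmom_delta hornerC scale1r mulmx1 => E.
  have E2 : pmom 1 (polyphase a g (dirac_id r)) =
      \sum_(k \in [set: int]) 2%:R *: a (2 * k + g).
    by apply: eq_fsbigr => k _; rewrite hornerC scale1r /polyphase conv_dir.
  have fs2 : fsupp (fun k => 2%:R *: a (2 * k + g)).
    by exists (N + `|g|)%N => k kN; rewrite aN ?scaler0//; lia.
  rewrite -[RHS]E E2 zsum_mulmxr// -[RHS](zsum_refl 0) [LHS]zsum_scale; last first.
    by exists (N + `|g|)%N => k kN; rewrite aN ?mulmx0//; lia.
  apply: eq_fsbigr => k _; rewrite -scalemxAr.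
  by have -> : 2 * (0 - k) + g = g - 2 * k by lia.
have [M dM] := fd; have [K xK] := window_of x.
pose W := (N + M + K + 1)%N.
have one n : \sum_(l <- zwin W) (pmom 1 v *m
    convolution (A n) d (dyfloor n x - (2 ^ n)%N%:Z * l)) = 1%:M.
  have := @iter_subdivision_convE _ _ _ fa _ n (fun=> pmom 1 v) d (dyfloor n x) fd.
  rewrite (@zsum_win _ W); last first.
    move=> l lW; rewrite -dyfloor_sub.
    rewrite (convolution_supp (iter_subdivision_supp (n := n) aN) dM) ?mulmx0//.
    rewrite -(ltr_nat R) natr_absz intr_norm.
    have p2 : 0 < (2%:R : R) ^+ n by rewrite exprn_gt0.
    have p21 : 1 <= (2%:R : R) ^+ n by rewrite exprn_ege1// ler1n.
    have hl : W%:R < `|l%:~R| :> R by rewrite -intr_norm -natr_absz ltr_nat.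
    have hx : N%:R + M%:R + 1 < `|x - l%:~R|.
      have := ler_distD x l%:~R 0; rewrite !subr0 distrC.
      by move: hl; rewrite /W !natrD; lra.
    have h1 := dyfloor_le n (x - l%:~R); have h2 := dyfloor_gt n (x - l%:~R).
    rewrite natrD natrM -subn1 natrB ?expn_gt0// natrX.
    have [N0 M0] : (0 : R) <= N%:R /\ (0 : R) <= M%:R by [].
    have hp : 2%:R ^+ n * (N%:R + M%:R + 1) < 2%:R ^+ n * `|x - l%:~R|.
      by rewrite ltr_pM2l.
    have hM : M%:R + 1 <= 2%:R ^+ n * (M%:R + 1) :> R by rewrite ler_peMl// addr_ge0.
    have hN : (2%:R ^+ n - 1) * N%:R + (M%:R + 1) <=
        2%:R ^+ n * (N%:R + M%:R + 1) :> R.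
      by move: hM; rewrite mulrBl mul1r !mulrDr mulr1; lra.
    have [y0|y0] := leP 0 (x - l%:~R).
      rewrite (ger0_norm y0) in hp.
      by rewrite (lt_le_trans _ (ler_norm _))//; move: h1 h2 hp hN; lra.
    rewrite (ltr0_norm y0) mulrN in hp.
    by rewrite -normrN (lt_le_trans _ (ler_norm _))//; move: h1 h2 hp hN; lra.
  move=> <-; rewrite cst /convolution.
  rewrite -zsum_mulmxr; last by exists M => y /dM.
  rewrite -[RHS]d1 pmom1_conv//; congr (_ *m _).
  by apply: eq_fsbigr => y _; rewrite hornerC scale1r.
have xK' : `|x| <= K%:R by exact: ltW.
rewrite (@zsum_win _ W) => [|l lW]; last first.
  rewrite (translate_vanish _ aN xK') ?mulmx0//.
  by move: lW; rewrite /W; lia.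
apply/eqP; rewrite -subr_eq0; apply/eqP.
apply: (limit_small ms (n0 := 0%N)
  (B := (W.*2.+1)%:R * (r%:R * entry_norm (pmom 1 v) * D))) => n _.
rewrite -(one n) -sumrB (le_trans (entry_norm_sum _ _ _))//.
rewrite (@le_trans _ _ (\sum_(l <- zwin W) r%:R * entry_norm (pmom 1 v) * D * rate ^+ n))//.
  apply: ler_sum => l _; rewrite -mulmxBr (le_trans (entry_normM _ _))//.
  rewrite -!mulrA ler_wpM2l// ler_wpM2l ?entry_norm_ge0//.
  by rewrite -entry_normN opprB -dyfloor_sub limit_near.
by rewrite big_const_seq count_predT size_zwin iter_addr_0 -[leLHS]mulr_natl !mulrA.
Qed.

End refinable_equations.

(** * Compactly supported integrals *)

Section integrals.
Context {R : realType}.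
Notation mu := (@lebesgue_measure R).

Definition csupp (K : R) (g : R -> R) : Prop :=
  continuous g /\ forall x, K < `|x| -> g x = 0.

Lemma csupp_integrable (K : R) (g : R -> R) : csupp K g ->
  mu.-integrable setT (EFin \o g).
Proof.
move=> [cg gK].
have : mu.-integrable `[- K, K] (EFin \o g).
  apply: continuous_compact_integrable; first exact: segment_compact.
  by apply: continuous_subspaceT => x; exact: cg.
rewrite integrable_mkcond//=.
have -> // : (EFin \o g) \_ `[- K, K] = EFin \o g.
apply/funext => x; rewrite patchE; case: ifPn => //.
rewrite notin_setE /= in_itv/= => /negP; rewrite -ler_norml -ltNge => xK.
by rewrite gK.
Qed.

(** For compact support the integral is an increment of an antiderivative; change of variables,
    bounds and periodization are then elementary calculus. *)
Lemma csupp_antiderivative (K : R) (g : R -> R) : csupp K g ->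
  exists2 G : R -> R, (forall x : R, is_derive x 1 G (g x)) &
    forall a b, a < - K -> K <= b -> Rintegral mu setT g = G b - G a.
Proof.
move=> gK; have ig := csupp_integrable gK.
exists (fun x => Rintegral mu `]-oo, x] g).
  move=> x; have [] := @continuous_FTC1 R g -oo%O x (x + 1).
  - by rewrite ltrDl.
  - exact: integrableS ig.
  - exact: ltNyr.
  - exact: gK.1.
  by move=> dG; rewrite derive1E => G'; exact: DeriveDef.
move=> a b aK bK.
have -> : Rintegral mu `]-oo, a] g = 0.
  rewrite Rintegral_mkcond (_ : g \_ `]-oo, a] = fun=> 0).
    by rewrite /Rintegral integral0.
  apply/funext => x; rewrite patchE; case: ifPn => // .
  rewrite inE /= in_itv/= => xa; apply: gK.2.
  by rewrite ltr_normr; apply/orP; right; lra.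
rewrite subr0 [RHS]Rintegral_mkcond; apply: eq_Rintegral => x _.
rewrite patchE; case: ifPn => // ; rewrite notin_setE /= in_itv/= => /negP.
rewrite -ltNge => bx; apply: gK.2; rewrite ltr_normr; apply/orP; left.
exact: le_lt_trans bx.
Qed.

Lemma csupp_FTC (K : R) (g G : R -> R) (a b : R) : csupp K g ->
  (forall x : R, is_derive x 1 G (g x)) -> a < - K -> K <= b ->
  Rintegral mu setT g = G b - G a.
Proof.
move=> gK GD aK bK; have [H HD HE] := csupp_antiderivative gK.
rewrite (HE a b aK bK).
have : G b - H b = G a - H a.
  apply: (@is_derive_0_is_cst R (fun x => G x - H x)) => x.
  have e0 : (0 : R) = g x - g x by rewrite subrr.
  by rewrite [X in is_derive _ _ _ X]e0; exact: is_deriveB.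
by move=> e; lra.
Qed.

Lemma csupp_affine (K : R) (g : R -> R) (k : int) : csupp K g ->
  csupp (K + `|k%:~R|) (fun x => g (2%:R * x - k%:~R)) /\
  Rintegral mu setT (fun x => g (2%:R * x - k%:~R)) =
  2%:R^-1 * Rintegral mu setT g.
Proof.
move=> gK; have [cg g0] := gK.
have gK' : csupp (K + `|k%:~R|) (fun x => g (2%:R * x - k%:~R)).
  split=> [x|x xK].
    apply: (@continuous_comp R R R (fun x : R => 2%:R * x - k%:~R) g);
      last exact: cg.
    apply: cvgB; last exact: cvg_cst.
    by apply: cvgM; [exact: cvg_cst|exact: cvg_id].
  apply: g0; have := ler_normD (2%:R * x - k%:~R) k%:~R; rewrite subrK normrM.
  rewrite (ger0_norm (ler0n _ 2)); have : 0 <= `|x| by [].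
  by move: xK; lra.
split=> //; have [G GD GE] := csupp_antiderivative gK.
pose b : R := `|K| + `|k%:~R| + 1.
have [n1 n2] : K <= `|K| /\ - K <= `|K|.
  by rewrite ler_norm -normrN ler_norm.
have [k1 k2] : k%:~R <= `|k%:~R| :> R /\ - k%:~R <= `|k%:~R| :> R.
  by rewrite ler_norm -normrN ler_norm.
have k0 : 0 <= `|k%:~R| :> R by [].
have K0 : 0 <= `|K| by [].
have GD' (x : R) : is_derive x 1 (fun x => 2%:R^-1 * G (2%:R * x - k%:~R))
    (g (2%:R * x - k%:~R)).
  have e : g (2%:R * x - k%:~R) = 2%:R^-1 * (2%:R * g (2%:R * x - k%:~R)).
    by rewrite mulKf// pnatr_eq0.
  rewrite [X in is_derive _ _ _ X]e.
  apply: is_derive_funZ; exact: is_derive_affine.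
have e := @csupp_FTC _ _ _ (- b) b gK' GD'.
rewrite e; [|by rewrite /b; lra..].
by rewrite -mulrBr (GE (2%:R * - b - k%:~R) (2%:R * b - k%:~R))//; rewrite /b; lra.
Qed.

(** Mean value theorem on [-K - 1, K]: the left end has to lie strictly below -K, whence the length
    2K + 1. *)
Lemma csupp_bound (K c : R) (g : R -> R) : csupp K g -> 0 <= K ->
  (forall x, `|g x| <= c) -> `|Rintegral mu setT g| <= (2%:R * K + 1) * c.
Proof.
move=> gK K0 gc; have [G GD GE] := csupp_antiderivative gK.
rewrite (GE (- K - 1) K)//; last by lra.
have aK : - K - 1 <= K by lra.
have GD' (x : R) : x \in `](- K - 1), K[%R -> is_derive x 1 G (g x).
  by move=> _; exact: GD.
have GC : {within `[(- K - 1), K], continuous G}.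
  by apply: continuous_subspaceT => x; have /is_derive_continuous := GD x.
have [x _ ->] := @MVT_segment R G g (- K - 1) K aK GD' GC.
rewrite normrM mulrC.
have -> : K - (- K - 1) = 2%:R * K + 1 by lra.
by rewrite ger0_norm ?ler_wpM2l//; lra.
Qed.

(** The sum H(x) of the G(x - l) has derivative c on [0, 1], so H(1) - H(0) = c. The same difference
    telescopes to G(W + 1) - G(-W), the integral of [g]. *)
Lemma csupp_partition (K c : R) (W : nat) (g : R -> R) : csupp K g ->
  K + 2%:R < W%:R ->
  (forall x, 0 <= x <= 1 -> \sum_(l <- zwin W) g (x - l%:~R) = c) ->
  Rintegral mu setT g = c.
Proof.
move=> gK KW gc; have [G GD GE] := csupp_antiderivative gK.
pose H x := \sum_(l <- zwin W) G (x - l%:~R).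
have HD (x : R) : is_derive x 1 H (\sum_(l <- zwin W) g (x - l%:~R)).
  rewrite /H; elim: (zwin W) => [|l s IH].
    rewrite big_nil; under eq_fun do rewrite big_nil.
    exact: is_derive_cst.
  rewrite big_cons; under eq_fun do rewrite big_cons.
  apply: is_derive_funD => //.
  have := @is_derive_affine R G 1 (- l%:~R) x (g (x - l%:~R)).
  rewrite !mul1r => /(_ (GD _)).
  by under eq_fun do rewrite mul1r.
have : H 1 - H 0 = c.
  have HD' (x : R) : x \in `]0, 1[%R ->
      is_derive x 1 H (\sum_(l <- zwin W) g (x - l%:~R)) by move=> _; exact: HD.
  have HC : {within `[0, 1], continuous H}.
    by apply: continuous_subspaceT => x; have /is_derive_continuous := HD x.
  have [x] := @MVT_segment R H _ 0 1 ler01 HD' HC.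
  by rewrite in_itv/= => /gc -> ->; rewrite subr0 mulr1.
move=> <-; rewrite (GE (- W%:R) (W%:R + 1)); [|by lra..].
rewrite /H -sumrB /zwin big_map -[W.*2.+1]subn0 -/(index_iota 0 W.*2.+1).
pose F (i : nat) : R := - G (W%:R + 1 - i%:R).
rewrite (eq_bigr (fun i => F i.+1 - F i)) => [|i _]; last first.
  rewrite /F opprK [RHS]addrC intrB -!pmulrn -natr1.
  congr (G _ - G _); lra.
rewrite telescope_sumr// /F opprK [RHS]addrC; congr (G _ - G _).
  by rewrite subr0.
by rewrite -addnn -addn1 !natrD; lra.
Qed.

End integrals.

(** * Complex integrals and the distribution defined by the refinable function *)

Section complex_integrals.
Context {R : realType}.
Notation C := R[i].
Notation normc := (@ComplexField.Normc.normc R).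
Notation mu := (@lebesgue_measure R).

Definition ccsupp (K : R) (f : R -> C) : Prop :=
  csupp K (fun x => complex.Re (f x)) /\ csupp K (fun x => complex.Im (f x)).

Definition ccontinuous (f : R -> C) : Prop :=
  continuous (fun x => complex.Re (f x)) /\ continuous (fun x => complex.Im (f x)).

Lemma csuppW (K K' : R) (g : R -> R) : K <= K' -> csupp K g -> csupp K' g.
Proof. by move=> KK' [cg g0]; split=> // x xK; apply: g0; exact: le_lt_trans xK. Qed.

Lemma ccsuppW (K K' : R) (f : R -> C) : K <= K' -> ccsupp K f -> ccsupp K' f.
Proof. by move=> KK' [f1 f2]; split; apply: csuppW KK' _. Qed.

Lemma continuous_funD (f g : R -> R) : continuous f -> continuous g ->
  continuous (fun x => f x + g x).
Proof. by move=> cf cg x; apply: cvgD; [exact: cf|exact: cg]. Qed.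

Lemma continuous_funM (f g : R -> R) : continuous f -> continuous g ->
  continuous (fun x => f x * g x).
Proof. by move=> cf cg x; apply: cvgM; [exact: cf|exact: cg]. Qed.

Lemma continuous_funN (f : R -> R) : continuous f -> continuous (fun x => - f x).
Proof. by move=> cf x; apply: cvgN; exact: cf. Qed.

Lemma ccontinuousM (f g : R -> C) : ccontinuous f -> ccontinuous g ->
  ccontinuous (fun x => f x * g x).
Proof.
move=> [f1 f2] [g1 g2]; split.
  under eq_fun do rewrite ReM.
  apply: continuous_funD; first exact: continuous_funM.
  by apply: continuous_funN; exact: continuous_funM.
under eq_fun do rewrite ImM.
by apply: continuous_funD; exact: continuous_funM.
Qed.

Lemma ccontinuousD (f g : R -> C) : ccontinuous f -> ccontinuous g ->
  ccontinuous (fun x => f x + g x).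
Proof.
move=> [f1 f2] [g1 g2]; split.
  by under eq_fun do rewrite ReD; exact: continuous_funD.
by under eq_fun do rewrite ImD; exact: continuous_funD.
Qed.

Lemma ccontinuous_cst (c : C) : ccontinuous (fun=> c).
Proof. by split=> x; exact: cvg_cst. Qed.

Lemma ccsuppP (K : R) (f : R -> C) :
  ccsupp K f <-> ccontinuous f /\ forall x, K < `|x| -> f x = 0.
Proof.
split=> [[[f1 f10] [f2 f20]]|[[f1 f2] f0]].
  split=> // x xK; apply/eqP; rewrite eq_complex/=.
  by rewrite f10// f20// !eqxx.
by split; split=> // x xK; rewrite f0.
Qed.

Lemma ccsuppM (K : R) (f g : R -> C) : ccsupp K f -> ccontinuous g ->
  ccsupp K (fun x => f x * g x).
Proof.
move=> /ccsuppP[cf f0] cg; apply/ccsuppP; split; first exact: ccontinuousM.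
by move=> x xK; rewrite f0// mul0r.
Qed.

Lemma ccsuppD (K : R) (f g : R -> C) : ccsupp K f -> ccsupp K g ->
  ccsupp K (fun x => f x + g x).
Proof.
move=> /ccsuppP[cf f0] /ccsuppP[cg g0]; apply/ccsuppP; split.
  exact: ccontinuousD.
by move=> x xK; rewrite f0// g0// addr0.
Qed.

Lemma ccsuppZ (K : R) (c : C) (f : R -> C) : ccsupp K f ->
  ccsupp K (fun x => c * f x).
Proof.
move=> /ccsuppP[cf f0]; apply/ccsuppP; split.
  by apply: ccontinuousM => //; exact: ccontinuous_cst.
by move=> x xK; rewrite f0// mulr0.
Qed.

Lemma cintegralD (K : R) (f g : R -> C) : ccsupp K f -> ccsupp K g ->
  cintegral (fun x => f x + g x) = cintegral f + cintegral g.
Proof.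
move=> [f1 f2] [g1 g2]; rewrite /cintegral.
under eq_Rintegral do rewrite ReD.
rewrite RintegralD//; [|exact: csupp_integrable f1|exact: csupp_integrable g1].
under [X in _ +i* X]eq_Rintegral do rewrite ImD.
by rewrite RintegralD//; [exact: csupp_integrable f2|exact: csupp_integrable g2].
Qed.

Lemma cintegralZ (K : R) (c : C) (f : R -> C) : ccsupp K f ->
  cintegral (fun x => c * f x) = c * cintegral f.
Proof.
move=> [f1 f2]; have [i1 i2] := (csupp_integrable f1, csupp_integrable f2).
have iZ (k : R) (g : R -> R) : mu.-integrable setT (EFin \o g) ->
    mu.-integrable setT (EFin \o (fun x => k * g x)).
  move=> ig; rewrite (_ : EFin \o _ = (fun x => k%:E * (EFin \o g) x)%E).
    exact: integrableZl.
  by apply/funext => x /=; rewrite EFinM.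
rewrite /cintegral.
under eq_Rintegral do rewrite ReM.
rewrite RintegralB//; [|exact: iZ|exact: iZ].
under [X in _ +i* X]eq_Rintegral do rewrite ImM.
rewrite RintegralD//; [|exact: iZ|exact: iZ].
by rewrite !RintegralZl//; case: c => x y.
Qed.

Lemma cintegral0 : cintegral (fun _ : R => 0 : C) = 0.
Proof. by rewrite /cintegral /Rintegral !integral0. Qed.

Lemma ccsupp0 (K : R) : ccsupp K (fun=> 0).
Proof. by apply/ccsuppP; split=> //; exact: ccontinuous_cst. Qed.

Lemma cintegral_sum (K : R) (I : Type) (s : seq I) (f : I -> R -> C) :
  (forall i, ccsupp K (f i)) ->
  ccsupp K (fun x => \sum_(i <- s) f i x) /\
  cintegral (fun x => \sum_(i <- s) f i x) = \sum_(i <- s) cintegral (f i).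
Proof.
move=> fK; elim: s => [|j s [IH1 IH2]].
  rewrite big_nil; under eq_fun do rewrite big_nil.
  by split; [exact: ccsupp0|exact: cintegral0].
rewrite big_cons; under eq_fun do rewrite big_cons.
by split; [exact: ccsuppD|rewrite (cintegralD (fK j) IH1) IH2].
Qed.

Lemma cintegral_affine (K : R) (f : R -> C) (k : int) : ccsupp K f ->
  ccsupp (K + `|k%:~R|) (fun x => f (2%:R * x - k%:~R)) /\
  cintegral (fun x => f (2%:R * x - k%:~R)) = 2%:R^-1 * cintegral f.
Proof.
move=> [f1 f2]; have [a1 e1] := csupp_affine k f1.
have [a2 e2] := csupp_affine k f2; split=> //.
rewrite /cintegral e1 e2.
have -> : (2%:R^-1 : C) = (2%:R^-1 : R)%:C by rewrite rmorphV ?unitfE ?pnatr_eq0// rmorph_nat.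
by apply/eqP; rewrite eq_complex/= !mul0r subr0 addr0 !eqxx.
Qed.

Lemma cintegral_bound (K c : R) (f : R -> C) : ccsupp K f -> 0 <= K ->
  (forall x, normc (f x) <= c) ->
  normc (cintegral f) <= 2%:R * (2%:R * K + 1) * c.
Proof.
move=> [f1 f2] K0 fc; rewrite (le_trans (normc_le_ReIm _))//=.
have h1 := csupp_bound f1 K0 (fun x => le_trans (normc_Re _) (fc x)).
have h2 := csupp_bound f2 K0 (fun x => le_trans (normc_Im _) (fc x)).
by rewrite -mulrA mulr_natl mulr2n lerD.
Qed.

Lemma smooth_ccontinuous (f : R -> C) : smooth f -> ccontinuous f.
Proof.
move=> /(_ 0%N)[[_ h1] [_ h2]]; split.
  by have := h1 0%N isT.
by have := h2 0%N isT.
Qed.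

Lemma smooth_cisN (xi : R) : smooth (fun x => cis (- (x * xi)) : C).
Proof.
have -> : (fun x => cis (- (x * xi))) =
    (fun x => \sum_(j <- [:: tt]) 1 * cis (- xi * x)) :> (R -> C).
  by apply/funext => x; rewrite big_seq1 mul1r mulNr mulrC.
exact: (expsum_chain [:: tt] (fun=> 1) (fun=> - xi)).1.
Qed.

Section distribution.
Variables (r : nat) (a : int -> 'M[C]_r) (v : int -> 'rV[C]_r).
Variables (phi : R -> 'cV[C]_r) (N : nat) (B : R).
Hypotheses (aN : supported_in N a).
Hypothesis phiN : forall i, ccsupp N%:R (fun x => phi x i 0).
Hypothesis phiB : forall x i, normc (phi x i 0) <= B.
Hypothesis phi_refine : forall x, phi x =
  2%:R *: \sum_(l \in [set: int]) (a l *m phi (2%:R * x - l%:~R)).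
Hypothesis phi_unity : forall x,
  \sum_(l \in [set: int]) (pmom 1 v *m phi (x - l%:~R)) = 1%:M.

Lemma distribution_of_compact i : compact_distribution (distribution_of phi i).
Proof.
split=> [c f g sf sg|].
  have [cf cg] := (smooth_ccontinuous sf, smooth_ccontinuous sg).
  have pf := ccsuppM (phiN i) cf; have pg := ccsuppM (phiN i) cg.
  rewrite /distribution_of.
  under eq_fun do rewrite mulrDr mulrCA.
  by rewrite (cintegralD (ccsuppZ c pf) pg) (cintegralZ c pf).
exists N%:R, (2%:R * (2%:R * N%:R + 1) * B), 0%N => f sf c fc.
have cf := smooth_ccontinuous sf; have pf := ccsuppM (phiN i) cf.
have f0 x : cderiven 0 f x = f x by rewrite /cderiven !derive1n0; case: (f x).
have fc' x : `|x| <= N%:R -> normc (f x) <= c.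
  by move=> xN; rewrite -f0; apply: fc.
have c0 : 0 <= c.
  by apply: (le_trans (normc_ge0 _)); apply: (fc' 0); rewrite normr0.
have B0 : 0 <= B := le_trans (normc_ge0 _) (phiB 0 i).
rewrite /distribution_of -mulrA; apply: (cintegral_bound pf) => // x.
have [xN|xN] := leP `|x| N%:R.
  by rewrite ComplexField.Normc.normcM ler_pM ?normc_ge0// fc'.
have [_ p0] := (ccsuppP _ _).1 (phiN i).
by rewrite p0// mul0r ComplexField.Normc.normc0 mulr_ge0.
Qed.

Lemma distribution_of_refine xi :
  vec_fourier (distribution_of phi) (2%:R * xi) =
  symbol a xi *m vec_fourier (distribution_of phi) xi.
Proof.
apply/matrixP => i z; rewrite ord1 !mxE.
pose h l x := phi x l 0 * cis (- (x * xi)).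
have hN l : ccsupp N%:R (h l).
  by apply: ccsuppM => //; apply: smooth_ccontinuous; exact: smooth_cisN.
pose K : R := N%:R + N%:R.
have hk l (k : int) : (`|k| <= N)%N ->
    ccsupp K (fun x => h l (2%:R * x - k%:~R)) /\
    cintegral (fun x => h l (2%:R * x - k%:~R)) = 2%:R^-1 * cintegral (h l).
  move=> kN; have [h1 h2] := cintegral_affine k (hN l); split=> //.
  by apply: ccsuppW h1; rewrite lerD2l -intr_norm -natr_absz ler_nat.
pose c k l : C := 2%:R * a k i l * cis (- (k%:~R * xi)).
(* [cintegral_sum] wants one support bound for all indices, while the translates by k fit into [K]
   only for |k| <= N; the conditional supplies 0 elsewhere. *)
have -> : fourier (distribution_of phi i) (2%:R * xi) =
    cintegral (fun x => \sum_(k <- zwin N) \sum_l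
      (if (`|k| <= N)%N then c k l * h l (2%:R * x - k%:~R) else 0)).
  rewrite /fourier /distribution_of; congr cintegral; apply/funext => x.
  rewrite {1}phi_refine (@zsum_win _ N) => [|k kN]; last by rewrite aN// mul0mx.
  rewrite mxE summxE -mulrA mulr_suml mulr_sumr.
  rewrite !big_seq; apply: eq_bigr => k; rewrite mem_zwin => kN; rewrite kN.
  rewrite mxE mulr_suml mulr_sumr; apply: eq_bigr => l _.
  rewrite /c /h.
  have -> : cis (- (x * (2%:R * xi))) = cis (- (k%:~R * xi)) *
      cis (- ((2%:R * x - k%:~R) * xi)) :> C.
    by rewrite -cisD; congr cis; ring.
  by ring.
have hs k l : ccsupp K (fun x =>
    if (`|k| <= N)%N then c k l * h l (2%:R * x - k%:~R) else 0).
  have [kN|_] := boolP (`|k| <= N)%N; last exact: ccsupp0.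
  by apply: ccsuppZ; exact: (hk l k kN).1.
rewrite (cintegral_sum (zwin N) (fun k => (cintegral_sum (index_enum 'I_r) (hs k)).1)).2.
under eq_bigr do rewrite (cintegral_sum _ (hs _)).2.
rewrite exchange_big/=; apply: eq_bigr => l _.
rewrite !mxE (symbol_win _ aN) summxE mulr_suml.
rewrite !big_seq; apply: eq_bigr => k; rewrite mem_zwin => kN; rewrite kN.
have [h1 h2] := hk l k kN; rewrite (cintegralZ _ h1) h2 mxE /c.
rewrite [fourier _ _](_ : _ = cintegral (h l))//.
rewrite !mulrA; congr (_ * _).
by rewrite mulrC -!mulrA mulKf ?pnatr_eq0// mulrC.
Qed.

(** The integer translates of v^(0) phi sum to 1, so its integral over the line is 1 by
    [csupp_partition], applied to real and imaginary parts. *)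
Lemma distribution_of_normalized :
  symbol v 0 *m vec_fourier (distribution_of phi) 0 = 1%:M.
Proof.
rewrite symbol_at0; apply/matrixP => y z; rewrite !ord1 mxE [RHS]mxE.
pose h x := \sum_i pmom 1 v 0 i * phi x i 0.
have hE x : h x = (pmom 1 v *m phi x) 0 0 by rewrite mxE.
have [hN hI] := @cintegral_sum N%:R _ (index_enum 'I_r)
  (fun i x => pmom 1 v 0 i * phi x i 0) (fun i => ccsuppZ _ (phiN i)).
have -> : \sum_j pmom 1 v 0 j * vec_fourier (distribution_of phi) 0 j 0 =
    cintegral h.
  rewrite hI; apply: eq_bigr => i _; rewrite mxE (cintegralZ _ (phiN i)).
  congr (_ * _); rewrite /fourier /distribution_of; congr cintegral.
  by apply/funext => x; rewrite mulr0 oppr0 cis0 mulr1.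
have [hR hIm] := hN.
pose W := (N + 3)%N.
have KW : N%:R + 2%:R < W%:R :> R by rewrite -natrD ltr_nat /W; lia.
have sumh x : 0 <= x <= 1 -> \sum_(l <- zwin W) h (x - l%:~R) = 1.
  move=> /andP[x0 x1]; have := phi_unity x.
  rewrite (@zsum_win _ W) => [/(congr1 (fun A : 'M[C]_1 => A 0 0))|l lW].
    rewrite summxE [X in _ = X -> _]mxE eqxx mulr1n => <-.
    by apply: eq_bigr => l _; rewrite hE.
  rewrite (_ : phi _ = 0) ?mulmx0//; apply/matrixP => i j; rewrite ord1 mxE.
  have [_ p0] := (ccsuppP _ _).1 (phiN i); apply: p0.
  have : W%:R < `|l%:~R| :> R by rewrite -intr_norm -natr_absz ltr_nat.
  have := ler_distD x l%:~R 0; rewrite !subr0 distrC (ger0_norm x0).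
  by rewrite /W natrD; lra.
rewrite /cintegral (csupp_partition (c := 1) hR KW) => [|x /sumh e]; last first.
  by rewrite -[RHS]/(complex.Re (1 : C)) -e raddf_sum.
rewrite (csupp_partition (c := 0) hIm KW) => [//|x /sumh e].
by rewrite -[RHS]/(complex.Im (1 : C)) -e raddf_sum.
Qed.

Lemma distribution_of_normalized_refinable :
  normalized_refinable a v (distribution_of phi).
Proof.
split; [exact: distribution_of_compact|exact: distribution_of_refine|].
exact: distribution_of_normalized.
Qed.

End distribution.
End complex_integrals.

(** * Uniqueness *)

Section bernstein.
Context {R : realType}.

Definition bern (n k : nat) (y : R) : R :=
  'C(n, k)%:R * y ^+ k * (1 - y) ^+ (n - k).

Lemma sum_bern (n : nat) (y : R) : \sum_(k < n.+1) bern n k y = 1.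
Proof.
have := exprDn (1 - y) y n; rewrite subrK expr1n => ->.
by apply: eq_bigr => k _; rewrite /bern -mulr_natl; ring.
Qed.

(** The identity (k+1) C(n+1, k+1) = (n+1) C(n, k) absorbs a factor k; the weights 1 and k give the
    first two moments of the binomial law. *)
Lemma sum_weighted_bern (n : nat) (w : nat -> R) (y : R) :
  \sum_(k < n.+2) k%:R * w k * bern n.+1 k y =
  n.+1%:R * y * \sum_(k < n.+1) w k.+1 * bern n k y.
Proof.
rewrite big_ord_recl/= mul0r mul0r add0r mulr_sumr; apply: eq_bigr => k _.
rewrite /bump/= add1n /bern subSS exprS.
have : n.+1%:R * 'C(n, k)%:R = k.+1%:R * 'C(n.+1, k.+1)%:R :> R.
  by rewrite -!natrM mul_bin_diag.
move=> e; transitivity (k.+1%:R * 'C(n.+1, k.+1)%:R * w k.+1 * y * y ^+ k *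
  (1 - y) ^+ (n - k)); first by ring.
by rewrite -e; ring.
Qed.

Lemma bern_variance (n : nat) (y : R) :
  \sum_(k < n.+2) (k%:R / n.+1%:R - y) ^+ 2 * bern n.+1 k y =
  y * (1 - y) / n.+1%:R.
Proof.
have n0 : (n.+1%:R : R) != 0 by rewrite pnatr_eq0.
have m1 : \sum_(k < n.+2) k%:R * bern n.+1 k y = n.+1%:R * y.
  have := sum_weighted_bern n (fun=> 1) y.
  under eq_bigr do rewrite mulr1; move=> ->.
  by under eq_bigr do rewrite mul1r; rewrite sum_bern mulr1.
have m1' : \sum_(k < n.+1) k%:R * bern n k y = n%:R * y.
  case: (n) => [|l]; first by rewrite big_ord1 !mul0r.
  have := sum_weighted_bern l (fun=> 1) y.
  under eq_bigr do rewrite mulr1; move=> ->.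
  by under eq_bigr do rewrite mul1r; rewrite sum_bern mulr1.
have m2 : \sum_(k < n.+2) k%:R * k%:R * bern n.+1 k y = n.+1%:R * y * (n%:R * y + 1).
  have -> := sum_weighted_bern n (fun k => k%:R) y; congr (_ * _).
  under eq_bigr do rewrite -natr1 mulrDl mul1r.
  by rewrite big_split/= m1' sum_bern.
have -> : \sum_(k < n.+2) (k%:R / n.+1%:R - y) ^+ 2 * bern n.+1 k y =
    n.+1%:R ^- 2 * (\sum_(k < n.+2) k%:R * k%:R * bern n.+1 k y) -
    2%:R * y / n.+1%:R * (\sum_(k < n.+2) k%:R * bern n.+1 k y) +
    y ^+ 2 * \sum_(k < n.+2) bern n.+1 k y.
  rewrite !mulr_sumr -sumrB -big_split/=; apply: eq_bigr => k _.
  by field.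
rewrite m2 m1 sum_bern -natr1; field.
by rewrite natr1.
Qed.

Lemma bernstein_lipschitz (g : R -> R) (K Lam e : R) : 0 < K -> 0 < e ->
  (forall x y, `|x| <= K -> `|y| <= K -> `|g x - g y| <= Lam * `|x - y|) ->
  exists p : {poly R}, forall x, `|x| <= K -> `|g x - p.[x]| <= e.
Proof.
move=> K0 e0 gL.
have K2 : 0 < 2%:R * K by rewrite mulr_gt0.
have Lam0 : 0 <= Lam.
  have := gL K (- K); rewrite normrN (gtr0_norm K0) lexx => /(_ isT isT) h.
  have := le_trans (normr_ge0 _) h; rewrite pmulr_lge0//.
  by rewrite opprK normr_gt0 -mulr2n -mulr_natl gt_eqF.
(* The Lipschitz constant after rescaling [-K, K] to [0, 1], enlarged to be positive. The bound |z|
   <= t + z^2 / t brings in the variance without a square root; [t] makes the first term contribute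
   e / 2, and [n] makes the second at most e / 2. *)
pose L' := (Lam + 1) * (2%:R * K).
have L'0 : 0 < L' by rewrite mulr_gt0// ltr_wpDl.
pose t := e / (2%:R * L').
have t0 : 0 < t by rewrite divr_gt0// mulr_gt0.
pose n := Num.bound (L' / (t * e)).
have nb : L' / (t * e) < n.+1%:R.
  have : L' / (t * e) < n%:R.
    by apply: archi_boundP; rewrite divr_ge0 ?ltW// mulr_gt0.
  by move=> h; rewrite (lt_trans h)// ltr_nat.
pose node (k : nat) : R := 2%:R * K * (k%:R / n.+1%:R) - K.
pose Y : {poly R} := (2%:R * K)^-1 *: ('X + K%:P).
pose p : {poly R} := \sum_(k < n.+2) (g (node k) * 'C(n.+1, k)%:R) *:
  (Y ^+ k * (1 - Y) ^+ (n.+1 - k)).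
exists p => x xK; pose y := (x + K) / (2%:R * K).
have Yx : Y.[x] = y by rewrite /Y !hornerE mulrC.
have pE : p.[x] = \sum_(k < n.+2) g (node k) * bern n.+1 k y.
  rewrite /p horner_sum; apply: eq_bigr => k _.
  by rewrite hornerZ hornerM !horner_exp hornerD hornerN hornerC Yx /bern; ring.
move: xK; rewrite ler_norml => /andP[x1 x2].
have y0 : 0 <= y by rewrite divr_ge0 ?(ltW K2)//; lra.
have y1 : y <= 1 by rewrite ler_pdivrMr//; lra.
have b0 k : 0 <= bern n.+1 k y.
  by rewrite /bern !mulr_ge0// exprn_ge0// subr_ge0.
have xE : x = 2%:R * K * y - K.
  by rewrite /y mulrC divfK ?gt_eqF// addrK.
have -> : g x - p.[x] = \sum_(k < n.+2) (g x - g (node k)) * bern n.+1 k y.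
  under [RHS]eq_bigr do rewrite mulrBl.
  by rewrite sumrB -mulr_sumr sum_bern mulr1 pE.
rewrite (le_trans (ler_norm_sum _ _ _))//.
have nK k : (k <= n.+1)%N -> `|node k| <= K.
  move=> kn; have k1 : k%:R / n.+1%:R <= 1 :> R.
    by rewrite ler_pdivrMr// mul1r ler_nat.
  have k0 : 0 <= k%:R / n.+1%:R :> R by rewrite divr_ge0.
  have h1 : 2%:R * K * (k%:R / n.+1%:R) <= 2%:R * K.
    by rewrite ler_piMr// ltW.
  have h2 : 0 <= 2%:R * K * (k%:R / n.+1%:R) by rewrite mulr_ge0// ltW.
  rewrite /node ler_norml; set z := 2%:R * K * _ in h1 h2 *.
  by clearbody z; apply/andP; split; lra.
rewrite (@le_trans _ _ (\sum_(k < n.+2)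
    L' * (t + (k%:R / n.+1%:R - y) ^+ 2 / t) * bern n.+1 k y))//.
  apply: ler_sum => k _; rewrite normrM (ger0_norm (b0 k)) ler_wpM2r//.
  have kn : (k <= n.+1)%N by rewrite -ltnS.
  rewrite (le_trans (gL _ _ _ (nK k kn)))//; first by rewrite ler_norml x1.
  have -> : x - node k = 2%:R * K * (y - k%:R / n.+1%:R).
    by rewrite {1}xE /node; ring.
  rewrite normrM (gtr0_norm K2) mulrA distrC; set z := _ - y.
  have z2 : `|z| <= t + z ^+ 2 / t.
    rewrite -real_normK ?num_real//; have [zt|tz] := leP `|z| t.
      by rewrite (le_trans zt)// lerDl divr_ge0 ?sqr_ge0// ltW.
    rewrite (@le_trans _ _ (`|z| ^+ 2 / t))//; last by rewrite lerDr ltW.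
    by rewrite ler_pdivlMr// expr2 ler_wpM2l// ltW.
  apply: ler_pM => //; first by rewrite mulr_ge0// ltW.
  by rewrite /L' ler_wpM2r ?(ltW K2)// lerDl.
have -> : \sum_(k < n.+2) L' * (t + (k%:R / n.+1%:R - y) ^+ 2 / t) * bern n.+1 k y
    = L' * t + L' / t * (y * (1 - y) / n.+1%:R).
  rewrite -bern_variance -[L' * t]mulr1 -(sum_bern n.+1 y).
  rewrite !mulr_sumr -big_split/=; apply: eq_bigr => k _; ring.
have e1 : L' * t = e / 2%:R by rewrite /t; field; rewrite gt_eqF.
have yy : y * (1 - y) <= 1 / 4%:R.
  have : 0 <= (y - 1 / 2%:R) ^+ 2 by rewrite sqr_ge0.
  by rewrite expr2; lra.
have e2 : L' / t * (y * (1 - y) / n.+1%:R) <= e / 2%:R.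
  have n0 : 0 < (n.+1%:R : R) by [].
  rewrite mulrA ler_pdivrMr//.
  have : L' / (t * e) * e <= n.+1%:R * e by rewrite ler_pM2r// ltW.
  have -> : L' / (t * e) * e = L' / t by field; rewrite !gt_eqF.
  have a0 : 0 <= L' / t by rewrite divr_ge0 ?ltW.
  have := ler_wpM2l a0 yy; lra.
by rewrite e1 (le_trans (lerD (lexx _) e2))//; lra.
Qed.

Lemma poly_antiderivative (q : {poly R}) (c : R) :
  exists p : {poly R}, p^`() = q /\ p.[0] = c.
Proof.
exists (c%:P + \sum_(k < size q) (q`_k / k.+1%:R) *: 'X^(k.+1)); split.
  rewrite derivD derivC add0r raddf_sum/= -[RHS]coefK poly_def.
  apply: eq_bigr => k _; rewrite derivZ derivXn/= -[X in _ *: X]scaler_nat scalerA.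
  by rewrite divfK// pnatr_eq0.
rewrite hornerD hornerC horner_sum big1 ?addr0// => k _.
by rewrite hornerZ hornerXn expr0n mulr0.
Qed.

Lemma bounded_segment (g : R -> R) (K : R) : 0 < K -> continuous g ->
  exists2 B : R, 0 <= B & forall x, `|x| <= K -> `|g x| <= B.
Proof.
move=> K0 cg.
have cn : {within `[- K, K], continuous (fun x => `|g x|)}.
  apply: continuous_subspaceT => x.
  exact: (@continuous_comp _ _ _ g (fun y => `|y|) x (cg x) (@norm_continuous _ _ _)).
have [c _ H] := @EVT_max R _ (- K) K ltac:(lra) cn.
by exists `|g c| => // x xK; apply: H; rewrite in_itv/= -ler_norml.
Qed.

Lemma mvt_bound (g g' : R -> R) (K B x y : R) :
  (forall x : R, is_derive x 1 g (g' x)) ->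
  (forall x, `|x| <= K -> `|g' x| <= B) -> `|x| <= K -> `|y| <= K ->
  `|g x - g y| <= B * `|x - y|.
Proof.
move=> gD gB; wlog yx : x y / y <= x => [H|].
  move=> xK yK; have [yx|/ltW xy] := leP y x; first exact: H.
  by rewrite distrC [`|x - y|]distrC; exact: H.
rewrite ![`|_| <= K]ler_norml => /andP[x1 x2] /andP[y1 y2].
have gD' (z : R) : z \in `]y, x[%R -> is_derive z 1 g (g' z).
  by move=> _; exact: gD.
have gC : {within `[y, x], continuous g}.
  by apply: continuous_subspaceT => z; have /is_derive_continuous := gD z.
have [z] := MVT_segment yx gD' gC; rewrite in_itv/= => /andP[z1 z2] ->.
by rewrite normrM ler_wpM2r// gB// ler_norml; apply/andP; split; lra.
Qed.

(** The top derivative is approximated first and integrated back M times, with the value at 0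
    matched each time. The tolerance e / (1 + K) is at most e, and stays so after one integration
    over a length K. *)
Lemma weierstrass_Cn (M : nat) (G : nat -> R -> R) (K e : R) :
  0 < K -> 0 < e ->
  (forall n (x : R), is_derive x 1 (G n) (G n.+1 x)) ->
  exists p : {poly R}, forall k x, (k <= M)%N -> `|x| <= K ->
    `|G k x - (p^`(k)).[x]| <= e.
Proof.
move=> K0; elim: M G e => [|M IH] G e e0 GD.
  have cG1 : continuous (G 1%N).
    by move=> x; have /is_derive_continuous := GD 1%N x.
  have [B B0 HB] := bounded_segment K0 cG1.
  have [p Hp] := @bernstein_lipschitz (G 0%N) K B e K0 e0
    (fun x y xK yK => mvt_bound (GD 0%N) HB xK yK).
  by exists p => k x; rewrite leqn0 => /eqP -> ; rewrite derivn0; exact: Hp.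
pose e' := e / (1 + K).
have K1 : 0 < 1 + K by lra.
have e'0 : 0 < e' by rewrite divr_gt0.
have [q Hq] := IH (fun n => G n.+1) e' e'0 (fun n x => GD n.+1 x).
have [p [pq p0]] := poly_antiderivative q (G 0%N 0).
have e'e : e' * (1 + K) = e by rewrite /e' divfK// gt_eqF.
have eK : 0 <= e' * K by rewrite mulr_ge0 ?ltW.
exists p => -[|k] x kM xK; last first.
  rewrite derivSn pq (le_trans (Hq k x kM xK))//.
  by move: e'e; rewrite mulrDr mulr1; lra.
rewrite derivn0.
have D (z : R) : is_derive z 1 (fun z => G 0%N z - p.[z]) (G 1%N z - q.[z]).
  by rewrite -pq; apply: is_deriveB => //; exact: is_derive_poly.
have Db z : `|z| <= K -> `|G 1%N z - q.[z]| <= e'.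
  by move=> zK; have := Hq 0%N z isT zK; rewrite derivn0.
have := @mvt_bound _ _ K e' x 0 D Db xK; rewrite normr0 => /(_ (ltW K0)).
rewrite p0 subrr !subr0 => h; rewrite (le_trans h)//.
rewrite (@le_trans _ _ (e' * K))// ?ler_wpM2l ?(ltW e'0)//.
by move: e'e; rewrite mulrDr mulr1; lra.
Qed.

End bernstein.

(** * Distributions with vanishing Fourier transform *)

Section distributions.
Context {R : realType}.
Notation C := R[i].
Notation normc := (@ComplexField.Normc.normc R).
Implicit Types T : (R -> C) -> C.

Lemma smooth_is_derive (f : R -> C) : smooth f -> forall n (x : R),
  is_derive x 1 (derive1n n (fun t => complex.Re (f t)))
    (derive1n n.+1 (fun t => complex.Re (f t)) x) /\
  is_derive x 1 (derive1n n (fun t => complex.Im (f t)))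
    (derive1n n.+1 (fun t => complex.Im (f t)) x).
Proof.
move=> sf n x; have [[dR _] [dI _]] := sf n.+1.
split.
  have -> : derive1n n.+1 (fun t => complex.Re (f t)) x =
    'D_1 (derive1n n (fun t => complex.Re (f t))) x by rewrite -derive1E.
  exact/derivableP/dR.
have -> : derive1n n.+1 (fun t => complex.Im (f t)) x =
  'D_1 (derive1n n (fun t => complex.Im (f t))) x by rewrite -derive1E.
exact/derivableP/dI.
Qed.

Lemma is_cderive_cderiven (f : R -> C) : smooth f ->
  forall n x, is_cderive (cderiven n f) x (cderiven n.+1 f x).
Proof. by move=> sf n x; have [h1 h2] := smooth_is_derive sf n x; split. Qed.

Lemma smooth_lin (c : C) (f g : R -> C) : smooth f -> smooth g ->
  smooth (fun x => c * f x + g x) /\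
  forall n, cderiven n (fun x => c * f x + g x) =
    (fun x => c * cderiven n f x + cderiven n g x).
Proof.
move=> sf sg.
pose F n x := c * cderiven n f x + cderiven n g x.
have e (h : R -> C) x : cderiven 0 h x = h x.
  by rewrite /cderiven !derive1n0; case: (h x).
have -> : (fun x => c * f x + g x) = F 0%N.
  by apply/funext => x; rewrite /F !e.
apply: smooth_chain => n x; apply: is_cderiveD; last exact: is_cderive_cderiven.
by apply: is_cderiveZ; exact: is_cderive_cderiven.
Qed.

Lemma smooth0 : smooth (fun _ : R => 0 : C).
Proof. exact: (smooth_chain (fun _ x => is_cderive_cst 0 x)).1. Qed.

Lemma smooth_poly (p : {poly R}) : smooth (fun x => (p.[x])%:C) /\
  forall n, cderiven n (fun x => (p.[x])%:C) = (fun x => ((p^`(n)).[x])%:C).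
Proof.
have H := @smooth_chain R (fun n x => ((p^`(n)).[x])%:C).
rewrite derivn0 in H; apply: H => n x; split; last exact: is_derive_cst.
have := @is_derive_poly R p^`(n) x; rewrite -derivnS; exact.
Qed.

Lemma smooth_real (f : R -> C) : smooth f ->
  smooth (fun x => (complex.Re (f x))%:C) /\ smooth (fun x => (complex.Im (f x))%:C).
Proof.
move=> sf; split.
  pose F n x := (derive1n n (fun t => complex.Re (f t)) x)%:C : C.
  apply: (smooth_chain (F := F) _).1 => n x; split=> /=.
    exact: (smooth_is_derive sf n x).1.
  exact: is_derive_cst.
pose F n x := (derive1n n (fun t => complex.Im (f t)) x)%:C : C.
apply: (smooth_chain (F := F) _).1 => n x; split=> /=.
  exact: (smooth_is_derive sf n x).2.
exact: is_derive_cst.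
Qed.

Lemma distribution0 T : compact_distribution T -> T (fun=> 0) = 0.
Proof.
move=> [lin _]; have := lin 1 _ _ smooth0 smooth0.
have -> : (fun _ : R => 1 * 0 + 0 : C) = fun=> 0.
  by apply/funext => x; rewrite mulr0 addr0.
by rewrite mul1r => /eqP; rewrite eq_sym -subr_eq0 addrK => /eqP.
Qed.

Lemma distribution_sum T (n : nat) (c : nat -> C) (f : nat -> R -> C) :
  compact_distribution T -> (forall k, smooth (f k)) ->
  smooth (fun x => \sum_(k < n) c k * f k x) /\
  T (fun x => \sum_(k < n) c k * f k x) = \sum_(k < n) c k * T (f k).
Proof.
move=> cT sf; have [lin _] := cT; elim: n => [|n [IH1 IH2]].
  rewrite big_ord0; under eq_fun do rewrite big_ord0.
  by split; [exact: smooth0|exact: distribution0].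
have e : (fun x => \sum_(k < n.+1) c k * f k x) =
    (fun x => c n * f n x + \sum_(k < n) c k * f k x).
  by apply/funext => x; rewrite big_ord_recr/= addrC.
rewrite e big_ord_recr/=; split; first exact: (smooth_lin (c n) (sf n) IH1).1.
by rewrite lin// IH2 addrC.
Qed.

Lemma distribution_sub T1 T2 : compact_distribution T1 ->
  compact_distribution T2 -> compact_distribution (fun f => T1 f - T2 f).
Proof.
move=> [l1 [K1 [B1 [M1 H1]]]] [l2 [K2 [B2 [M2 H2]]]]; split.
  by move=> c f g sf sg; rewrite l1// l2//; ring.
exists (Num.max K1 K2), (B1 + B2), (maxn M1 M2) => f sf c Hc.
rewrite (le_trans (normcB _ _))// mulrDl lerD//.
  apply: H1 => // k x kM xK; apply: Hc; first by rewrite leq_max kM.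
  by rewrite le_max xK.
apply: H2 => // k x kM xK; apply: Hc; first by rewrite leq_max kM orbT.
by rewrite le_max xK orbT.
Qed.

Definition cis_remainder (eta : R) (n : nat) (x : R) : C :=
  cis (eta * x) - \sum_(l < n) ('i%C * eta%:C) ^+ l / l`!%:R * (x ^+ l)%:C.

Lemma cis_remainderS eta n x :
  is_cderive (cis_remainder eta n.+1) x ('i%C * eta%:C * cis_remainder eta n x).
Proof.
have monD l : is_cderive (fun t : R => (t ^+ l)%:C) x (l%:R * (x ^+ l.-1)%:C).
  have -> : l%:R * (x ^+ l.-1)%:C = (l%:R * x ^+ l.-1)%:C :> C.
    by rewrite rmorphM rmorph_nat.
  split=> /=; last exact: is_derive_cst.
  have := @is_derive_poly R 'X^l x; rewrite derivXn hornerMn hornerXn mulr_natl.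
  suff -> : horner 'X^l = (fun t : R => t ^+ l) by [].
  by apply/funext => t; rewrite hornerXn.
have -> : cis_remainder eta n.+1 = (fun t => cis (eta * t) + (-1) *
    \sum_(l < n.+1) ('i%C * eta%:C) ^+ l / l`!%:R * (t ^+ l)%:C).
  by apply/funext => t; rewrite mulN1r.
have -> : 'i%C * eta%:C * cis_remainder eta n x =
    'i%C * eta%:C * cis (eta * x) + (-1) *
    \sum_(l < n.+1) ('i%C * eta%:C) ^+ l / l`!%:R * (l%:R * (x ^+ l.-1)%:C).
  rewrite /cis_remainder mulrBr mulN1r; congr (_ - _).
  rewrite big_ord_recl/= mul0r mulr0 add0r mulr_sumr; apply: eq_bigr => l _.
  rewrite /bump/= add1n exprS factS natrM invfM.
  have n0 : (l.+1%:R : C) != 0 by rewrite pnatr_eq0.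
  set w := 'i%C * eta%:C.
  transitivity (w * (w ^+ l / l`!%:R * (x ^+ l)%:C) * (l.+1%:R / l.+1%:R)).
    by rewrite divff// mulr1.
  by ring.
apply: is_cderiveD; first exact: is_cderive_cisZ.
apply: is_cderiveZ; apply: is_cderive_sum => l; apply: is_cderiveZ.
exact: monD.
Qed.

Lemma cis_remainder0 eta x :
  is_cderive (cis_remainder eta 0) x ('i%C * eta%:C * cis_remainder eta 0 x).
Proof.
have -> : cis_remainder eta 0 = (fun t => cis (eta * t)).
  by apply/funext => t; rewrite /cis_remainder big_ord0 subr0.
exact: is_cderive_cisZ.
Qed.

(** The truncated subtraction is intended: beyond order n the remainder is the exponential itself,
    which differentiation only multiplies by i eta. *)
Lemma cis_remainder_smooth eta n : smooth (cis_remainder eta n) /\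
  forall k, cderiven k (cis_remainder eta n) =
    (fun x => ('i%C * eta%:C) ^+ k * cis_remainder eta (n - k) x).
Proof.
pose F k x := ('i%C * eta%:C) ^+ k * cis_remainder eta (n - k) x.
have -> : cis_remainder eta n = F 0%N.
  by apply/funext => x; rewrite /F expr0 mul1r subn0.
apply: smooth_chain => k x; rewrite /F exprSr -mulrA; apply: is_cderiveZ.
have [kn|nk] := ltnP k n.
  have -> : (n - k = (n - k.+1).+1)%N by rewrite subnSK.
  exact: cis_remainderS.
have [-> ->] : (n - k = 0 /\ n - k.+1 = 0)%N.
  by split; apply/eqP; rewrite subn_eq0 ?(leq_trans nk).
exact: cis_remainder0.
Qed.

(* The crude factor 2 comes from applying the mean value bound to the real and
   the imaginary part. *)
Lemma cis_remainder_bound eta n K x : 0 <= K -> `|x| <= K ->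
  normc (cis_remainder eta n x) <= (2%:R * K * `|eta|) ^+ n.
Proof.
move=> K0; elim: n x => [|n IH] x xK.
  by rewrite /cis_remainder big_ord0 subr0 normc_cis expr0.
have zero : cis_remainder eta n.+1 0 = 0.
  rewrite /cis_remainder big_ord_recl/= mulr0 cis0 !expr0 fact0 divr1 mulr1.
  rewrite big1 ?addr0 ?subrr// => l _.
  by rewrite /bump/= add1n expr0n mulr0.
set B := (2%:R * K * `|eta|) ^+ n in IH.
have nw : normc ('i%C * eta%:C) = `|eta|.
  rewrite ComplexField.Normc.normcM normc_real /= expr0n expr1n/= add0r.
  by rewrite sqrtr1 mul1r.
have Db y : `|y| <= K ->
    normc ('i%C * eta%:C * cis_remainder eta n y) <= `|eta| * B.
  by move=> yK; rewrite ComplexField.Normc.normcM nw ler_wpM2l// IH.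
have hR := @mvt_bound R _ _ K (`|eta| * B) x 0
  (fun y => (cis_remainderS eta n y).1)
  (fun y yK => le_trans (normc_Re _) (Db y yK)) xK.
have hI := @mvt_bound R _ _ K (`|eta| * B) x 0
  (fun y => (cis_remainderS eta n y).2)
  (fun y yK => le_trans (normc_Im _) (Db y yK)) xK.
move: hR hI; rewrite zero !normr0 => /(_ K0) + /(_ K0).
rewrite !subr0 => hR hI.
have B0 : 0 <= `|eta| * B by rewrite mulr_ge0// exprn_ge0// !mulr_ge0.
rewrite (le_trans (normc_le_ReIm _))// (le_trans (lerD hR hI))//.
rewrite exprS -/B.
have : `|eta| * B * `|x| <= `|eta| * B * K by rewrite ler_wpM2l.
lra.
Qed.

(** The k-th derivative is (i eta)^k times the remainder of order n - k, in total of order |eta|^n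
    for k <= n. For k > n it is of order |eta|^k, which |eta| <= 1 makes no larger. *)
Lemma distribution_remainder T : compact_distribution T ->
  exists2 B : R, 0 <= B & forall n, exists2 D : R, 0 <= D &
    forall eta, `|eta| <= 1 -> normc (T (cis_remainder eta n)) <= B * (D * `|eta| ^+ n).
Proof.
move=> [_ [K [B [M HT]]]]; exists `|B| => // n.
pose K' := Num.max K 0.
have K'0 : 0 <= K' by rewrite le_max lexx orbT.
pose D := (1 + 2%:R * K') ^+ n.
have D1 : 1 <= D by rewrite exprn_ege1// lerDl mulr_ge0.
exists D; first by rewrite (le_trans _ D1).
move=> eta eta1; have [sR dR] := cis_remainder_smooth eta n.
have eta0 : 0 <= `|eta| by [].
have c0 : 0 <= D * `|eta| ^+ n by rewrite mulr_ge0// ?(le_trans _ D1)// exprn_ge0.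
have := HT _ sR (D * `|eta| ^+ n); move=> h; rewrite (le_trans (h _))//; last first.
  by rewrite ler_wpM2r// ler_norm.
move=> k x kM xK.
have xK' : `|x| <= K' by rewrite le_max xK.
rewrite dR ComplexField.Normc.normcM normcX ComplexField.Normc.normcM normc_real.
have -> : normc ('i%C : C) = 1 by rewrite /= expr0n expr1n/= add0r sqrtr1.
rewrite mul1r.
have ek : 0 <= `|eta| ^+ k by rewrite exprn_ge0.
rewrite (le_trans (ler_wpM2l ek (cis_remainder_bound eta (n - k) K'0 xK')))//.
rewrite exprMn mulrCA.
have [kn|nk] := leqP k n.
  rewrite -exprD subnKC// ler_wpM2r ?exprn_ge0//.
  rewrite (@le_trans _ _ ((1 + 2%:R * K') ^+ (n - k)))//.
    by rewrite lerXn2r ?nnegrE ?addr_ge0 ?mulr_ge0// lerDr.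
  by rewrite ler_weXn2l ?leq_subr// lerDl mulr_ge0.
have -> : (n - k = 0)%N by apply/eqP; rewrite subn_eq0 ltnW.
rewrite !expr0 mulr1 mul1r (@le_trans _ _ (`|eta| ^+ n))//.
  by rewrite ler_wiXn2l// ltnW.
by rewrite ler_peMl// exprn_ge0.
Qed.

(* T applied to the Taylor remainder of order n + 1 of e^{i eta x} is
   O(eta^(n+1)), yet equals - (i eta)^n T(x^n) / n!. *)
Lemma distribution_monomial T n : compact_distribution T ->
  (forall xi, fourier T xi = 0) -> T (fun x => (x ^+ n)%:C) = 0.
Proof.
move=> cT FT; elim/ltn_ind: n => n IH.
have sm l : smooth (fun x : R => (x ^+ l)%:C : C).
  have [h _] := smooth_poly 'X^l; move: h.
  by under eq_fun do rewrite hornerXn.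
have [B B0 HB] := distribution_remainder cT.
have [D D0 HD] := HB n.+1.
have cisT eta : T (fun x => cis (eta * x)) = 0.
  rewrite -(FT (- eta)) /fourier; congr T; apply/funext => x; congr cis.
  by rewrite mulrN opprK mulrC.
have scis eta : smooth (fun x => cis (eta * x) : C).
  have := @smooth_cisN R (- eta).
  by under eq_fun do rewrite mulrN opprK mulrC.
have rem eta : T (cis_remainder eta n.+1) =
    - (('i%C * eta%:C) ^+ n / n`!%:R * T (fun x => (x ^+ n)%:C)).
  have [lin _] := cT.
  have [sS TS] := @distribution_sum T n.+1
    (fun l => - (('i%C * eta%:C) ^+ l / l`!%:R)) (fun l x => (x ^+ l)%:C) cT sm.
  have -> : cis_remainder eta n.+1 = (fun x => 1 * cis (eta * x) +
      \sum_(k < n.+1) - (('i%C * eta%:C) ^+ k / k`!%:R) * (x ^+ k)%:C).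
    apply/funext => x; rewrite /cis_remainder mul1r -sumrN.
    by congr (_ + _); apply: eq_bigr => k _; rewrite mulNr.
  rewrite lin// cisT mulr0 add0r TS big_ord_recr/= big1 ?add0r ?mulNr// => k _.
  by rewrite IH ?mulr0.
set z := T _ in rem *.
have f0 : 0 < (n`!%:R : R) by rewrite ltr0n fact_gt0.
have key : forall eta : R, 0 < eta -> eta <= 1 ->
    normc z <= n`!%:R * (B * D) * eta.
  move=> eta e0 e1; have := HD eta; rewrite rem normcN.
  rewrite !ComplexField.Normc.normcM normcX ComplexField.Normc.normcM normc_real.
  have -> : normc ('i%C : C) = 1 by rewrite /= expr0n expr1n/= add0r sqrtr1.
  rewrite mul1r ComplexField.Normc.normcV normc_nat (gtr0_norm e0).
  move=> /(_ e1); rewrite exprSr.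
  have en : 0 < eta ^+ n by rewrite exprn_gt0.
  rewrite -[leLHS]mulrA.
  have -> : B * (D * (eta ^+ n * eta)) = eta ^+ n * (B * D * eta) by ring.
  rewrite ler_pM2l// mulrC ler_pdivrMr// => h; rewrite (le_trans h)//.
  by rewrite mulrC !mulrA.
have nz : normc z <= 0.
  apply: (@geometric_le R (n`!%:R * (B * D)) 2%:R^-1).
    by rewrite invr_gt0 ltr0n/= invf_lt1 ?ltr1n.
  move=> k; rewrite add0r; apply: key; first by rewrite exprn_gt0.
  by rewrite exprn_ile1// invf_le1 ?ler1n.
apply: ComplexField.Normc.eq0_normc; apply/eqP.
by rewrite eq_le nz normc_ge0.
Qed.

Lemma distribution_poly T (p : {poly R}) : compact_distribution T ->
  (forall xi, fourier T xi = 0) -> T (fun x => (p.[x])%:C) = 0.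
Proof.
move=> cT FT.
have sm l : smooth (fun x : R => (x ^+ l)%:C : C).
  have [h _] := smooth_poly 'X^l; move: h.
  by under eq_fun do rewrite hornerXn.
have [_ TS] := @distribution_sum T (size p) (fun l => (p`_l)%:C)
  (fun l x => (x ^+ l)%:C) cT sm.
have -> : (fun x => (p.[x])%:C) =
    (fun x => \sum_(k < size p) (p`_k)%:C * (x ^+ k)%:C) :> (R -> C).
  apply/funext => x; rewrite horner_coef rmorph_sum; apply: eq_bigr => k _.
  by rewrite rmorphM.
by rewrite TS big1// => k _; rewrite distribution_monomial// mulr0.
Qed.

Lemma distribution_eq0 T f : compact_distribution T ->
  (forall xi, fourier T xi = 0) -> smooth f -> T f = 0.
Proof.
move=> cT FT sf; have [lin [K [B [M HT]]]] := cT.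
pose K' := Num.max K 1.
have K'0 : 0 < K' by rewrite lt_max ltr01 orbT.
have real (g : R -> R) : smooth (fun x => (g x)%:C : C) -> T (fun x => (g x)%:C) = 0.
  move=> sg; apply: ComplexField.Normc.eq0_normc; apply/eqP.
  rewrite eq_le normc_ge0 andbT.
  apply: (@geometric_le R `|B| 2%:R^-1).
    by rewrite invr_gt0 ltr0n/= invf_lt1 ?ltr1n.
  move=> n; rewrite add0r; set e := _ ^+ n.
  have e0 : 0 < e by rewrite exprn_gt0.
  have gD k (x : R) : is_derive x 1 (derive1n k g) (derive1n k.+1 g x).
    exact: (smooth_is_derive sg k x).1.
  have [p Hp] := @weierstrass_Cn R M (fun k => derive1n k g) K' e K'0 e0 gD.
  have [sp dp] := smooth_poly p.
  have [sd dd] := smooth_lin (-1) sp sg.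
  (* [T] kills the polynomial, so subtracting it costs nothing, while the difference is at most e
     with its first M derivatives on the segment that controls [T]. *)
  have -> : T (fun x => (g x)%:C) =
      T (fun x => -1 * (p.[x])%:C + (g x)%:C).
    by rewrite lin// distribution_poly// mulr0 add0r.
  rewrite (le_trans (HT _ sd e _))//; last first.
    by rewrite ler_wpM2r ?ler_norm// ltW.
  move=> k x kM xK; rewrite dd dp.
  have -> : cderiven k (fun x => (g x)%:C) x = (derive1n k g x)%:C.
    rewrite /cderiven /=; congr (_ +i* _).
    have := @derive1n_chain R k (fun _ _ => 0) (fun _ _ _ => is_derive_cst _ _ _) k (leqnn k).
    by move=> ->.
  rewrite mulN1r addrC -rmorphB normc_real; apply: Hp => //.
  by rewrite le_max xK.
have [sR sI] := smooth_real sf.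
have -> : f = (fun x => 'i%C * (complex.Im (f x))%:C + (complex.Re (f x))%:C).
  by apply/funext => x; rewrite addrC -complexE.
by rewrite lin// !real// mulr0 addr0.
Qed.

End distributions.

(** * Refinable distributions with equal normalization *)

Section uniqueness.
Context {R : realType}.
Notation C := R[i].
Notation normc := (@ComplexField.Normc.normc R).

(** As T(1) = 0, the transform at t is T applied to e^(-itx) - 1, a Taylor remainder of order 1. *)
Lemma fourier_small (T : (R -> C) -> C) : compact_distribution T ->
  fourier T 0 = 0 ->
  exists2 D : R, 0 <= D & forall t, `|t| <= 1 -> normc (fourier T t) <= D * `|t|.
Proof.
move=> cT T0; have [lin _] := cT.
have [B B0 /(_ 1%N) [D D0 HD]] := distribution_remainder cT.
exists (B * D); first exact: mulr_ge0.
move=> t t1; have := HD (- t); rewrite normrN expr1 mulrA => /(_ t1).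
suff -> : T (cis_remainder (- t) 1) = fourier T t by [].
have -> : cis_remainder (- t) 1 =
    (fun x => -1 * cis (- (x * 0)) + cis (- (x * t))).
  apply/funext => x; rewrite /cis_remainder big_ord_recl big_ord0 /= !expr0.
  by rewrite mulr0 oppr0 cis0 divr1 addr0 !mulr1 addrC mulNr mulrC.
rewrite lin; [|exact: smooth_cisN|exact: smooth_cisN].
by move: T0; rewrite /fourier => ->; rewrite mulr0 add0r.
Qed.

Variables (r : nat) (a : int -> 'M[C]_r).
Hypothesis fa : fin_supp a.
Notation A := (fun n => iter n (subdivision a) (dirac_id r)).

Lemma symbol_dirac t : symbol (@dirac_id R r) t = 1%:M.
Proof.
rewrite /symbol (@zsum1 _ 0) /dirac_id => [|k /negPf ->]; last by rewrite scaler0.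
by rewrite eqxx mul0r oppr0 cis0 scale1r.
Qed.

Lemma symbol_iter (D : R -> 'cV[C]_r) :
  (forall t, D (2%:R * t) = symbol a t *m D t) ->
  forall n t, symbol (A n) t *m D t = 2%:R ^+ n *: D (2%:R ^+ n * t).
Proof.
move=> HD; elim=> [|n IH] t /=.
  by rewrite symbol_dirac mul1mx expr0 scale1r mul1r.
rewrite symbol_subdivision//; last exact: fin_supp_iter_subdivision.
rewrite -scalemxAl -mulmxA -HD IH scalerA -exprS; congr (_ *: D _).
by rewrite mulrA -exprSr.
Qed.

Lemma symbol_bound (p q N : nat) (u : int -> 'M[C]_(p, q)) (B t : R) :
  supported_in N u -> (forall k, entry_norm (u k) <= B) ->
  entry_norm (symbol u t) <= (N.*2.+1)%:R * B.
Proof.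
move=> uN uB; apply: entry_norm_zsum => k; first by move=> /uN ->; rewrite scaler0.
by rewrite entry_normZ normc_cis mul1r.
Qed.

Lemma growth_mask (kappa : R) : 0 < kappa ->
  (forall u : int -> 'cV[C]_r, fin_supp u -> growth a u kappa) ->
  exists2 B : R, 0 <= B & forall n k, entry_norm (A n k) <= B * kappa ^+ n.
Proof.
move=> k0 Hg.
have He (i : 'I_r) := Hg _ (fin_supp_delta (delta_mx i 0 : 'cV[C]_r)).
pose B i := s2val (cid2 (He i)).
have B0 i : 0 <= B i by rewrite ltW// (s2valP (cid2 (He i))).
have HB i := s2valP' (cid2 (He i)).
exists (\sum_i B i); first exact: sumr_ge0.
move=> n k; apply/entry_norm_leP; first by rewrite mulr_ge0 ?sumr_ge0 ?exprn_ge0 ?(ltW k0).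
move=> x i; have := HB i n k; rewrite conv_delta => h.
have <- : (A n k *m delta_mx i (0 : 'I_1)) x 0 = A n k x i.
  by rewrite -colE mxE.
rewrite (le_trans (le_entry_norm _ _ _))// (le_trans h)//.
rewrite ler_wpM2r ?exprn_ge0 ?(ltW k0)// -/(B i) (bigD1 i)//= lerDl.
exact: sumr_ge0.
Qed.

(* D t = 2^-n symbol(A_n)(2^-n t) D(2^-n t), where the symbol of A_n is
   O((2 kappa)^n) and the last factor O(2^-n). *)
Lemma refinable_eq0 (D : R -> 'cV[C]_r) (kappa K : R) : 0 < kappa < 2%:R -> 0 <= K ->
  (forall u : int -> 'cV[C]_r, fin_supp u -> growth a u kappa) ->
  (forall t, D (2%:R * t) = symbol a t *m D t) ->
  (forall t, `|t| <= 1 -> entry_norm (D t) <= K * `|t|) ->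
  forall t, D t = 0.
Proof.
move=> /andP[k0 k2] K0 Hg HD Dt.
have [B B0 HB] := growth_mask k0 Hg.
have [N aN] := fa.
have small t : `|t| <= 1 -> D t = 0.
  move=> t1; apply: entry_norm_eq0; apply/eqP; rewrite eq_le entry_norm_ge0 andbT.
  apply: (@geometric_le R (r%:R * (N.*2.+1)%:R * B * K) (kappa / 2%:R)).
    by rewrite divr_gt0//= ltr_pdivrMr ?mul1r.
  move=> n; rewrite add0r.
  have p0 : 0 < (2%:R ^+ n : R) by rewrite exprn_gt0.
  pose y : R := 2%:R ^- n * t.
  have y1 : `|y| = 2%:R ^- n * `|t|.
    by rewrite normrM gtr0_norm// invr_gt0.
  have yle : `|y| <= 2%:R ^- n.
    by rewrite y1 ler_piMr// invr_ge0 ltW.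
  have -> : D t = (2%:R ^- n)%:C *: (symbol (A n) y *m D y).
    rewrite symbol_iter// scalerA /y mulrA divff ?gt_eqF// mul1r.
    have -> : (2%:R ^- n : R)%:C = 2%:R ^- n :> C.
      by rewrite fmorphV rmorphXn rmorph_nat.
    by rewrite mulVf ?scale1r// expf_neq0// pnatr_eq0.
  rewrite entry_normZ normc_real gtr0_norm ?invr_gt0//.
  have p1 : (2%:R ^- n : R) <= 1 by rewrite invf_le1// exprn_ege1// ler1n.
  have h1 := Dt y (le_trans yle p1).
  have h2 := symbol_bound y (iter_subdivision_supp (n := n) aN) (HB n).
  have h3 : (((2 ^ n).-1 * N).*2.+1)%:R <= 2%:R ^+ n * (N.*2.+1)%:R :> R.
    rewrite -natrX -natrM ler_nat; have := expn_gt0 2 n; nia.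
  have h4 : entry_norm (symbol (A n) y *m D y) <=
      r%:R * ((2%:R ^+ n * (N.*2.+1)%:R * (B * kappa ^+ n)) * (K * 2%:R ^- n)).
    rewrite (le_trans (entry_normM _ _))// ler_wpM2l//.
    rewrite ler_pM ?entry_norm_ge0//.
      rewrite (le_trans h2)// ler_wpM2r// mulr_ge0// exprn_ge0//.
      exact: ltW.
    by rewrite (le_trans h1)// ler_wpM2l.
  rewrite (le_trans (ler_wpM2l _ h4)) ?invr_ge0 ?(ltW p0)//.
  rewrite le_eqVlt; apply/orP; left; apply/eqP.
  by rewrite expr_div_n; field; rewrite gt_eqF.
(* The estimate covers |t| <= 1; the refinement equation carries the vanishing from t / 2 to t. *)
move=> t; have [M tM] : exists M : nat, `|t| <= 2%:R ^+ M.
  have [M hM] := window_of t.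
  exists M.
  by rewrite (le_trans (ltW hM))// -natrX ler_nat ltnW// ltn_expl.
elim: M t tM => [|M IH] t tM; first exact: small.
have -> : t = 2%:R * (t / 2%:R) by rewrite mulrC divfK.
rewrite HD IH ?mulmx0// normrM normfV (gtr0_norm (ltr0n _ 2%N))//.
by rewrite ler_pdivrMr// -exprSr.
Qed.

Lemma normalized_refinable_unique (v : int -> 'rV[C]_r) (kappa q : R) Phi Psi :
  0 < kappa < 2%:R -> 0 < q < 1 ->
  (forall u : int -> 'cV[C]_r, fin_supp u -> growth a u kappa) ->
  (forall y : 'cV[C]_r, pmom 1 v *m y = 0 -> exists B : R, forall n,
    entry_norm (iter n (mulmx (pmom 1 a)) y) <= B * q ^+ n) ->
  normalized_refinable a v Phi -> normalized_refinable a v Psi ->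
  forall i f, smooth f -> Phi i f = Psi i f.
Proof.
move=> k02 q01 Hg Hd [c1 r1 n1] [c2 r2 n2] i f sf.
pose T j g := Phi j g - Psi j g.
have cT j : compact_distribution (T j) by apply: distribution_sub.
have eT t : vec_fourier T t = vec_fourier Phi t - vec_fourier Psi t.
  by apply/matrixP => x y; rewrite !mxE.
have rT t : vec_fourier T (2%:R * t) = symbol a t *m vec_fourier T t.
  by rewrite !eT r1 r2 mulmxBr.
(* This vector is fixed by a^(0) and lies in the kernel of v^(0), on which the powers of a^(0)
   decay. *)
have T0 : vec_fourier T 0 = 0.
  have fixT : pmom 1 a *m vec_fourier T 0 = vec_fourier T 0.
    by rewrite -symbol_at0 -rT mulr0.
  have [|B HB] := Hd (vec_fourier T 0).
    by rewrite -symbol_at0 eT mulmxBr n1 n2 subrr.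
  apply: entry_norm_eq0; apply/eqP; rewrite eq_le entry_norm_ge0 andbT.
  apply: (@geometric_le R B q) => // n; rewrite add0r (le_trans _ (HB n))//.
  suff -> : iter n (mulmx (pmom 1 a)) (vec_fourier T 0) = vec_fourier T 0 by [].
  by elim: n => //= n ->.
have He j : exists2 D : R, 0 <= D & forall t, `|t| <= 1 -> normc (fourier (T j) t) <= D * `|t|.
  by apply: fourier_small => //; have /matrixP/(_ j 0) := T0; rewrite !mxE.
pose D j := s2val (cid2 (He j)).
have D0 j : 0 <= D j by exact: (s2valP (cid2 (He j))).
have HD j := s2valP' (cid2 (He j)).
have FT : forall t, vec_fourier T t = 0.
  apply: (@refinable_eq0 _ kappa (\sum_j D j)) => //; first exact: sumr_ge0.
  move=> t t1; apply/entry_norm_leP; first by rewrite mulr_ge0 ?sumr_ge0.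
  move=> j l; rewrite mxE (le_trans (HD j t t1))// ler_wpM2r//.
  by rewrite -/(D j) (bigD1 j)//= lerDl sumr_ge0.
apply/eqP; rewrite -subr_eq0; apply/eqP.
apply: (@distribution_eq0 _ (T i) f) => // t.
by have /matrixP/(_ i 0) := FT t; rewrite !mxE.
Qed.

End uniqueness.

(** * Convergence rates *)

Section assembly.
Context {R : realType}.
Notation C := R[i].

Lemma powR_half_nat (m : nat) : 2%:R `^ (- m%:R) = 2%:R ^- m :> R.
Proof. by rewrite powRN powR_mulrn. Qed.

Lemma powR_rate (e : R) (n : nat) :
  2%:R `^ (- (e * n%:R)) = (2%:R `^ (- e)) ^+ n :> R.
Proof. by rewrite -mulNr powRrM powR_mulrn// powR_ge0. Qed.

Lemma ld_le (m : nat) (w : R -> C) : (ld m w <= m)%N.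
Proof.
rewrite /ld; set l := [seq _ <- _ | _].
have : {subset l <= iota 0 m.+1} by move=> x; rewrite mem_filter => /andP[].
case: l => [//|x l] /(_ x); rewrite mem_head => /(_ isT).
by rewrite mem_iota add0n ltnS.
Qed.

Lemma cderiven_monomial (beta : C) (j l : nat) : l != j ->
  cderiven l (fun xi : R => beta * ('i%C * xi%:C) ^+ j) 0 = 0.
Proof.
move=> lj; have [sp dp] := @smooth_poly R 'X^j.
have [_ d0] := smooth_chain (fun _ (x : R) => is_cderive_cst (0 : C) x).
have [_ dl] := smooth_lin (beta * 'i%C ^+ j) sp (@smooth0 R).
have -> : (fun xi : R => beta * ('i%C * xi%:C) ^+ j) =
    (fun x => beta * 'i%C ^+ j * ('X^j.[x])%:C + 0).
  by apply/funext => x; rewrite addr0 hornerXn exprMn rmorphXn mulrA.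
rewrite dl dp d0 addr0 derivnXn hornerMn hornerXn.
have [jl|jl|/eqP] := ltngtP j l; last by rewrite eq_sym (negPf lj).
  by rewrite ffact_small// mulr0n mulr0.
by rewrite expr0n subn_eq0 leqNgt jl mul0rn mulr0.
Qed.

Variables (r : nat) (a : int -> 'M[C]_r).
Hypothesis fa : fin_supp a.
Notation A := (fun n => iter n (subdivision a) (dirac_id r)).

Lemma smoothness_data (m : nat) : (0 < sr a)%N ->
  (m%:R%:E < sm_infty a)%E -> (sm_infty a <= m.+1%:R%:E)%E ->
  exists s v, [/\ sm_infty a = s%:E, m%:R < s,
    [/\ fin_supp v, pmom 1 v != 0, matches a v (sr a) & kills a v (sr a)] &
    forall kappa u, 2%:R `^ (- s) < kappa -> annihilates v (sr a) u ->
      growth a u kappa].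
Proof.
move=> sr0 ms sm; have [s [es er]] := rho_sm (ltW ms) sm.
have [/sum_rulesP[//|fv v0 va vk] _] := sr_filterP sr0.
exists s, (sr_filter a); split => //; first by rewrite es lte_fin in ms.
move=> kappa u sk [fu uv]; apply: (@growth_rho _ _ _ fa (sr_filter a) (sr a)) => //.
- by rewrite (le_lt_trans _ sk)// powR_ge0.
- by rewrite er lte_fin.
- by apply/vanishing_spaceP.
Qed.

Section spectral_data.
Variables (m : nat) (s : R) (vs : int -> 'rV[C]_r) (J : nat).
Hypotheses (J0 : (0 < J)%N) (ms : m%:R < s).
Hypotheses (fvs : fin_supp vs) (vs0 : pmom 1 vs != 0).
Hypotheses (vsa : matches a vs J) (vsk : kills a vs J).
Hypothesis Hs : forall (kappa : R) u, 2%:R `^ (- s) < kappa ->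
  annihilates vs J u -> growth a u kappa.

Lemma kappa_exists : exists kappa : R, [/\ 0 < kappa, kappa < 2%:R ^- m &
  forall u, annihilates vs J u -> growth a u kappa].
Proof.
have h : 2%:R `^ (- s) < 2%:R ^- m :> R.
  by rewrite -powR_half_nat ltr_powR2// ltrN2.
have h0 : 0 <= 2%:R `^ (- s) :> R by rewrite powR_ge0.
exists ((2%:R `^ (- s) + 2%:R ^- m) / 2%:R); split; [lra|lra|].
by move=> u; apply: Hs; lra.
Qed.

(** The sum rules and the growth bounds come with the filter [vs] of order J. Being proportional to
    it up to order m + 1, any other matching filter has the same annihilated sequences at these
    orders and inherits both. *)
Lemma filter_data v : matching_filter a m.+1 v ->
  [/\ fin_supp v, pmom 1 v != 0, matches a v m.+1, kills a v m.+1 &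
  forall (kappa : R) j (u : int -> 'cV[C]_r),
  0 < kappa -> (j <= m.+1)%N -> 2%:R ^- j < kappa -> 2%:R `^ (- s) < kappa ->
  annihilates v j u -> growth a u kappa].
Proof.
move=> /(matching_filterP fa)[fv v0 va].
have [kap [k0 km Hk]] := kappa_exists.
have mJ : (m < J)%N := order_gt fa fvs vs0 J0 vsa k0 km Hk.
have [c c0 cv] := matching_scalar fa fvs vs0 mJ vsa k0 km Hk fv v0 va.
have vc : mom_eq m.+1 vs (fun k => c^-1 *: v k).
  apply: mom_eq_sym; have := mom_eqZ c^-1 fv (fin_suppZ (fun=> c) fvs) cv.
  by under [X in mom_eq _ _ X]eq_fun do rewrite scalerA mulVf// scale1r.
split=> //; first exact: (kills_congr fa fvs fv cv (mom_eqW mJ vsk)).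
move=> kappa j u kk jm jk sk vu.
apply: (@growth_order _ _ _ fa _ _ fvs vsa vsk _ kk _ j) => //.
- by move=> u'; apply: Hs.
- exact: leq_trans jm mJ.
- exact: (annihilates_congr fv fvs (mom_eqW jm vc)).
Qed.

End spectral_data.

Section one_filter.
Variables (m : nat) (s : R) (v : int -> 'rV[C]_r).
Hypotheses (ms : m%:R < s) (fv : fin_supp v) (v0 : pmom 1 v != 0).
Hypotheses (va : matches a v m.+1) (vk : kills a v m.+1).
Hypothesis Hgrow : forall (kappa : R) j (u : int -> 'cV[C]_r),
  0 < kappa -> (j <= m.+1)%N -> 2%:R ^- j < kappa -> 2%:R `^ (- s) < kappa ->
  annihilates v j u -> growth a u kappa.

Lemma powR_s_lt1 : 2%:R `^ (- s) < 1 :> R.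
Proof.
rewrite -[ltRHS](powRr0 2%:R) ltr_powR2// oppr_lt0.
exact: le_lt_trans ms.
Qed.

Lemma refinable_unique Phi Psi :
  normalized_refinable a v Phi -> normalized_refinable a v Psi ->
  forall i f, smooth f -> Phi i f = Psi i f.
Proof.
have s1 := powR_s_lt1; have s0 : 0 <= 2%:R `^ (- s) :> R by rewrite powR_ge0.
pose q : R := (Num.max (2%:R `^ (- s)) 2%:R^-1 + 1) / 2%:R.
have [q1 q2 q3] : [/\ q < 1, 2%:R `^ (- s) < q & 2%:R^-1 < q].
  by rewrite /q; case: (lerP (2%:R `^ (- s)) 2%:R^-1) => h; split; lra.
have q0 : 0 < q by rewrite (le_lt_trans s0).
(* A rate between 1 and 2 is wanted: above 1 = 2^-0 growth holds without any moment condition, and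
   below 2 the ratio kappa / 2 in [refinable_eq0] is less than 1. *)
apply: (@normalized_refinable_unique _ _ _ fa v (3%:R / 2%:R) q); [lra|lra| |].
  have h1 : 2%:R ^- 0 < 3%:R / 2%:R :> R by rewrite expr0 invr1; lra.
  have h2 : 2%:R `^ (- s) < 3%:R / 2%:R :> R by lra.
  move=> u fu; apply: (@Hgrow _ 0%N _ _ _ h1 h2) => //.
  by split=> // f; rewrite leqn0 size_poly_eq0 => /eqP ->; rewrite !pmom0l.
move=> y; apply: (iter_symbol_decay fa fv v0 (J := m.+1) q0) => u.
apply: Hgrow => //; rewrite (le_lt_trans _ q3)//.
by rewrite lef_pV2 ?posrE ?exprn_gt0// exprS ler_peMr// exprn_ege1// ler1n.
Qed.

Variables (d : int -> 'cV[C]_r) (L : nat -> R -> 'cV[C]_r) (D : R).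
Hypotheses (fd : fin_supp d) (vd : pmom 1 (convolution v d) = 1%:M).
Hypothesis LD : limit_family a m s d L D.

Lemma limit_normalized_refinable :
  normalized_refinable a v (distribution_of (L 0%N)).
Proof.
have [N aN] := fa; have [D0 _ cL] := LD.
have [B B0 HB] := fin_supp_bounded (fin_supp_conv (fin_supp_iter_subdivision 0 fa) fd).
apply: (@distribution_of_normalized_refinable _ _ _ _ _ N (B + D)) => //.
- move=> i; apply/ccsuppP; split; first exact: cL.
  by move=> x Nx; rewrite (limit_support ms fd LD (leq0n m) aN Nx) mxE.
- move=> x i; rewrite (le_trans (le_entry_norm _ _ _))//.
  have := limit_near LD 0 x; rewrite expr0 mulr1 => h.
  have -> : L 0%N x = convolution (A 0%N) d (dyfloor 0 x) -
    (convolution (A 0%N) d (dyfloor 0 x) - L 0%N x) by rewrite subKr.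
  by rewrite (le_trans (entry_normB _ _))// lerD// HB.
- exact: (refinement_equation fa ms fd LD).
- exact: (partition_of_unity fa fv va vk ms fd vd LD).
Qed.

Lemma limit_convergence u : (0 < r)%N -> fin_supp u ->
  let w := fun xi => (symbol v xi *m symbol u xi) 0 0 in
  let j := ld m w in
  let beta := cderiven j w 0 / ('i%C ^+ j * j`!%:R) in
  forall t : nat, (1 <= t)%N -> (t <= m.+1 - j)%N ->
  eqO (j + t) w (fun xi => beta * ('i%C * xi%:C) ^+ j) ->
  let nu := Num.min t%:R (s - j%:R) in
  0 < nu /\
  forall eps : R, 0 < eps -> eps < nu ->
  exists2 c : R, 0 < c &
    (forall n : nat, (0 < n)%N ->
       (linf_norm (fun k : int =>
          (2%:R ^+ (j * n) *: convolution (A n) u k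
          - beta *: mxderiven j (L 0%N) (2%:R ^- n * k%:~R))%R)
        <= (c * 2%:R `^ (- ((nu - eps) * n%:R)))%:E)%E) /\
    (forall (N : nat), (0 < N)%N -> supported_in N a -> supported_in N u ->
     forall (w0 : int -> 'rV[C]_r) (K : R), 0 < K ->
     let eta := fun x : R =>
       \sum_(k \in [set: int]) (w0 k *m L 0%N (x - k%:~R)) in
     let CK := \sum_(k \in [set k : int | `|k%:~R| <= K + N%:R])
                 entry_norm (w0 k) in
     forall n : nat, (0 < n)%N ->
     forall k : int, `|k%:~R| <= 2%:R ^+ n * K ->
       entry_norm
         ((2%:R ^+ (j * n)) *: convolution (iter n (subdivision a) w0) u k
          - beta *: mxderiven j eta (2%:R ^- n * k%:~R))
       <= c * CK * 2%:R `^ (- ((nu - eps) * n%:R))).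
Proof.
move=> r0 fu w j beta t t1 tm Hw nu.
have jm : (j <= m)%N by exact: ld_le.
have jt : (j + t <= m.+1)%N by rewrite -leq_subRL// leqW.
have dw l : cderiven l w 0 = (- 'i%C) ^+ l * pmom 'X^l (convolution v u) 0 0.
  rewrite -(cderiven_symbol0 l 0 0 (fin_supp_conv fv fu)).
  by congr (cderiven l _ 0); apply/funext => xi; rewrite symbol_conv.
have mom0 l : (l < j + t)%N -> l != j -> pmom 'X^l (convolution v u) = 0.
  move=> lt lj; apply/matrixP => x y; rewrite !ord1 [RHS]mxE.
  have /eqP := Hw l lt; rewrite cderiven_monomial// dw mulf_eq0.
  by rewrite (negPf (Ni_neq0 l)) => /eqP.
(* The quotient of (-i)^j by i^j is (-1)^j, so the constant of the statement is the one of
   [limit_rate]. *)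
have betaE : beta = pmom 'X^j (convolution v u) 0 0 / ((-1) ^+ j * j`!%:R).
  have i0 : 'i%C != 0 :> C.
    by have := @Ni_neq0 R 1; rewrite expr1 oppr_eq0.
  have XX := expf_neq0 j i0; have eV := @invr_sign C j.
  rewrite /beta dw [(- 'i%C) ^+ j]exprNn.
  move: (_ ^+ j) ('i%C ^+ j) (j`!%:R : C) (pmom _ _ _ _) XX eV => e X F P XX eV.
  rewrite invfM [in RHS]invfM eV.
  transitivity (X / X * (P * (e * F^-1))); last by rewrite divff// mul1r.
  by ring.
have js : 0 < s - j%:R by rewrite subr_gt0 (le_lt_trans _ ms)// ler_nat.
split; first by rewrite lt_min ltr0n t1.
move=> eps e0; rewrite lt_min => /andP[et es].
have nut : nu <= t%:R by rewrite ge_min lexx.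
have nus : nu <= s - j%:R by rewrite ge_min lexx orbT.
have nue : 0 < nu - eps by rewrite subr_gt0 lt_min et.
have e1 : nu - eps < t%:R by lra.
have e2 : nu - eps < s - j%:R by lra.
have [B B0] := limit_rate fa fv va vk ms Hgrow fd vd LD t1 jt fu mom0 nue e1 e2.
rewrite -betaE => HB.
have r1 : 1 <= r%:R :> R by rewrite ler1n.
(* The factor r is the cost of the product with [w0] in [limit_rate_general]; 1 is added because [B]
   may be 0. *)
exists (r%:R * (B + 1)); first by rewrite mulr_gt0// ?(lt_le_trans ltr01 r1)//; lra.
have p0 n : 0 <= (2%:R `^ (- (nu - eps)) : R) ^+ n by rewrite exprn_ge0// powR_ge0.
have HB' n k : entry_norm (scaled a j u n k - beta *: L j (2%:R ^- n * k%:~R)) <=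
    (B + 1) * (2%:R `^ (- (nu - eps))) ^+ n.
  by rewrite (le_trans (HB n k))// ler_wpM2r// lerDl.
split=> [n _|N _ aN uN w0 K K0 eta CK n _ k kK].
  apply: ub_ereal_sup => _ [k _ <-]; rewrite lee_fin powR_rate.
  rewrite (limit_mxderiven ms fd LD)// (le_trans (HB' n k))//.
  by rewrite ler_wpM2r// ler_peMl//; lra.
have X0 : 0 <= (B + 1) * (2%:R `^ (- (nu - eps))) ^+ n by rewrite mulr_ge0//; lra.
have := limit_rate_general fa ms fd LD (X := fun n => (B + 1) * (2%:R `^ (- (nu - eps))) ^+ n)
  w0 jm aN uN K0 X0 (HB' n) kK.
rewrite powR_rate -/CK; move=> h; rewrite (le_trans h)//.
by rewrite !mulrA mulrAC.
Qed.
End one_filter.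
End assembly.

Unset Implicit Arguments.

Theorem theorem3 (R : realType) (r : nat) (r_gt0 : (0 < r)%N)
    (a : int -> 'M[R[i]]_r) (a_fin : fin_supp a)
    (* excludes masks such as a = delta/4, for which sr a = 0, sm_infty a = 1
       and 1 is not an eigenvalue of the symbol at 0 *)
    (sr_gt0 : (0 < sr a)%N)
    (m : nat) (m_lt_sm : (m%:R%:E < sm_infty a)%E)
    (sm_le_m1 : (sm_infty a <= m.+1%:R%:E)%E) :
  (* spectral properties of the symbol of a at 0 *)
  [/\ mup 1 (char_poly (symbol a 0)) = 1%N,
      forall z : R[i], eigenvalue (symbol a 0) z -> z != 1 ->
        ComplexField.Normc.normc z < 2%:R ^- m,
  (* existence, values at 0 and essential uniqueness of the matching filter *)
      exists v, matching_filter a m.+1 v,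
      (forall v : int -> 'rV[R[i]]_r, fin_supp v ->
        (matching_filter a m.+1 v <->
         [/\ symbol v 0 != 0,
             symbol v 0 *m symbol a 0 = symbol v 0 &
             forall j, (1 <= j <= m)%N ->
               1%:M - 2%:R ^+ j *: symbol a 0 \in unitmx /\
               mxderiven j (symbol v) 0 =
               \sum_(0 <= k < j)
                 ((2%:R ^+ k * j`!%:R) / (k`!%:R * (j - k)`!%:R)) *:
                 (mxderiven k (symbol v) 0 *m mxderiven (j - k) (symbol a) 0
                   *m invmx (1%:M - 2%:R ^+ j *: symbol a 0))])) /\
      (forall v v', matching_filter a m.+1 v -> matching_filter a m.+1 v' ->
         exists2 c : R[i], c != 0 & forall j, (j <= m)%N ->
           mxderiven j (symbol v') 0 = c *: mxderiven j (symbol v) 0) &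
  (* the refinable function and the convergence rates *)
      forall v : int -> 'rV[R[i]]_r, matching_filter a m.+1 v ->
      exists phi : R -> 'cV[R[i]]_r,
        [/\ normalized_refinable a v (distribution_of phi),
            forall Phi, normalized_refinable a v Phi ->
              forall i f, smooth f -> Phi i f = distribution_of phi i f,
            exists K : R, forall x, K < `|x| -> phi x = 0,
            forall i, class_C m (fun x => phi x i 0) &
            forall u : int -> 'cV[R[i]]_r, fin_supp u ->
            let w := fun xi => (symbol v xi *m symbol u xi) 0 0 in
            let j := ld m w in
            let beta := cderiven j w 0 / ('i%C ^+ j * j`!%:R) in
            forall s : nat, (1 <= s)%N -> (s <= m.+1 - j)%N ->
            eqO (j + s) w (fun xi => beta * ('i%C * xi%:C) ^+ j) ->
            let nu := Num.min s%:R (fine (sm_infty a) - j%:R) in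
            0 < nu /\
            forall eps : R, 0 < eps -> eps < nu ->
            exists2 C : R, 0 < C &
              (forall n : nat, (0 < n)%N ->
                 (linf_norm (fun k : int =>
                    (2%:R ^+ (j * n) *:
                      convolution (iter n (subdivision a) (dirac_id r)) u k
                    - beta *: mxderiven j phi (2%:R ^- n * k%:~R))%R)
                  <= (C * 2%:R `^ (- ((nu - eps) * n%:R)))%:E)%E) /\
              (forall (N : nat), (0 < N)%N -> supported_in N a ->
                 supported_in N u ->
               forall (w0 : int -> 'rV[R[i]]_r) (K : R), 0 < K ->
               let eta := fun x : R =>
                 \sum_(k \in [set: int]) (w0 k *m phi (x - k%:~R)) in
               let CK := \sum_(k \in [set k : int | `|k%:~R| <= K + N%:R])
                           entry_norm (w0 k) in
               forall n : nat, (0 < n)%N ->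
               forall k : int, `|k%:~R| <= 2%:R ^+ n * K ->
                 entry_norm
                   ((2%:R ^+ (j * n)) *:
                      convolution (iter n (subdivision a) w0) u k
                    - beta *: mxderiven j eta (2%:R ^- n * k%:~R))
                 <= C * CK * 2%:R `^ (- ((nu - eps) * n%:R)))]].

Proof.
have [s [vs [es ms [fvs vs0 vsa vsk] Hs]]] := smoothness_data a_fin sr_gt0 m_lt_sm sm_le_m1.
have [kap [k0 km Hk]] := kappa_exists ms Hs.
have mJ : (m < sr a)%N := order_gt a_fin fvs vs0 sr_gt0 vsa k0 km Hk.
have Hu := unit_symbol a_fin fvs vs0 sr_gt0 vsa k0 km Hk.
have scal v : matching_filter a m.+1 v ->
    exists2 c : R[i], c != 0 & mom_eq m.+1 v (fun k => c *: vs k).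
  move=> /(matching_filterP a_fin)[fv v0 va].
  exact: (matching_scalar a_fin fvs vs0 mJ vsa k0 km Hk fv v0 va).
rewrite symbol_at0; split.
- exact: (mup_symbol a_fin fvs vs0 sr_gt0 vsa k0 km Hk).
- exact: (eigenvalue_symbol a_fin fvs vs0 sr_gt0 vsa k0 km Hk).
(* The filter of order [sr a] qualifies because [sr a] exceeds m. *)
- exists vs; apply/(matching_filterP a_fin); split => //.
  exact: mom_eqW mJ vsa.
- split; first by move=> v fv; rewrite -symbol_at0; exact: matching_values.
  move=> v v' Hv Hv'; have [c c0 vc] := scal v Hv; have [c' c'0 vc'] := scal v' Hv'.
  have [fv _ _] := Hv; have [fv' _ _] := Hv'.
  exists (c' / c); first by rewrite mulf_neq0// invr_eq0.
  move=> j jm; rewrite !mxderiven_symbol0//.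
  have sX : (size ('X^j : {poly R[i]}) <= m.+1)%N by rewrite size_polyXn ltnS.
  rewrite (vc' _ sX) (vc _ sX) !pmomZr// !scalerA; congr (_ *: _).
  by rewrite [c' / c * _]mulrC -mulrA divfK.
move=> v Hv.
have [fv v0 va vk Hg] := filter_data a_fin sr_gt0 ms fvs vs0 vsa vsk Hs Hv.
have [z vz] := right_inverse v0.
pose d : int -> 'cV[R[i]]_r := fun k => if k == 0 then z else 0.
have fd : fin_supp d by exact: fin_supp_delta.
have vd : pmom 1 (convolution v d) = 1%:M.
  by rewrite pmom1_conv// pmom_delta hornerC scale1r.
have [L [D LD]] := limit_family_exists a_fin fv va vk ms Hg fd.
have NR := limit_normalized_refinable a_fin ms fv va vk fd vd LD.
exists (L 0%N); split => //.
- by move=> Phi NP; exact: (refinable_unique a_fin ms fv v0 Hg NP NR).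
- have [N aN] := a_fin; exists N%:R => x Nx.
  exact: (limit_support ms fd LD (leq0n m) aN Nx).
- exact: (limit_class_C ms fd LD).
- move=> u fu; rewrite es /=.
  exact: (limit_convergence a_fin ms fv va vk Hg fd vd LD r_gt0 fu).
Qed.
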